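(* The linear map $\varphi:\widehat{\mathcal G}(\mathcal J)\to\widehat{\mathcal C}_{\mathfrak g}[\sigma]$ given, for $m,n\in\mathbb Z$ and $s\in\mathbb Z^\times$, by $$x_+(2m+j,2n+k)\mapsto\begin{cases}2\big((E_{1,3}\otimes t_2^n)^{(j)}\big)(m+\tfrac j2),&k=0,\ j\in\{0,1\},\\ \sqrt{-1}\big(((E_{1,2}-E_{4,3})\otimes t_2^{n+1})^{(0)}\big)(m),&k=1,\ j=0,\end{cases}$$ $$x_-(2m+j,2n+k)\mapsto\begin{cases}2\big((E_{3,1}\otimes t_2^n)^{(j)}\big)(m+\tfrac j2),&k=0,\ j\in\{0,1\},\\ -\sqrt{-1}\big(((E_{2,1}-E_{3,4})\otimes t_2^{n})^{(0)}\big)(m),&k=1,\ j=0,\end{cases}$$ $$\alpha^\vee(2m+j,2n+k)\mapsto\begin{cases}2\big(((E_{1,1}-E_{3,3})\otimes t_2^n)^{(j)}\big)(m+\tfrac j2),&k=0,\ j\in\{0,1\},\\ 2\sqrt{-1}\big(((E_{1,4}+E_{2,3})\otimes t_2^{n})^{(j)}\big)(m+\tfrac j2),&k=1,\ j\in\{0,1\},\end{cases}$$ $$C_1(2m,2n)\mapsto\tfrac12(t_2^n\mathbf k_1)(m-1),\quad C_2(2m,0)\mapsto\tfrac12\mathbf k_2(m),\quad C_2(2m,2s)\mapsto-\tfrac m{2s}(t_2^s\mathbf k_1)(m-1)$$ is a Lie algebra isomorphism.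
   Context: All vector spaces are over $\mathbb C$; $\mathbb Z^\times=\mathbb Z\setminus\{0\}$; $\mathrm{tr}$ is the matrix trace. **The baby TKK algebra.** Let $e_1=(1,0)$, $e_2=(0,1)$, $S_0=2\mathbb Z^2$, $S_1=e_1+2\mathbb Z^2$, $S_2=e_2+2\mathbb Z^2$, $S=S_0\cup S_1\cup S_2$, $S^\perp=\mathbb Z^2\setminus S$. $\mathcal J=\bigoplus_{\rho\in S}\mathbb C x^\rho$ is the Jordan algebra with $x^\rho\cdot x^\tau=x^{\rho+\tau}$ if $\rho+\tau\in S$ and $0$ otherwise. $L_a$ is multiplication by $a$. $\langle\mathcal J,\mathcal J\rangle$ is the quotient of $\mathcal J\otimes\mathcal J$ by the span of all $a\otimes b+b\otimes a$ and $a\cdot b\otimes c+b\cdot c\otimes a+c\cdot a\otimes b$; $\langle a,b\rangle$ is the image of $a\otimes b$. $\widehat{\mathcal G}(\mathcal J)=(\mathfrak{sl}_2\otimes\mathcal J)\oplus\langle\mathcal J,\mathcal J\rangle$ is the Lie algebra with $[A\otimes a,B\otimes b]=[A,B]\otimes ab+2\mathrm{tr}(AB)\langle a,b\rangle$, $[\langle a,b\rangle,A\otimes c]=A\otimes[L_a,L_b]c$, $[\langle a,b\rangle,\langle c,d\rangle]=\langle[L_a,L_b]c,d\rangle+\langle c,[L_a,L_b]d\rangle$. Let $x_+,x_-,\alpha^\vee$ be the standard basis of $\mathfrak{sl}_2$ ($[x_+,x_-]=\alpha^\vee$, $[\alpha^\vee,x_\pm]=\pm2x_\pm$). For $\rho=(m,n)\in\mathbb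 Z^2$: $x_\pm(m,n)=x_\pm\otimes x^\rho$ if $\rho\in S$ and $0$ otherwise; $\alpha^\vee(m,n)=\alpha^\vee\otimes x^\rho$ if $\rho\in S$ and $2\langle x^{e_1},x^{\rho-e_1}\rangle$ if $\rho\in S^\perp$; $C_i(m,n)=\langle x^{e_i},x^{\rho-e_i}\rangle$ if $\rho\in S_0$ and $0$ otherwise ($i=1,2$). These elements span $\widehat{\mathcal G}(\mathcal J)$; the $C_i(m,n)$ are central, and the only linear relations among the $x_\pm(\rho)$ ($\rho\in S$), $\alpha^\vee(\tau)$ ($\tau\in\mathbb Z^2$), $C_i(\upsilon)$ ($\upsilon\in S_0$) are $\upsilon_1C_1(\upsilon)+\upsilon_2C_2(\upsilon)=0$ for $\upsilon=(\upsilon_1,\upsilon_2)\in S_0$. **The Lie conformal algebra $\mathcal C_{\mathfrak g}$.** Realize $\mathfrak{sp}_4$ with basis $E_{1,1}-E_{3,3}$, $E_{2,2}-E_{4,4}$, $E_{1,3}$, $E_{3,1}$, $E_{2,4}$, $E_{4,2}$, $E_{1,2}-E_{4,3}$, $E_{2,1}-E_{3,4}$, $E_{1,4}+E_{2,3}$, $E_{4,1}+E_{3,2}$ ($E_{i,j}$ elementary $4\times4$ matrices). Let $\mathfrak g=(\mathfrak{sp}_4\otimes\mathbb C[t_2^{\pm1}])\oplus\mathbb C\mathbf k_2\oplus\bigoplus_{s\in\mathbb Z^\times}\mathbb C\,t_2^s\mathbf k_1$ and $\mathcal C_{\mathfrak g}=(\mathbb C[D]\otimes\mathfrak g)\oplus\mathbb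 C\mathbf k_1$ ($D$ an indeterminate; $t_2^0\mathbf k_1:=\mathbf k_1$; $\mathfrak g$ identified with $1\otimes\mathfrak g$). Put $\partial(D^n\otimes a)=D^{n+1}\otimes a$, $\partial\mathbf k_1=0$. The Lie conformal algebra structure $Y_-(a,z)=\sum_{n\ge0}a_nz^{-n-1}$ is the unique one with $[\partial,Y_-(a,z)]=\frac{d}{dz}Y_-(a,z)=Y_-(\partial a,z)$, $Y_-(\mathbf k_1,z)=Y_-(\mathbf k_2,z)=Y_-(t_2^s\mathbf k_1,z)=0$, and $(x\otimes t_2^m)_0(y\otimes t_2^{m'})=[x,y]\otimes t_2^{m+m'}+\frac{m}{m+m'}\mathrm{tr}(xy)D\otimes t_2^{m+m'}\mathbf k_1$ if $m+m'\ne0$, $=[x,y]\otimes1+m\,\mathrm{tr}(xy)\mathbf k_2$ if $m+m'=0$; $(x\otimes t_2^m)_1(y\otimes t_2^{m'})=\mathrm{tr}(xy)t_2^{m+m'}\mathbf k_1$; $(x\otimes t_2^m)_n(y\otimes t_2^{m'})=0$ for $n>1$. **The involution $\sigma$** of $\mathcal C_{\mathfrak g}$ is linear, commutes with $\partial$, fixes $\mathbf k_1,\mathbf k_2,t_2^s\mathbf k_1$, and for $n\in\mathbb Z$: $(E_{1,1}-E_{3,3})\otimes t_2^n\mapsto(E_{4,4}-E_{2,2})\otimes t_2^n+\kappa_n$, $(E_{2,2}-E_{4,4})\otimes t_2^n\mapsto(E_{3,3}-E_{1,1})\otimes t_2^n+\kappa_n$, where $\kappa_0=\mathbf k_2$,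 $\kappa_n=\frac1nD\otimes t_2^n\mathbf k_1$ ($n\ne0$); $(E_{1,2}-E_{4,3})\otimes t_2^n$ and $(E_{2,1}-E_{3,4})\otimes t_2^n$ are fixed; $(E_{1,4}+E_{2,3})\otimes t_2^n\mapsto-(E_{4,1}+E_{3,2})\otimes t_2^{n+1}$; $(E_{4,1}+E_{3,2})\otimes t_2^n\mapsto-(E_{1,4}+E_{2,3})\otimes t_2^{n-1}$; $E_{1,3}\otimes t_2^n\mapsto E_{4,2}\otimes t_2^{n+1}$; $E_{3,1}\otimes t_2^n\mapsto E_{2,4}\otimes t_2^{n-1}$; $E_{2,4}\otimes t_2^n\mapsto E_{3,1}\otimes t_2^{n+1}$; $E_{4,2}\otimes t_2^n\mapsto E_{1,3}\otimes t_2^{n-1}$. It is an automorphism of the Lie conformal algebra $\mathcal C_{\mathfrak g}$ of order $2$. **The twisted Lie algebra.** For $r\in\mathbb Z$ put $\mathcal C_{\mathfrak g}^{(r)}=\{a\in\mathcal C_{\mathfrak g}\mid\sigma(a)=(-1)^ra\}$ and, for $a\in\mathcal C_{\mathfrak g}$, $a^{(r)}=\frac12(a+(-1)^r\sigma(a))\in\mathcal C_{\mathfrak g}^{(r)}$. Then $\widehat{\mathcal C}_{\mathfrak g}[\sigma]=\bigoplus_{r\in\mathbb Z}(\mathcal C_{\mathfrak g}^{(r)}\otimes t^{r/2})/\mathrm{Image}(\partial\otimes1+1\otimes\frac{d}{dt})$, where $a(\frac r2)$ denotes the class of $a\otimes t^{r/2}$, with Lie bracket $[a(\frac r2),b(\frac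 s2)]=\sum_{i\ge0}\binom{r/2}{i}(a_ib)(\frac{r+s}2-i)$ for $a\in\mathcal C_{\mathfrak g}^{(r)}$, $b\in\mathcal C_{\mathfrak g}^{(s)}$. *)

(* Defs.v *)
From HB Require Import structures.
From mathcomp Require Import all_boot all_order all_algebra.
From mathcomp Require Import generic_quotient finmap.
From mathcomp Require Import boolp classical_sets functions cardinality fsbigop.

Set Implicit Arguments.
Unset Strict Implicit.
Unset Printing Implicit Defensive.

Import GRing.Theory Num.Theory.

Local Open Scope classical_set_scope.
Local Open Scope ring_scope.
Local Open Scope quotient_scope.

Section FinSupp.
Variables (F : fieldType) (K : choiceType) (V : lmodType F).

Definition fin_supp : {pred K -> V} :=
  fun f => `[< finite_set [set k | f k != 0] >].

(* The direct sum of copies of V indexed by K; with V := F^o it is the vector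
   space with basis K. *)
Record finsupp := Finsupp { fsval :> K -> V; _ : fsval \in fin_supp }.

HB.instance Definition _ := [isSub for fsval].
HB.instance Definition _ := [Choice of finsupp by <:].

Lemma fin_supp_submod : submod_closed fin_supp.
Proof.
split=> [|a f g].
  apply/asboolP; apply: sub_finite_set (finite_set0 K) => k /=.
  by rewrite eqxx.
move=> /asboolP Hf /asboolP Hg; apply/asboolP.
apply: (@sub_finite_set _ _ ([set k | f k != 0] `|` [set k | g k != 0])).
  move=> k /= Hk; apply: contrapT => /not_orP[/negP]; rewrite negbK => /eqP fk.
  move=> /negP; rewrite negbK => /eqP gk; move: Hk.
  by rewrite !fctE fk gk scaler0 addr0 eqxx.
by rewrite finite_setU.
Qed.

HB.instance Definition _ :=
  GRing.isSubmodClosed.Build F (K -> V) fin_supp fin_supp_submod.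
HB.instance Definition _ := [SubChoice_isSubLmodule of finsupp by <:].

Lemma single_subproof k v : (fun k' => if k' == k then v else 0) \in fin_supp.
Proof.
apply/asboolP; apply: (@sub_finite_set _ _ [set k]) => // k' /=.
by case: (k' =P k) => // _; rewrite eqxx.
Qed.

Definition single k v : finsupp := Finsupp (single_subproof k v).

Lemma fin_suppP (u : finsupp) : finite_set [set k | u k != 0].
Proof. by case: u => u /= /asboolP. Qed.

Lemma fs_scaleD a (u v : finsupp) k : (a *: u + v) k = a *: u k + v k.
Proof. by []. Qed.

Lemma fs_ext (u v : finsupp) : u =1 v -> u = v.
Proof. by move=> uv; apply/val_inj/funext. Qed.

End FinSupp.

Section LinearExtension.
Variables (F : fieldType) (K : choiceType) (W : lmodType F).

Definition lext (f : K -> W) (u : finsupp K F^o) : W :=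
  \sum_(k \in [set: K]) (u k : F) *: f k.

Lemma lextE f (u : finsupp K F^o) (A : {fset K}) : (forall k, k \notin A -> u k = 0) ->
  lext f u = \sum_(k <- A) (u k : F) *: f k.
Proof. by move=> uA; apply: fsbigTE => k /uA ->; rewrite scale0r. Qed.

Lemma lext_is_linear f : linear (lext f).
Proof.
move=> a u v.
have fu := fin_suppP u; have fv := fin_suppP v.
pose A := (fset_set [set k | u k != 0%R] `|` fset_set [set k | v k != 0%R])%fset.
have uA k : k \notin A -> u k = 0.
  rewrite !inE negb_or !in_fset_set // => /andP[/negP nu _]; apply/eqP.
  by apply: contra_notT nu => nu; rewrite inE.
have vA k : k \notin A -> v k = 0.
  rewrite !inE negb_or !in_fset_set // => /andP[_ /negP nu]; apply/eqP.
  by apply: contra_notT nu => nu; rewrite inE.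
have wA k : k \notin A -> (a *: u + v) k = 0.
  by move=> kA; rewrite fs_scaleD uA // vA // scaler0 addr0.
rewrite (lextE f uA) (lextE f vA) (lextE f wA) scaler_sumr -big_split.
by apply: eq_bigr => k _; rewrite /= scalerA -scalerDl.
Qed.

HB.instance Definition _ f :=
  GRing.isLinear.Build F (finsupp K F^o) W *:%R (lext f) (lext_is_linear f).

Lemma lext_single f k : lext f (single k 1) = f k.
Proof.
rewrite (@lextE _ _ [fset k]%fset); first by rewrite big_seq_fset1 /= eqxx scale1r.
by move=> k'; rewrite inE /= => /negbTE ->.
Qed.

Lemma lext_linE (f : {linear finsupp K F^o -> W}) u :
  f u = lext (fun k => f (single k 1)) u.
Proof.
have fu := fin_suppP u; pose A := fset_set [set k | u k != 0].
have uA k : k \notin A -> u k = 0.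
  rewrite in_fset_set // => /negP nu; apply/eqP.
  by apply: contra_notT nu => nu; rewrite inE.
rewrite (lextE _ uA) -[in LHS](_ : \sum_(k <- A) (u k : F) *: single k 1 = u).
  by rewrite linear_sum; apply: eq_bigr => k _; rewrite linearZ.
apply: fs_ext => k; rewrite -[LHS]/(val _ k) raddf_sum fct_sumE.
have sE j : val ((u j : F) *: single j (1 : F^o)) k = if k == j then u j else 0.
  rewrite -[LHS]/((u j : F) * (if k == j then 1 else 0)).
  by case: eqP; rewrite ?mulr1 ?mulr0.
rewrite (eq_bigr _ (fun j _ => sE j)).
have [kA|kA] := boolP (k \in A).
  rewrite (big_fsetD1 k kA) /= eqxx big_seq big1 ?addr0 // => j.
  by rewrite !inE eq_sym => /andP[/negbTE -> _].
rewrite uA // big_seq big1 // => j jA.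
by case: eqP kA => // ->; rewrite jA.
Qed.

Lemma eq_lin (f g : {linear finsupp K F^o -> W}) :
  (forall k, f (single k 1) = g (single k 1)) -> f =1 g.
Proof.
by move=> fg u; rewrite (lext_linE f) (lext_linE g); congr (lext _ u); apply/funext.
Qed.

End LinearExtension.

Section Quotient.
Variables (F : fieldType) (V : lmodType F).

Inductive lspan (G : set V) : V -> Prop :=
| lspan0 : lspan G 0
| lspan_gen v : G v -> lspan G v
| lspanP a u v : lspan G u -> lspan G v -> lspan G (a *: u + v).

Variable G : set V.

Definition modspan : rel V := fun u v => `[< lspan G (u - v) >].

Lemma lspanZ a u : lspan G u -> lspan G (a *: u).
Proof. by move=> Gu; rewrite -[_ *: _]addr0; apply: lspanP => //; apply: lspan0. Qed.

Lemma lspanD u v : lspan G u -> lspan G v -> lspan G (u + v).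
Proof. by move=> *; rewrite -[u]scale1r; apply: lspanP. Qed.

Lemma modspan_equiv : equiv_class_of modspan.
Proof.
split=> [u|u v|v u w].
- by apply/asboolP; rewrite subrr; apply: lspan0.
- by apply/asbool_equiv_eq; split=> /(lspanZ (-1)); rewrite scaleN1r opprB.
- move=> /asboolP uv /asboolP vw; apply/asboolP.
  by rewrite -(subrKA v); apply: lspanD.
Qed.

Canonical modspan_equiv_rel := EquivRelPack modspan_equiv.

(* V / span G *)
Definition quot := {eq_quot modspan}.
HB.instance Definition _ := Choice.on quot.
HB.instance Definition _ := EqQuotient.on quot.

Definition qcls (v : V) : quot := \pi_quot v.

Lemma qclsP u v : reflect (lspan G (u - v)) (qcls u == qcls v).
Proof. by rewrite /qcls piE /=; exact: asboolP. Qed.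

Lemma qcls_eq u v : lspan G (u - v) -> qcls u = qcls v.
Proof. by move=> uv; apply/eqP/qclsP. Qed.

Lemma qcls_repr q : qcls (repr q) = q.
Proof. exact: reprK. Qed.

Lemma repr_qcls v : lspan G (repr (qcls v) - v).
Proof. by apply/qclsP; rewrite qcls_repr. Qed.

Definition qadd (p q : quot) := qcls (repr p + repr q).
Definition qopp (p : quot) := qcls (- repr p).
Definition qscale (a : F) (p : quot) := qcls (a *: repr p).

Lemma qaddE u v : qadd (qcls u) (qcls v) = qcls (u + v).
Proof.
apply: qcls_eq; rewrite opprD addrACA.
by apply: lspanD; apply: repr_qcls.
Qed.

Lemma qoppE u : qopp (qcls u) = qcls (- u).
Proof.
have := lspanZ (-1) (repr_qcls u); rewrite scaleN1r opprD => ?.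
exact: qcls_eq.
Qed.

Lemma qscaleE a u : qscale a (qcls u) = qcls (a *: u).
Proof. by apply: qcls_eq; rewrite -scalerBr; apply/lspanZ/repr_qcls. Qed.

Lemma quotW (P : quot -> Prop) : (forall v, P (qcls v)) -> forall q, P q.
Proof. by move=> PV q; rewrite -[q]qcls_repr. Qed.

Lemma qaddA : associative qadd.
Proof. by elim/quotW=> u; elim/quotW=> v; elim/quotW=> w; rewrite !qaddE addrA. Qed.
Lemma qaddC : commutative qadd.
Proof. by elim/quotW=> u; elim/quotW=> v; rewrite !qaddE addrC. Qed.
Lemma qadd0 : left_id (qcls 0) qadd.
Proof. by elim/quotW=> u; rewrite qaddE add0r. Qed.
Lemma qaddN : left_inverse (qcls 0) qopp qadd.
Proof. by elim/quotW=> u; rewrite qoppE qaddE addNr. Qed.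

HB.instance Definition _ := GRing.isZmodule.Build quot qaddA qaddC qadd0 qaddN.

Lemma qclsD u v : qcls u + qcls v = qcls (u + v).
Proof. exact: qaddE. Qed.

Lemma qscaleA a b q : qscale a (qscale b q) = qscale (a * b) q.
Proof. by elim/quotW: q => u; rewrite !qscaleE scalerA. Qed.
Lemma qscale1 : left_id 1 qscale.
Proof. by elim/quotW=> u; rewrite qscaleE scale1r. Qed.
Lemma qscaleDr : right_distributive qscale +%R.
Proof.
by move=> a; elim/quotW=> u; elim/quotW=> v; rewrite qclsD !qscaleE qclsD scalerDr.
Qed.
Lemma qscaleDl q : {morph qscale^~ q : a b / a + b}.
Proof. by elim/quotW: q => u a b; rewrite !qscaleE qclsD scalerDl. Qed.

HB.instance Definition _ :=
  GRing.Zmodule_isLmodule.Build F quot qscaleA qscale1 qscaleDr qscaleDl.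

Lemma qcls_is_linear : linear qcls.
Proof. by move=> a u v; rewrite -qclsD; congr (_ + _); rewrite -qscaleE. Qed.

HB.instance Definition _ :=
  GRing.isLinear.Build F V quot *:%R qcls qcls_is_linear.

End Quotient.

Definition e1 : int * int := (1, 0).
Definition e2 : int * int := (0, 1).

Definition inS0 (r : int * int) : bool := (2 %| r.1)%Z && (2 %| r.2)%Z.
Definition inS1 (r : int * int) : bool := inS0 (r - e1).
Definition inS2 (r : int * int) : bool := inS0 (r - e2).
Definition inS (r : int * int) : bool := [|| inS0 r, inS1 r | inS2 r].

Definition idxS : Type := {r : int * int | inS r}.
HB.instance Definition _ := Choice.on idxS.

Variant sl2b := Xp | Xm | Av.

Definition sl2b_code (b : sl2b) : nat :=
  match b with Xp => 0 | Xm => 1 | Av => 2 end.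
Definition sl2b_decode (n : nat) : option sl2b :=
  onth [:: Xp; Xm; Av] n.
Lemma sl2b_codeK : pcancel sl2b_code sl2b_decode. Proof. by case. Qed.
HB.instance Definition _ := Countable.copy sl2b (pcan_type sl2b_codeK).
Lemma sl2b_enumP : Finite.axiom [:: Xp; Xm; Av]. Proof. by case. Qed.
HB.instance Definition _ := isFinite.Build sl2b sl2b_enumP.

(* XHi stands for E_{i,i} - E_{i+2,i+2}, and Xij for the basis element of sp_4
   whose entry (i,j) is 1 and which is the only one with a nonzero entry
   there. *)
Variant sp4b := XH1 | XH2 | X13 | X31 | X24 | X42 | X12 | X21 | X14 | X41.

Definition sp4b_seq := [:: XH1; XH2; X13; X31; X24; X42; X12; X21; X14; X41].
Definition sp4b_code (b : sp4b) : nat :=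
  match b with
  | XH1 => 0 | XH2 => 1 | X13 => 2 | X31 => 3 | X24 => 4
  | X42 => 5 | X12 => 6 | X21 => 7 | X14 => 8 | X41 => 9
  end.
Definition sp4b_decode (n : nat) : option sp4b := onth sp4b_seq n.
Lemma sp4b_codeK : pcancel sp4b_code sp4b_decode. Proof. by case. Qed.
HB.instance Definition _ := Countable.copy sp4b (pcan_type sp4b_codeK).
Lemma sp4b_enumP : Finite.axiom sp4b_seq. Proof. by case. Qed.
HB.instance Definition _ := isFinite.Build sp4b sp4b_enumP.

Definition mxlie (F : fieldType) n (A B : 'M[F]_n) : 'M[F]_n :=
  A *m B - B *m A.

(* Matrix units and entries, with rows and columns numbered from 1. *)
Definition Emx (F : fieldType) n (i j : nat) : 'M[F]_n :=
  \matrix_(k, l) ((k.+1 == i) && (l.+1 == j))%:R.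
Definition entry (F : fieldType) n (A : 'M[F]_n.+1) (i j : nat) : F :=
  A (inord i.-1) (inord j.-1).

Section TKK.
Variable F : numFieldType.

Definition J : Type := finsupp idxS F^o.
HB.instance Definition _ := GRing.Lmodule.on J.

(* x^r, extended by 0 to r outside S *)
Definition xJ (r : int * int) : J :=
  if insub r is Some s then single s 1 else 0.

Definition mulJ (a b : J) : J :=
  lext (fun r => lext (fun t => xJ (val r + val t)) b) a.

Definition commL (a b c : J) : J := mulJ a (mulJ b c) - mulJ b (mulJ a c).

(* J tensor J, with basis the x^r tensor x^t *)
Definition JtJ : Type := finsupp (idxS * idxS)%type F^o.
HB.instance Definition _ := GRing.Lmodule.on JtJ.

Definition tensJ (a b : J) : JtJ :=
  lext (fun r => lext (fun t => single (r, t) 1) b) a.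

Definition relJ : set JtJ := [set w |
  (exists a b, w = tensJ a b + tensJ b a) \/
  (exists a b c,
     w = tensJ (mulJ a b) c + tensJ (mulJ b c) a + tensJ (mulJ c a) b)].

Definition JJ : Type := quot relJ.
HB.instance Definition _ := GRing.Lmodule.on JJ.

Definition brJ (a b : J) : JJ := qcls relJ (tensJ a b).

(* The actions of J tensor J on J and on itself induced by
   a tensor b |-> [L_a, L_b]. *)
Definition derJ (w : JtJ) (c : J) : J :=
  lext (fun p => commL (xJ (val p.1)) (xJ (val p.2)) c) w.
Definition derJtJ (w z : JtJ) : JtJ :=
  lext (fun q => tensJ (derJ w (xJ (val q.1))) (xJ (val q.2))
               + tensJ (xJ (val q.1)) (derJ w (xJ (val q.2)))) z.

Definition sl2mx (b : sl2b) : 'M[F]_2 :=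
  match b with
  | Xp => Emx F 2 1 2
  | Xm => Emx F 2 2 1
  | Av => Emx F 2 1 1 - Emx F 2 2 2
  end.

(* The coordinates, in the basis sl2mx, of a matrix in sl_2. *)
Definition sl2coord (A : 'M[F]_2) (b : sl2b) : F :=
  match b with
  | Xp => entry A 1 2
  | Xm => entry A 2 1
  | Av => entry A 1 1
  end.

(* sl_2 tensor J: u stands for the sum of the sl2mx b tensor u b *)
Definition sl2J : Type := {ffun sl2b -> J}.
HB.instance Definition _ := GRing.Lmodule.on sl2J.

Definition tens2 (A : 'M[F]_2) (a : J) : sl2J :=
  [ffun b => sl2coord A b *: a].

Definition tkk : Type := (sl2J * JJ)%type.
HB.instance Definition _ := GRing.Lmodule.on tkk.

(* The bracket, with elements of JJ = (J tensor J) / span relJ acting through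
   a representative. *)
Definition tkk_br (p q : tkk) : tkk :=
  ((\sum_b \sum_c tens2 (mxlie (sl2mx b) (sl2mx c)) (mulJ (p.1 b) (q.1 c)))
     + [ffun b => derJ (repr p.2) (q.1 b)]
     - [ffun b => derJ (repr q.2) (p.1 b)],
   (\sum_b \sum_c (2 * \tr (sl2mx b *m sl2mx c)) *: brJ (p.1 b) (q.1 c))
     + qcls relJ (derJtJ (repr p.2) (repr q.2))).

Definition xp_ (r : int * int) : tkk := (tens2 (sl2mx Xp) (xJ r), 0).
Definition xm_ (r : int * int) : tkk := (tens2 (sl2mx Xm) (xJ r), 0).
Definition av_ (r : int * int) : tkk :=
  if inS r then (tens2 (sl2mx Av) (xJ r), 0)
  else (0, 2 *: brJ (xJ e1) (xJ (r - e1))).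
Definition C1_ (r : int * int) : tkk :=
  if inS0 r then (0, brJ (xJ e1) (xJ (r - e1))) else 0.
Definition C2_ (r : int * int) : tkk :=
  if inS0 r then (0, brJ (xJ e2) (xJ (r - e2))) else 0.

End TKK.

Section Conformal.
Variable F : numFieldType.

Definition Znz : Type := {s : int | s != 0}.
HB.instance Definition _ := Choice.on Znz.

(* A basis of g: x tensor t_2^m, k_2, and t_2^s k_1 for s <> 0. *)
Definition gbasis : Type := (sp4b * int + (unit + Znz))%type.
HB.instance Definition _ := Choice.on gbasis.

(* A basis of C_g: the D^i tensor g, and k_1. *)
Definition cgbasis : Type := (nat * gbasis + unit)%type.
HB.instance Definition _ := Choice.on cgbasis.

Definition Cg : Type := finsupp cgbasis F^o.
HB.instance Definition _ := GRing.Lmodule.on Cg.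

Definition cg_elt (p : cgbasis) : Cg := single p 1.

Definition sp4mx (b : sp4b) : 'M[F]_4 :=
  match b with
  | XH1 => Emx F 4 1 1 - Emx F 4 3 3
  | XH2 => Emx F 4 2 2 - Emx F 4 4 4
  | X13 => Emx F 4 1 3
  | X31 => Emx F 4 3 1
  | X24 => Emx F 4 2 4
  | X42 => Emx F 4 4 2
  | X12 => Emx F 4 1 2 - Emx F 4 4 3
  | X21 => Emx F 4 2 1 - Emx F 4 3 4
  | X14 => Emx F 4 1 4 + Emx F 4 2 3
  | X41 => Emx F 4 4 1 + Emx F 4 3 2
  end.

(* The coordinates, in the basis sp4mx, of a matrix in sp_4. *)
Definition sp4coord (X : 'M[F]_4) (b : sp4b) : F :=
  match b with
  | XH1 => entry X 1 1
  | XH2 => entry X 2 2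
  | X13 => entry X 1 3
  | X31 => entry X 3 1
  | X24 => entry X 2 4
  | X42 => entry X 4 2
  | X12 => entry X 1 2
  | X21 => entry X 2 1
  | X14 => entry X 1 4
  | X41 => entry X 4 1
  end.

Definition xt (b : sp4b) (m : int) : Cg := cg_elt (inl (0%N, inl (b, m))).
Definition Xt (X : 'M[F]_4) (m : int) : Cg := \sum_b sp4coord X b *: xt b m.
Definition k2 : Cg := cg_elt (inl (0%N, inr (inl tt))).
(* t_2^s k_1, which is k_1 for s = 0 *)
Definition k1t (s : int) : Cg :=
  if insub s is Some s' then cg_elt (inl (0%N, inr (inr s')))
  else cg_elt (inr tt).

Definition dD : Cg -> Cg :=
  lext (fun p : cgbasis =>
    match p with
    | inl (i, g) => cg_elt (inl (i.+1, g))
    | inr _ => 0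
    end).

(* g_n h for g, h in the basis of g *)
Definition nprod_g (n : nat) (g h : gbasis) : Cg :=
  match g, h with
  | inl (b, m), inl (c, m') =>
      let x := sp4mx b in
      let y := sp4mx c in
      let s := m + m' in
      match n with
      | 0 => Xt (mxlie x y) s
             + (if s == 0 then (m%:~R * \tr (x *m y)) *: k2
                else (m%:~R / s%:~R * \tr (x *m y)) *: dD (k1t s))
      | 1 => \tr (x *m y) *: k1t s
      | _ => 0
      end
  | _, _ => 0
  end.

(* g_n (D^j h): the identity [dD, a_n] = - n a_(n-1) gives
   a_n (dD b) = dD (a_n b) + n a_(n-1) b. *)
Fixpoint nprod_r (j n : nat) (g h : gbasis) : Cg :=
  if j is j'.+1 then dD (nprod_r j' n g h) + n%:R *: nprod_r j' n.-1 g h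
  else nprod_g n g h.

(* (D^i g)_n (D^j h), by (dD a)_n = - n a_(n-1) *)
Fixpoint nprod_l (i j n : nat) (g h : gbasis) : Cg :=
  if i is i'.+1 then - (n%:R *: nprod_l i' j n.-1 g h)
  else nprod_r j n g h.

Definition nprod_b (n : nat) (p q : cgbasis) : Cg :=
  match p, q with
  | inl (i, g), inl (j, h) => nprod_l i j n g h
  | _, _ => 0
  end.

(* a_n b *)
Definition nprod (n : nat) (a b : Cg) : Cg :=
  lext (fun p => lext (fun q => nprod_b n p q) b) a.

Definition kappa (n : int) : Cg :=
  if n == 0 then k2 else n%:~R^-1 *: dD (k1t n).

Definition sigma_x (b : sp4b) (n : int) : Cg :=
  match b with
  | XH1 => - xt XH2 n + kappa n
  | XH2 => - xt XH1 n + kappa n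
  | X12 => xt X12 n
  | X21 => xt X21 n
  | X14 => - xt X41 (n + 1)
  | X41 => - xt X14 (n - 1)
  | X13 => xt X42 (n + 1)
  | X31 => xt X24 (n - 1)
  | X24 => xt X31 (n + 1)
  | X42 => xt X13 (n - 1)
  end.

Definition sigma_b (p : cgbasis) : Cg :=
  match p with
  | inl (i, inl (b, n)) => iter i dD (sigma_x b n)
  | _ => cg_elt p
  end.

Definition sigma : Cg -> Cg := lext sigma_b.

HB.instance Definition _ := GRing.Linear.on dD.
HB.instance Definition _ := GRing.Linear.on sigma.

(* a^(r) *)
Definition tpart (r : int) (a : Cg) : Cg := 2^-1 *: (a + (-1) ^ r *: sigma a).


Lemma dD_elt i g : dD (cg_elt (inl (i, g))) = cg_elt (inl (i.+1, g)).
Proof. exact: lext_single. Qed.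

Lemma sigma_elt p : sigma (cg_elt p) = sigma_b p.
Proof. exact: lext_single. Qed.

Lemma sigma_dD a : sigma (dD a) = dD (sigma a).
Proof.
apply: (eq_lin (f := sigma \o @dD) (g := @dD \o sigma)) => -[[i g]|[]] /=.
  rewrite -/(cg_elt _) dD_elt !sigma_elt.
  by case: g => [[b n]|k] //; rewrite dD_elt.
rewrite -/(cg_elt _) sigma_elt /= (_ : dD (cg_elt (inr tt)) = 0) ?linear0 //.
exact: lext_single.
Qed.

Lemma sigma_k1t s : sigma (k1t s) = k1t s.
Proof. by rewrite /k1t; case: insubP => [s' _ _|_]; rewrite sigma_elt. Qed.

Lemma sigma_kappa n : sigma (kappa n) = kappa n.
Proof.
rewrite /kappa; case: ifP => _; first exact: sigma_elt.
by rewrite linearZ /= sigma_dD sigma_k1t.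
Qed.

Lemma sigma_xt b n : sigma (xt b n) = sigma_x b n.
Proof. exact: sigma_elt. Qed.

Lemma sigmaK : involutive sigma.
Proof.
apply: (eq_lin (f := sigma \o sigma) (g := idfun)) => -[[i [[b n]|g]]|[]] /=.
- rewrite -/(cg_elt _) sigma_elt /=.
  have -> : cg_elt (inl (i, inl (b, n))) = iter i (@dD) (xt b n).
    by elim: i => // i IH; rewrite iterS -IH dD_elt.
  elim: i => [|i IH]; last by rewrite !iterS sigma_dD IH.
  by case: b => /=; rewrite ?linearD ?linearN /= !(sigma_xt, sigma_kappa) /=
     ?opprD ?opprK ?addrNK ?subrK ?addrK.
- by rewrite !sigma_elt.
- by rewrite !sigma_elt.
Qed.

Lemma sigma_tpart r a : sigma (tpart r a) = (-1) ^ r *: tpart r a.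
Proof.
rewrite /tpart linearZ linearD linearZ /= sigmaK [RHS]scalerA mulrC -scalerA.
congr (_ *: _); rewrite scalerDr scalerA -expfzMl mulrNN mulr1 exp1rz scale1r.
by rewrite addrC.
Qed.

End Conformal.

Section Twisted.
Variable F : numFieldType.

(* Cg tensor C[t^{1/2}, t^{-1/2}]: u r is the coefficient of t^{r/2} *)
Definition loopCg : Type := finsupp int (Cg F).
HB.instance Definition _ := GRing.Lmodule.on loopCg.

Definition is_twisted : {pred loopCg} :=
  fun u => `[< forall r : int, sigma (u r) = (-1) ^ r *: u r >].

Lemma is_twisted_submod : submod_closed is_twisted.
Proof.
split=> [|a u v].
  apply/asboolP => r; have -> : (0 : loopCg) r = 0 by [].
  by rewrite linear0 scaler0.
move=> /asboolP Hu /asboolP Hv; apply/asboolP => r.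
by rewrite fs_scaleD linearD linearZ /= Hu Hv scalerDr !scalerA mulrC.
Qed.

HB.instance Definition _ :=
  GRing.isSubmodClosed.Build F loopCg is_twisted is_twisted_submod.

(* The direct sum of the C_g^(r) tensor t^{r/2} *)
Record twisted := Twisted { twval :> loopCg; _ : twval \in is_twisted }.
HB.instance Definition _ := [isSub for twval].
HB.instance Definition _ := [Choice of twisted by <:].
HB.instance Definition _ := [SubChoice_isSubLmodule of twisted by <:].

Lemma twmon_subproof r a : single r (tpart r a) \in is_twisted.
Proof.
apply/asboolP => s /=; case: (s =P r) => [->|_]; first exact: sigma_tpart.
by rewrite linear0 scaler0.
Qed.

(* a^(r) tensor t^{r/2} *)
Definition twmon (r : int) (a : Cg F) : twisted := Twisted (twmon_subproof r a).

(* dD tensor 1 + 1 tensor d/dt *)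
Definition totD (u : loopCg) : loopCg :=
  \sum_(r \in [set: int])
    (single r (dD (u r)) + single (r - 2) ((r%:~R / 2) *: u r)).

(* totD is linear and commutes with the twist, so this set is a subspace, equal
   to its span. *)
Definition imtotD : set twisted :=
  [set w | exists u : twisted, twval w = totD (twval u)].

Definition Chat : Type := quot imtotD.
HB.instance Definition _ := GRing.Lmodule.on Chat.

(* a^(r)(r/2), which is a(r/2) for a in C_g^(r) *)
Definition mode (r : int) (a : Cg F) : Chat := qcls imtotD (twmon r a).

Definition gbinom (x : F) (i : nat) : F :=
  (\prod_(k < i) (x - k%:R)) / i`!%:R.

(* As sigma is an automorphism of order 2, a_i b lies in C_g^(r+s), which is
   C_g^(r+s-2i), for a in C_g^(r) and b in C_g^(s): the projection in mode
   leaves it unchanged. *)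
Definition Chat_br (x y : Chat) : Chat :=
  \sum_(r \in [set: int]) \sum_(s \in [set: int]) \sum_(i \in [set: nat])
    gbinom (r%:~R / 2) i *:
      mode (r + s - (2 * i)%:Z) (nprod i (twval (repr x) r) (twval (repr y) s)).

End Twisted.

(* Main.v *)
From HB Require Import structures.
From mathcomp Require Import all_boot all_order all_algebra.
From mathcomp Require Import finmap.
From mathcomp Require Import boolp classical_sets cardinality fsbigop.
From mathcomp Require Import reals complex.
From mathcomp Require Import zify ring.
Require Import Defs.

Set Implicit Arguments.
Unset Strict Implicit.
Unset Printing Implicit Defensive.

Import GRing.Theory Num.Theory.

Local Open Scope classical_set_scope.
Local Open Scope ring_scope.

(* Fix u in S_0: the cyclic relation makes r |-> <x^r, x^(u-r)> additive, so it is
   r_1 C_1(u) + r_2 C_2(u); in degree u in S^perp one gets +- alpha(u) / 2, and 0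
   in the other degrees. Hence u_1 C_1(u) + u_2 C_2(u) = 0 is the only relation
   among the generators, and phi is well defined. In C_g-hat[sigma] the relation
   (D a)(r/2) = - (r/2) a(r/2 - 1) removes all D's, which gives a map psi in the
   other direction, inverse to phi on generators. Both brackets are graded by
   Z^2, where (x tensor t_2^n)(r/2) has degree (r, 2 n + sp4deg x) for a suitable
   grading sp4deg of sp_4. So for a pair of generators, whether psi takes the
   bracket of their images to their bracket is a comparison of five coordinates,
   depending only on the parities of the degrees. *)

(** Both brackets are defined through chosen representatives of quotient classes, so neither is
    visibly bilinear, and without bilinearity nothing can be checked on generators. In the TKK
    algebra, [L_a, L_b] x^c on monomials is a sign depending on the degrees of a and b times a sign
    depending on c. The first sign is compatible with the relations of <J, J>, so only the S^perp
    component of an element of <J, J> acts ([perp]), and [tkk_brP] is a formula free of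
    representatives. On the conformal side the bracket is written on loops before passing to the
    quotient ([loop_br]). Two recurrences for (i + 1) binom(x, i + 1), one for each argument, make
    it vanish on the image of [totD]. The comparison is made in the TKK algebra because its
    generators and relations are explicit, and it suffices there because psi is injective. The five
    coordinates are not unique: generators vanish outside their lattices. Hence they are compared
    only where the generator can be nonzero ([tc_eq]). This is what reconciles signs (-1)^r with
    elements fixed by sigma, whose images vanish for odd r. *)

Section LinearMaps.
Variables (F : fieldType) (V W : lmodType F).

(** Linearity is kept as an unbundled property, so that maps given by anonymous functions, such as a
    bracket with one argument fixed, need no structure instance. *)
Lemma lin_add (f : V -> W) : linear f -> forall u v, f (u + v) = f u + f v.
Proof. by move=> lf u v; rewrite -[u in LHS]scale1r lf scale1r. Qed.

Lemma lin0 (f : V -> W) : linear f -> f 0 = 0.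
Proof. by move=> lf; apply: (addIr (f 0)); rewrite -lin_add // !add0r. Qed.

Lemma lin_scale (f : V -> W) : linear f -> forall a u, f (a *: u) = a *: f u.
Proof. by move=> lf a u; rewrite -[a *: u]addr0 lf lin0 // addr0. Qed.

Lemma lin_opp (f : V -> W) : linear f -> forall u, f (- u) = - f u.
Proof. by move=> lf u; rewrite -scaleN1r lin_scale // scaleN1r. Qed.

Lemma lin_sum (f : V -> W) : linear f ->
  forall (I : Type) (s : seq I) (P : pred I) (g : I -> V),
  f (\sum_(i <- s | P i) g i) = \sum_(i <- s | P i) f (g i).
Proof.
move=> lf I s P g; elim/big_rec2: _ => [|i y1 y2 _ <-]; first exact: lin0.
exact: lin_add.
Qed.

Lemma linear_zero : linear (fun _ : V => 0 : W).
Proof. by move=> a u v; rewrite scaler0 addr0. Qed.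

Lemma linear_add (f g : V -> W) : linear f -> linear g -> linear (fun x => f x + g x).
Proof. by move=> lf lg a u v; rewrite lf lg scalerDr addrACA. Qed.

Lemma linear_opp (f : V -> W) : linear f -> linear (fun x => - f x).
Proof. by move=> lf a u v; rewrite lf opprD scalerN. Qed.

Lemma linear_scale (f : V -> W) c : linear f -> linear (fun x => c *: f x).
Proof. by move=> lf a u v; rewrite lf scalerDr !scalerA mulrC. Qed.

Lemma linear_bigsum (I : Type) (s : seq I) (P : pred I) (f : I -> V -> W) :
  (forall i, linear (f i)) -> linear (fun x => \sum_(i <- s | P i) f i x).
Proof.
move=> lf a u v; rewrite scaler_sumr -big_split /=.
by apply: eq_bigr => i _; rewrite lf.
Qed.

Lemma span_eq_lin (G : set V) (f g : V -> W) : linear f -> linear g ->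
  (forall v, G v -> f v = g v) -> forall v, lspan G v -> f v = g v.
Proof.
move=> lf lg fg v; elim=> {v} [|v /fg //|a u v _ IHu _ IHv].
  by rewrite !lin0.
by rewrite lf lg IHu IHv.
Qed.

Lemma span_lin0 (G : set V) (f : V -> W) : linear f ->
  (forall v, G v -> f v = 0) -> forall v, lspan G v -> f v = 0.
Proof. by move=> lf; apply: (span_eq_lin lf linear_zero). Qed.

Lemma lspan_img (G : set V) (H : set W) (f : V -> W) : linear f ->
  (forall v, G v -> lspan H (f v)) -> forall v, lspan G v -> lspan H (f v).
Proof.
move=> lf GH v; elim=> {v} [|v /GH //|a u v _ IHu _ IHv].
  by rewrite lin0 //; apply: lspan0.
by rewrite lf; apply: lspanP.
Qed.

End LinearMaps.

Lemma linear_comp (F : fieldType) (U V W : lmodType F) (g : V -> W) (f : U -> V) :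
  linear f -> linear g -> linear (fun x => g (f x)).
Proof. by move=> lf lg a u v; rewrite lf lg. Qed.

Lemma linear_id (F : fieldType) (V : lmodType F) : linear (fun x : V => x).
Proof. by []. Qed.

Lemma linear_of (F : fieldType) (U V : lmodType F) (f : {linear U -> V}) : linear f.
Proof. by move=> a u v; rewrite linearP. Qed.

(** The reduction to generators used for every identity between bilinear maps below. *)
Lemma span_eq_lin2 (F : fieldType) (U V W : lmodType F) (G : set U) (H : set V)
    (f g : U -> V -> W) :
  (forall v, linear (f^~ v)) -> (forall v, linear (g^~ v)) ->
  (forall u, linear (f u)) -> (forall u, linear (g u)) ->
  (forall u v, G u -> H v -> f u v = g u v) ->
  forall u v, lspan G u -> lspan H v -> f u v = g u v.
Proof.
move=> lf1 lg1 lf2 lg2 fg u v Gu Hv; move: u Gu.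
apply: (span_eq_lin (lf1 v) (lg1 v)) => u Gu; move: v Hv.
by apply: (span_eq_lin (lf2 u) (lg2 u)) => v; apply: fg.
Qed.

(** * Sums over finitely supported families *)

Section FinitelySupported.
Variables (F : fieldType) (K : choiceType) (V W : lmodType F).

(** The analogue of [lext] for coefficients in an arbitrary space. Loops with values in [Cg] need
    it: [totD], the bracket on loops and psi all have this shape. *)
Definition lsum (f : K -> V -> W) (u : finsupp K V) : W :=
  \sum_(k \in [set: K]) f k (u k).

Lemma fs_outside (u : finsupp K V) (A : {fset K}) :
  [set k | u k != 0] `<=` [set` A] -> forall k, k \notin A -> u k = 0.
Proof.
move=> uA k kA; apply/eqP; apply: contraNT kA => uk.
exact: (uA k uk).
Qed.

Lemma fs_supp (u : finsupp K V) : exists A : {fset K}, forall k, k \notin A -> u k = 0.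
Proof.
exists (fset_set [set k | u k != 0]); apply: fs_outside => k uk.
by rewrite /= in_fset_set ?inE //; apply: fin_suppP.
Qed.

Lemma lsumE (f : K -> V -> W) (u : finsupp K V) (A : {fset K}) :
  (forall k, linear (f k)) -> (forall k, k \notin A -> u k = 0) ->
  lsum f u = \sum_(k <- A) f k (u k).
Proof. by move=> lf uA; apply: fsbigTE => k /uA ->; apply: lin0. Qed.

Lemma lsum_linear (f : K -> V -> W) : (forall k, linear (f k)) -> linear (lsum f).
Proof.
move=> lf a u v.
have [A uA] := fs_supp u; have [B vB] := fs_supp v.
have uAB k : k \notin (A `|` B)%fset -> u k = 0.
  by rewrite inE negb_or => /andP[/uA].
have vAB k : k \notin (A `|` B)%fset -> v k = 0.
  by rewrite inE negb_or => /andP[_ /vB].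
rewrite (lsumE lf uAB) (lsumE lf vAB) (lsumE lf (A := (A `|` B)%fset)).
  rewrite scaler_sumr -big_split; apply: eq_bigr => k _.
  exact: lf.
move=> k kAB; rewrite -[LHS]/(a *: u k + v k).
by rewrite uAB // vAB // scaler0 addr0.
Qed.

Lemma lsum_single (f : K -> V -> W) k v : (forall k, linear (f k)) ->
  lsum f (single k v) = f k v.
Proof.
move=> lf; rewrite (@lsumE _ _ [fset k]%fset) //; first by rewrite big_seq_fset1 /= eqxx.
by move=> k'; rewrite inE /= => /negbTE ->.
Qed.

Lemma single_linear (k : K) : linear (@single F K V k).
Proof.
move=> a u v; apply: fs_ext => k'.
rewrite -[RHS]/(a *: single k u k' + single k v k') /=.
by case: eqP => // _; rewrite scaler0 addr0.
Qed.

Lemma fs_span (u : finsupp K V) : lspan [set w | exists k v, w = single k v] u.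
Proof.
have [A uA] := fs_supp u.
have -> : u = \sum_(k <- A) single k (u k).
  apply: fs_ext => k.
  have -> : (\sum_(j <- A) single j (u j)) k = \sum_(j <- A) (if k == j then u j else 0).
    by elim/big_rec2: _ => // j x y _ <-.
  have [kA|kA] := boolP (k \in A).
    rewrite (big_fsetD1 k kA) /= eqxx big_seq big1 ?addr0 // => j.
    by rewrite !inE eq_sym => /andP[/negbTE -> _].
  rewrite uA // big_seq big1 // => j jA.
  by case: eqP kA => // ->; rewrite jA.
elim/big_rec: _ => [|k x _ Sx]; first exact: lspan0.
by apply: lspanD => //; apply: lspan_gen; exists k, (u k).
Qed.

End FinitelySupported.

Lemma fs_span1 (F : fieldType) (K : choiceType) (u : finsupp K F^o) :
  lspan [set w | exists k, w = single k 1] u.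
Proof.
elim: (fs_span u) => [|w [k [v ->]]|a x y _ Sx _ Sy]; first exact: lspan0.
  have -> : single k v = (v : F) *: (single k 1 : finsupp K F^o).
    rewrite -(lin_scale (@single_linear F K F^o k)); congr single.
    by rewrite -[v in LHS]mulr1.
  by apply: lspanZ; apply: lspan_gen; exists k.
exact: lspanP.
Qed.

Lemma lext_linear (F : fieldType) (K : choiceType) (W : lmodType F) (f : K -> W) :
  linear (lext f).
Proof. exact: lext_is_linear. Qed.

Lemma lext_linear_fun (F : fieldType) (K : choiceType) (V W : lmodType F)
    (f : V -> K -> W) (u : finsupp K F^o) :
  (forall k, linear (f^~ k)) -> linear (fun v => lext (f v) u).
Proof.
move=> lf a v w; have [A uA] := fs_supp u.
rewrite !(lextE _ uA) scaler_sumr -big_split; apply: eq_bigr => k _ /=.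
by rewrite lf scalerDr !scalerA mulrC.
Qed.

Lemma lsum_linear_fun (F : fieldType) (K : choiceType) (U V W : lmodType F)
    (f : U -> K -> V -> W) (u : finsupp K V) :
  (forall v k, linear (f v k)) ->
  (forall k x, linear (fun v => f v k x)) -> linear (fun v => lsum (f v) u).
Proof.
move=> lf1 lf a v w; have [A uA] := fs_supp u.
rewrite !(lsumE _ uA) // scaler_sumr -big_split; apply: eq_bigr => k _ /=.
by rewrite lf.
Qed.

(** * Linear maps out of a quotient *)

Section QuotientLift.
Variables (F : fieldType) (V W : lmodType F) (G : set V) (f : V -> W).
Hypotheses (lf : linear f) (fG : forall v, G v -> f v = 0).

Definition qlift (q : quot G) : W := f (repr q).

Lemma qliftE v : qlift (qcls G v) = f v.
Proof.
apply/eqP; rewrite -subr_eq0 -(lin_opp lf) -(lin_add lf); apply/eqP.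
exact: span_lin0 lf fG _ (repr_qcls G v).
Qed.

Lemma qlift_linear : linear qlift.
Proof.
move=> a p q; rewrite -[p]qcls_repr -[q]qcls_repr -linearP !qliftE; exact: lf.
Qed.

End QuotientLift.

(** * Parity of integers and membership in S *)

Definition oddz (a : int) : bool := ~~ (2 %| a)%Z.

Lemma oddzD a b : oddz (a + b) = oddz a (+) oddz b.
Proof. by rewrite /oddz; lia. Qed.

Lemma oddzN a : oddz (- a) = oddz a.
Proof. by rewrite /oddz; lia. Qed.

Lemma oddz_half (a : int) : a = 2 * (a %/ 2)%Z + (oddz a)%:Z.
Proof. by rewrite /oddz; lia. Qed.

Definition oddzE := (oddzD, oddzN).

Lemma inS0E r : inS0 r = ~~ oddz r.1 && ~~ oddz r.2.
Proof. by rewrite /inS0 /oddz !negbK. Qed.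

Lemma inSE r : inS r = ~~ (oddz r.1 && oddz r.2).
Proof.
by rewrite /inS /inS1 /inS2 !inS0E /= !oddzE; case: (oddz r.1); case: (oddz r.2).
Qed.

(** * Normal form of an alternating cyclic function of two degrees *)

Section NormalForm.
Variables (F : numFieldType) (V : lmodType F).
(** A model of r, t |-> <x^r, x^t>. In the cyclic relation the sums of degrees may leave S: the
    corresponding product is then 0, in accordance with [g0]. *)
Variable g : int * int -> int * int -> V.
Hypothesis g0 : forall r t, ~~ inS r -> g r t = 0.
Hypothesis gC : forall r t, g r t = - g t r.
Hypothesis gcyc : forall r s t, inS r -> inS s -> inS t ->
  g (r + s) t + g (s + t) r + g (t + r) s = 0.

Lemma additive_int (f : int -> V) : (forall a b, f (a + b) = f a + f b) ->
  forall n, f n = n%:~R *: f 1.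
Proof.
move=> fD; have f0 : f 0 = 0 by apply: (addrI (f 0)); rewrite -fD !addr0.
have fN a : f (- a) = - f a by apply: (addrI (f a)); rewrite -fD !subrr.
have fn (n : nat) : f n%:Z = n%:R *: f 1.
  elim: n => [|n IH]; first by rewrite scale0r.
  by rewrite intS fD IH -natr1 scalerDl scale1r addrC.
case=> n; first exact: fn.
by rewrite NegzE fN fn -scaleNr mulrNz.
Qed.

Section FixedDegree.
Variable u : int * int.
Hypothesis u0 : inS0 u.
Let f a := g a (u - a).

Let fD a b : inS a -> inS b -> inS (a + b) -> f (a + b) = f a + f b.
Proof.
(* As u is even, u - (a + b) has the parities of a + b. The cyclic relation for a, b and u - (a + b)
   then reads f(a + b) = f(a) + f(b) after two sign changes. *)
move=> Sa Sb Sab; have Sc : inS (u - (a + b)).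
  move: u0 Sab; rewrite !inSE inS0E /= !oddzE.
  by do 6!case: (oddz _).
have := gcyc Sa Sb Sc.
have -> : b + (u - (a + b)) = u - a by rewrite addrC opprD addrA subrK.
have -> : u - (a + b) + a = u - b by rewrite opprD addrA addrAC subrK.
rewrite (gC (u - a)) (gC (u - b)) -addrA -opprD => /eqP.
by rewrite subr_eq0 => /eqP.
Qed.

Let S2 (a b : int) : inS (2 * a, 2 * b).
Proof. by rewrite inSE /= /oddz; lia. Qed.

Let f_even a b : f (2 * a, 2 * b) = (2 * a)%:~R *: f e1 + (2 * b)%:~R *: f e2.
Proof.
(* Additivity of f is available only as long as all degrees stay in S, so it is exploited first on
   the subgroup S_0. The value at 2 e_i is twice the one at e_i because e_i itself lies in S. *)
have E (x y z t : int) : (x, y) + (z, t) = (x + z, y + t) by [].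
have -> : (2 * a, 2 * b) = (2 * a, 2 * 0) + (2 * 0, 2 * b).
  by rewrite E !mulr0 addr0 add0r.
rewrite fD ?E -?mulrDr //.
rewrite (@additive_int (fun a => f (2 * a, 2 * 0))); last first.
  by move=> x y; rewrite -fD ?E -?mulrDr.
rewrite (@additive_int (fun a => f (2 * 0, 2 * a))); last first.
  by move=> x y; rewrite -fD ?E -?mulrDr.
have -> : (2 * 1 : int, 2 * 0 : int) = e1 + e1 by [].
have -> : (2 * 0 : int, 2 * 1 : int) = e2 + e2 by [].
rewrite !fD // -!mulr2n -!scaler_nat !scalerA.
by rewrite !intrM !(mulrC _ 2%:R).
Qed.

(** S is the union of S_0, e1 + S_0 and e2 + S_0, so one more use of additivity leads from S_0 to
    all of S. *)
Lemma nf_S0 r : inS r -> f r = r.1%:~R *: g e1 (u - e1) + r.2%:~R *: g e2 (u - e2).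
Proof.
have E (x y z t : int) : (x, y) + (z, t) = (x + z, y + t) by [].
case: r => a b; rewrite inSE [in X in _ -> X](oddz_half a) [in X in _ -> X](oddz_half b) /=.
rewrite -E; case: (oddz a); case: (oddz b) => //= _.
- rewrite fD ?S2 //; last by rewrite inSE /= /oddz; lia.
  rewrite f_even addr0 [in RHS]intrD scalerDl.
  by rewrite [f (_, _)](_ : _ = 1%:~R *: f e1) ?scale1r // addrAC.
- rewrite fD ?S2 //; last by rewrite inSE /= /oddz; lia.
  rewrite f_even addr0 [in RHS]intrD scalerDl.
  by rewrite [f (_, _)](_ : _ = 1%:~R *: f e2) ?scale1r // addrA.
- by rewrite (_ : (0, 0) = 0) // addr0 f_even !addr0.
Qed.

(** The left side is f(u) = g u 0 = - g 0 u = - f(0), and the normal form of f(0) is 0. *)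
Lemma nf_rel : u.1%:~R *: g e1 (u - e1) + u.2%:~R *: g e2 (u - e2) = 0.
Proof.
have Su : inS u by rewrite inSE; move: u0; rewrite inS0E => /andP[/negbTE->].
by rewrite -nf_S0 // /f gC subrr -[u]subr0 -/(f 0) nf_S0 // !scale0r addr0 oppr0.
Qed.

End FixedDegree.

Lemma nf_S00 r t : inS r -> inS0 (r + t) ->
  g r t = r.1%:~R *: g e1 (r + t - e1) + r.2%:~R *: g e2 (r + t - e2).
Proof. by move=> Sr S0; rewrite -nf_S0 // addrAC subrr add0r. Qed.

(** Cyclic relation for r - e1, e1 and t. Here r has parities (1, 0) and t has parities (0, 1), so
    e1 + t lies in S^perp and the middle term drops out. *)
Lemma nf_perp r t : inS r -> inS t -> ~~ inS (r + t) -> oddz r.1 ->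
  g r t = g e1 (r + t - e1).
Proof.
move=> Sr St Srt r1.
have S0 : inS (r - e1).
  by move: Sr; rewrite !inSE /= !oddzE r1 /=; case: (oddz _).
have := gcyc S0 (isT : inS e1) St.
rewrite (g0 (r := e1 + t)); last first.
  by move: Sr St Srt; rewrite !inSE /= !oddzE r1 /=; do 3!case: (oddz _).
rewrite subrK addr0 => /eqP; rewrite addr_eq0 => /eqP ->.
by rewrite -gC (addrC t) addrAC.
Qed.

Lemma nf_else r t : inS (r + t) -> ~~ inS0 (r + t) -> g r t = 0.
Proof.
have [Sr|Sr] := boolP (inS r); last by rewrite g0.
have [St|St] := boolP (inS t); last by rewrite gC g0 ?oppr0.
wlog r0 : r t Sr St / inS0 r.
  move=> H Srt nSrt; have [r0|r0] := boolP (inS0 r); first exact: H.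
  rewrite gC H ?oppr0 // 1?addrC //.
  move: Sr St Srt nSrt r0; rewrite !inSE !inS0E /= !oddzE.
  by do 4!case: (oddz _).
(* With r in S_0, t lies in S_1 or S_2. The unit vector [e] is the one for which t + e and r - e + t
   are both in S^perp, so the cyclic relation for e, r - e and t is left with the single term g r
   t. *)
move=> Srt nSrt; pose e := if oddz t.1 then e2 else e1.
have Se : inS e by rewrite /e; case: ifP.
have Sb : inS (r - e).
  move: r0; rewrite /e inSE inS0E; case: ifP => _ /=;
    by rewrite !oddzE /=; do 2!case: (oddz _).
have := gcyc Se Sb St; rewrite (addrC e) subrK.
rewrite (g0 (r := r - e + t)); last first.
  move: r0 St Srt nSrt; rewrite /e; case: (boolP (oddz t.1)) => t1;
    rewrite !inSE !inS0E /= !oddzE ?(negbTE t1) ?t1;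
    by case: (oddz r.1); case: (oddz r.2); case: (oddz t.2).
rewrite (g0 (r := t + e)) ?addr0 //.
move: r0 St Srt nSrt; rewrite /e; case: (boolP (oddz t.1)) => t1;
  rewrite !inSE !inS0E /= !oddzE ?(negbTE t1) ?t1;
  by case: (oddz r.1); case: (oddz r.2); case: (oddz t.2).
Qed.

End NormalForm.

(** * Multiplication operators of the Jordan algebra and their commutators *)

Section Jordan.
Variable F : numFieldType.
Local Notation J := (J F).
Local Notation JtJ := (JtJ F).
Local Notation xJ := (xJ F).

Lemma xJ_val (s : idxS) : xJ (val s) = single s 1.
Proof. by rewrite /Defs.xJ valK. Qed.

Lemma xJ_in r (Sr : inS r) : xJ r = single (Sub r Sr : idxS) 1.
Proof. by rewrite -xJ_val SubK. Qed.

Lemma xJ_out r : ~~ inS r -> xJ r = 0.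
Proof. by move=> Sr; rewrite /Defs.xJ insubN. Qed.

Lemma J_span (a : J) : lspan [set w | exists2 r, inS r & w = xJ r] a.
Proof.
elim: (fs_span1 a) => [|w [k ->]|c x y _ Sx _ Sy]; first exact: lspan0.
  by apply: lspan_gen; exists (val k); [exact: valP | rewrite xJ_val].
exact: lspanP.
Qed.

Lemma mulJ_linl (b : J) : linear ((@mulJ F)^~ b).
Proof. exact: lext_linear. Qed.

Lemma mulJ_linr (a : J) : linear (mulJ a).
Proof. by apply: lext_linear_fun => k; apply: lext_linear. Qed.

Lemma tensJ_linl (b : J) : linear ((@tensJ F)^~ b).
Proof. exact: lext_linear. Qed.

Lemma tensJ_linr (a : J) : linear (tensJ a).
Proof. by apply: lext_linear_fun => k; apply: lext_linear. Qed.

Lemma mulJ_x r t : inS r -> inS t -> mulJ (xJ r) (xJ t) = xJ (r + t).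
Proof. by move=> Sr St; rewrite (xJ_in Sr) (xJ_in St) /mulJ !lext_single. Qed.

Lemma tensJ_x (p : idxS * idxS) : tensJ (xJ (val p.1)) (xJ (val p.2)) = single p 1.
Proof. by case: p => r t; rewrite !xJ_val /tensJ !lext_single. Qed.

Lemma JtJ_span (w : JtJ) :
  lspan [set w | exists r t, [/\ inS r, inS t & w = tensJ (xJ r) (xJ t)]] w.
Proof.
elim: (fs_span1 w) => [|_ [k ->]|c x y _ Sx _ Sy]; first exact: lspan0.
  apply: lspan_gen; exists (val k.1), (val k.2); split; try exact: valP.
  by rewrite tensJ_x.
exact: lspanP.
Qed.

Lemma tensJ0l (b : J) : tensJ 0 b = 0. Proof. exact: lin0 (tensJ_linl b). Qed.
Lemma tensJ0r (a : J) : tensJ a 0 = 0. Proof. exact: lin0 (tensJ_linr a). Qed.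

Lemma commL_linr (a b : J) : linear (commL a b).
Proof.
apply: linear_add; last apply: linear_opp.
  by apply: (linear_comp (g := mulJ a)); exact: mulJ_linr.
by apply: (linear_comp (g := mulJ b)); exact: mulJ_linr.
Qed.

Section KillRel.
Variables (V : lmodType F) (G : JtJ -> V).
Hypothesis lG : linear G.
Let g r t := G (tensJ (xJ r) (xJ t)).
Hypothesis gC : forall r t, inS r -> inS t -> g r t = - g t r.
Hypothesis gcyc : forall r s t, inS r -> inS s -> inS t ->
  g (r + s) t + g (s + t) r + g (t + r) s = 0.

(** By bilinearity the antisymmetry relations need only be tested on monomials. Together with
    [kill_cyc] this turns a map given on pairs of degrees into one that descends to <J, J>. *)
Lemma kill_anti a b : G (tensJ a b + tensJ b a) = 0.
Proof.
rewrite (lin_add lG); move: a b (J_span a) (J_span b).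
pose H a b := G (tensJ a b) + G (tensJ b a).
have l1 b : linear (H^~ b).
  apply: linear_add; apply: linear_comp lG; [exact: tensJ_linl | exact: tensJ_linr].
have l2 a : linear (H a).
  apply: linear_add; apply: linear_comp lG; [exact: tensJ_linr | exact: tensJ_linl].
apply: (span_eq_lin2 l1 (fun _ => @linear_zero _ _ _) l2 (fun _ => @linear_zero _ _ _)).
by move=> _ _ [r Sr ->] [t St ->]; rewrite /H -!/(g _ _) gC // addNr.
Qed.

Lemma kill_cyc a b c :
  G (tensJ (mulJ a b) c + tensJ (mulJ b c) a + tensJ (mulJ c a) b) = 0.
Proof.
rewrite !(lin_add lG).
pose H a b c := G (tensJ (mulJ a b) c) + G (tensJ (mulJ b c) a) + G (tensJ (mulJ c a) b).
have T1 x (f : J -> J) : linear f -> linear (fun a => G (tensJ (f a) x)).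
  by move=> lf; apply: (linear_comp (g := G)) lG; apply: linear_comp lf _; apply: tensJ_linl.
have T2 x (f : J -> J) : linear f -> linear (fun a => G (tensJ x (f a))).
  by move=> lf; apply: (linear_comp (g := G)) lG; apply: linear_comp lf _; apply: tensJ_linr.
have lid := @linear_id F J.
have l1 b' c' : linear (fun a => H a b' c').
  apply: linear_add; first apply: linear_add.
  - by apply: T1; apply: mulJ_linl.
  - exact: T2.
  - by apply: T1; apply: mulJ_linr.
have l2 a' c' : linear (fun b => H a' b c').
  apply: linear_add; first apply: linear_add.
  - by apply: T1; apply: mulJ_linr.
  - by apply: T1; apply: mulJ_linl.
  - exact: T2.
have l3 a' b' : linear (fun c => H a' b' c).
  apply: linear_add; first apply: linear_add.
  - exact: T2.
  - by apply: T1; apply: mulJ_linr.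
  - by apply: T1; apply: mulJ_linl.
rewrite -/(H a b c).
apply: (span_lin0 (l1 b c)) (J_span a) => _ [r Sr ->].
apply: (span_lin0 (l2 (xJ r) c)) (J_span b) => _ [s Ss ->].
apply: (span_lin0 (l3 (xJ r) (xJ s))) (J_span c) => _ [t St ->].
by rewrite /H !mulJ_x // -!/(g _ _) gcyc.
Qed.

Lemma kill_rel w : relJ w -> G w = 0.
Proof.
by case=> [[a [b ->]]|[a [b [c ->]]]]; [exact: kill_anti | exact: kill_cyc].
Qed.

End KillRel.

(* <x^r, x^t> = sg r t / 2 * alpha(r + t) when r + t lies in S^perp. *)
Definition sg (r t : int * int) : F :=
  if inS r && inS t then
    if oddz r.1 && oddz t.2 then 1 else if oddz r.2 && oddz t.1 then -1 else 0
  else 0.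

(** The part of [L_a, L_b] x^c that depends on c: -1 on S_1, 1 on S_2 and 0 on S_0. For instance
    [L_{x^e1}, L_{x^e2}] x^e1 = - x^{2 e1 + e2}. *)
Definition sv (c : int * int) : F :=
  if oddz c.1 then -1 else if oddz c.2 then 1 else 0.

Lemma sg_perp r t : inS (r + t) -> sg r t = 0.
Proof.
rewrite /sg !inSE /= !oddzE.
by case: (oddz r.1); case: (oddz r.2); case: (oddz t.1); case: (oddz t.2).
Qed.

Lemma sg_anti r t : sg r t = - sg t r.
Proof.
rewrite /sg !inSE.
by case: (oddz r.1); case: (oddz r.2); case: (oddz t.1); case: (oddz t.2);
  rewrite //= ?oppr0 ?opprK.
Qed.

Lemma sg_cyc r s t : inS r -> inS s -> inS t ->
  sg (r + s) t + sg (s + t) r + sg (t + r) s = 0.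
Proof.
rewrite /sg !inSE /= !oddzE.
by case: (oddz r.1); case: (oddz r.2); case: (oddz t.1); case: (oddz t.2);
  case: (oddz s.1); case: (oddz s.2) => //=; rewrite ?(addr0, add0r, subrr, addNr).
Qed.

(** A check over the parities of r, t and c. The separation of variables in the coefficient is the
    point: it lets the action factor through [perp]. *)
Lemma commL_x r t c : inS r -> inS t -> inS c ->
  commL (xJ r) (xJ t) (xJ c) = (sg r t * sv c) *: xJ (r + t + c).
Proof.
move=> Sr St Sc; rewrite /commL (mulJ_x St Sc) (mulJ_x Sr Sc).
have mx u v : inS u -> mulJ (xJ u) (xJ v) = if inS v then xJ (u + v) else 0.
  move=> Su; case: ifP => Sv; first exact: mulJ_x.
  by rewrite (xJ_out (negbT Sv)) (lin0 (mulJ_linr _)).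
rewrite !mx // addrA [t + (r + c)]addrA (addrC t r).
have [nS|nS] := boolP (inS (r + t + c)); last first.
  by rewrite !(xJ_out nS) scaler0 !if_same subrr.
move: Sr St Sc nS; rewrite /sg /sv !inSE /= !oddzE.
by case: (oddz r.1); case: (oddz r.2); case: (oddz t.1); case: (oddz t.2);
  case: (oddz c.1); case: (oddz c.2) => //= _ _ _ _;
  rewrite ?(mulN1r, mul1r, mulr1, mulr0, mul0r, opprK, scale0r, scale1r, scaleN1r,
             subrr, sub0r, subr0).
Qed.

Definition perpM : Type := finsupp (int * int)%type F^o.
HB.instance Definition _ := GRing.Lmodule.on perpM.

(* [L_a, L_b] depends on a tensor b only through its component in degrees of
   S^perp. *)
Definition perp (w : JtJ) : perpM :=
  lext (fun p => sg (val p.1) (val p.2) *: (single (val p.1 + val p.2) 1 : perpM)) w.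

Lemma perp_linear : linear perp.
Proof. exact: lext_linear. Qed.

Lemma perp_x r t :
  perp (tensJ (xJ r) (xJ t)) = sg r t *: (single (r + t) 1 : perpM).
Proof.
have [Sr|Sr] := boolP (inS r); last first.
  by rewrite (xJ_out Sr) tensJ0l (lin0 perp_linear) /sg (negbTE Sr) scale0r.
have [St|St] := boolP (inS t); last first.
  by rewrite (xJ_out St) tensJ0r (lin0 perp_linear) /sg (negbTE St) andbF scale0r.
rewrite -[r]/(val (Sub r Sr : idxS)) -[t]/(val (Sub t St : idxS)).
by rewrite (tensJ_x (Sub r Sr : idxS, Sub t St : idxS)) /perp lext_single.
Qed.

(** This makes the S^perp component well defined on <J, J>, and with [derJE] the action of <J, J> on
    J independent of representatives. *)
Lemma perp_rel w : relJ w -> perp w = 0.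
Proof.
apply: kill_rel perp_linear _ _ w => [r t Sr St|r s t Sr Ss St].
  by rewrite !perp_x (addrC t r) -scaleNr -sg_anti.
rewrite !perp_x (addrC (s + t) r) (addrC (t + r) s) !addrA (addrAC s) (addrC s r) -!scalerDl.
by rewrite sg_cyc // scale0r.
Qed.

Definition derP (u : perpM) (c : J) : J :=
  lext (fun v => lext (fun k : idxS => sv (val k) *: xJ (v + val k)) c) u.

Lemma derP_linl c : linear (derP^~ c).
Proof. exact: lext_linear. Qed.

Lemma derP_linr u : linear (derP u).
Proof. by apply: lext_linear_fun => k; apply: lext_linear. Qed.

Lemma derP_x v r : inS r -> derP (single v 1) (xJ r) = sv r *: xJ (v + r).
Proof. by move=> Sr; rewrite (xJ_in Sr) /derP !lext_single. Qed.

Lemma derJ_linl c : linear ((@derJ F)^~ c).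
Proof. exact: lext_linear. Qed.

Lemma derJ_linr (w : JtJ) : linear (derJ w).
Proof. by apply: lext_linear_fun => k; apply: commL_linr. Qed.

Lemma derJ_x r t c : inS r -> inS t -> derJ (tensJ (xJ r) (xJ t)) c = commL (xJ r) (xJ t) c.
Proof.
move=> Sr St; rewrite -[r]/(val (Sub r Sr : idxS)) -[t]/(val (Sub t St : idxS)).
by rewrite (tensJ_x (Sub r Sr : idxS, Sub t St : idxS)) /derJ lext_single.
Qed.

Lemma derJE w c : derJ w c = derP (perp w) c.
Proof.
move: w c (JtJ_span w) (J_span c).
have l1 c : linear (fun w => derP (perp w) c).
  by apply: linear_comp; [exact: perp_linear | exact: derP_linl].
apply: (span_eq_lin2 derJ_linl l1 derJ_linr) => [w|w c]; first exact: derP_linr.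
move=> [r [t [Sr St ->]]] [s Ss ->].
rewrite derJ_x // commL_x // perp_x (lin_scale (derP_linl _)) derP_x //.
by rewrite scalerA.
Qed.

End Jordan.

(** * The normal form in all degrees at once, and its behaviour under derivations *)

Section NormalForm2.
Variables (F : numFieldType) (V : lmodType F).
Variable g : int * int -> int * int -> V.
Hypothesis g0 : forall r t, ~~ inS r -> g r t = 0.
Hypothesis gC : forall r t, g r t = - g t r.
Hypothesis gcyc : forall r s t, inS r -> inS s -> inS t ->
  g (r + s) t + g (s + t) r + g (t + r) s = 0.

Definition nfc (r u : int * int) : V :=
  if inS0 u then r.1%:~R *: g e1 (u - e1) + r.2%:~R *: g e2 (u - e2) else 0.

Lemma nf r t : inS r -> inS t ->
  g r t = nfc r (r + t) + sg F r t *: g e1 (r + t - e1).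
Proof.
move=> Sr St; have [S0|S0] := boolP (inS0 (r + t)).
  have S1 : inS (r + t) by move: S0; rewrite inS0E inSE => /andP[/negbTE->].
  by rewrite sg_perp // scale0r addr0 /nfc S0 nf_S00.
have [S1|S1] := boolP (inS (r + t)).
  by rewrite sg_perp // scale0r addr0 /nfc (negbTE S0) nf_else.
rewrite /nfc (negbTE S0) add0r /sg Sr St /=.
have [r1|r1] := boolP (oddz r.1).
  have -> : oddz t.2 by move: Sr St S1; rewrite !inSE /= !oddzE r1; do 3!case: (oddz _).
  by rewrite scale1r; apply: nf_perp.
have [t1 r2] : oddz t.1 /\ oddz r.2.
  by move: Sr St S1; rewrite !inSE /= !oddzE (negbTE r1); do 3!case: (oddz _).
by rewrite t1 r2 /= scaleN1r gC (addrC r t) (nf_perp g0 gC) // addrC.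
Qed.

(** The left side is the derivation of degree u applied to both slots of <x^c, x^d>. In degree u + c
    + d in S^perp the two terms cancel. In degree in S_0 the contributions of c cancel, so only
    those of u remain, with sign - sg c d. In the other degrees everything vanishes. *)
Lemma nf_der u c d : ~~ inS u -> inS c -> inS d ->
  sv F c *: g (u + c) d + sv F d *: g c (u + d) =
  - (sg F c d *: nfc u (u + (c + d))).
Proof.
move=> Su Sc Sd.
have E : g (u + c) d = if inS (u + c) then nfc (u + c) (u + (c + d))
    + sg F (u + c) d *: g e1 (u + (c + d) - e1) else 0.
  by case: ifP => [S1|/negbT/g0 //]; rewrite nf // addrA.
have E' : g c (u + d) = if inS (u + d) then nfc c (u + (c + d))
    + sg F c (u + d) *: g e1 (u + (c + d) - e1) else 0.
  case: ifP => [S1|/negbT S1]; last by rewrite gC g0 // oppr0.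
  by rewrite nf // addrCA.
rewrite {}E {}E' /nfc; set X := g e1 _; set X2 := g e2 _.
move: Su Sc Sd; rewrite /sv /sg !inSE !inS0E /= !oddzE.
case u1: (oddz u.1); case u2: (oddz u.2) => //= _.
case c1: (oddz c.1); case c2: (oddz c.2); case d1: (oddz d.1); case d2: (oddz d.2) => //= _ _;
  rewrite ?(scale0r, scaler0, addr0, add0r, oppr0, scale1r, scaleN1r, opprK, subrr, addNr) //.
  by rewrite !intrD !scalerDl addrACA opprD subrK.
by rewrite !intrD !scalerDl addrACA addrK.
Qed.

End NormalForm2.

Lemma linear_pair (F : fieldType) (U V W : lmodType F) (f : U -> V) (g : U -> W) :
  linear f -> linear g -> linear (fun x => (f x, g x)).
Proof. by move=> lf lg a u v; rewrite lf lg. Qed.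

Lemma linear_ffun (F : fieldType) (I : finType) (U V : lmodType F) (f : I -> U -> V) :
  (forall i, linear (f i)) -> linear (fun x => [ffun i => f i x]).
Proof. by move=> lf a u v; apply/ffunP => i; rewrite !ffunE lf. Qed.

(** * The Lie algebra <J, J> *)

Section JJside.
Variable F : numFieldType.
Local Notation J := (J F).
Local Notation JJ := (JJ F).
Local Notation JtJ := (JtJ F).
Local Notation xJ := (xJ F).

Lemma qcls_linear (V : lmodType F) (G : set V) : linear (qcls G).
Proof. exact: qcls_is_linear. Qed.

Lemma qcls0 (V : lmodType F) (G : set V) v : G v -> qcls G v = 0.
Proof.
move=> Gv; rewrite -(lin0 (@qcls_linear _ G)); apply: qcls_eq.
by rewrite subr0; apply: lspan_gen.
Qed.

Definition gJ (r t : int * int) : JJ := brJ (xJ r) (xJ t).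

Lemma brJ_linl (b : J) : linear ((@brJ F)^~ b).
Proof. by apply: linear_comp (@qcls_linear _ _); apply: tensJ_linl. Qed.

Lemma brJ_linr (a : J) : linear (brJ a).
Proof. by apply: linear_comp (@qcls_linear _ _); apply: tensJ_linr. Qed.

Lemma gJ0 r t : ~~ inS r -> gJ r t = 0.
Proof. by move=> Sr; rewrite /gJ (xJ_out F Sr); exact: lin0 (brJ_linl _). Qed.

Lemma gJC r t : gJ r t = - gJ t r.
Proof.
apply/eqP; rewrite -addr_eq0; apply/eqP.
apply: etrans (esym (lin_add (@qcls_linear _ _) _ _)) _.
by apply: qcls0; left; exists (xJ r), (xJ t).
Qed.

Lemma gJcyc r s t : inS r -> inS s -> inS t ->
  gJ (r + s) t + gJ (s + t) r + gJ (t + r) s = 0.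
Proof.
move=> Sr Ss St.
have : relJ (tensJ (mulJ (xJ r) (xJ s)) (xJ t) + tensJ (mulJ (xJ s) (xJ t)) (xJ r)
             + tensJ (mulJ (xJ t) (xJ r)) (xJ s)).
  by right; exists (xJ r), (xJ s), (xJ t).
move=> /qcls0; rewrite !(lin_add (@qcls_linear _ (@relJ F))) !mulJ_x //.
Qed.

(** The bracket of <J, J> in terms of S^perp components. Its values are combinations of the central
    C_1 and C_2. *)
Definition perp_br (u v : perpM F) : JJ :=
  lext (fun a => lext (fun b => - nfc gJ a (a + b)) v) u.

Lemma perp_br_linl v : linear (perp_br^~ v).
Proof. exact: lext_linear. Qed.

Lemma perp_br_linr u : linear (perp_br u).
Proof. by apply: lext_linear_fun => k; apply: lext_linear. Qed.

Lemma derJtJ_linr (w : JtJ) : linear (derJtJ w).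
Proof. exact: lext_linear. Qed.

Lemma derJtJ_linl (z : JtJ) : linear ((@derJtJ F)^~ z).
Proof.
apply: (lext_linear_fun (f := fun w q => tensJ (derJ w (xJ (val q.1))) (xJ (val q.2))
               + tensJ (xJ (val q.1)) (derJ w (xJ (val q.2))))) => q.
apply: linear_add; apply: linear_comp (derJ_linl _) _; [exact: tensJ_linl | exact: tensJ_linr].
Qed.

Lemma derJtJ_x (w : JtJ) c d : inS c -> inS d ->
  derJtJ w (tensJ (xJ c) (xJ d)) = tensJ (derJ w (xJ c)) (xJ d) + tensJ (xJ c) (derJ w (xJ d)).
Proof.
move=> Sr St; rewrite -[c]/(val (Sub c Sr : idxS)) -[d]/(val (Sub d St : idxS)).
by rewrite (tensJ_x F (Sub c Sr : idxS, Sub d St : idxS)) /derJtJ lext_single.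
Qed.

(** The right side depends on w and z only through [perp], hence only on their classes. On monomials
    the identity is [nf_der]. *)
Lemma derJtJE (w z : JtJ) : qcls (@relJ F) (derJtJ w z) = perp_br (perp w) (perp z).
Proof.
have lq := @qcls_linear _ (@relJ F).
move: w z (JtJ_span w) (JtJ_span z).
have l1 z : linear (fun w : JtJ => qcls (@relJ F) (derJtJ w z)).
  exact: linear_comp (derJtJ_linl z) lq.
have l2 z : linear (fun w : JtJ => perp_br (perp w) (perp z)).
  exact: linear_comp (@perp_linear F) (perp_br_linl _).
have l3 w : linear (fun z : JtJ => qcls (@relJ F) (derJtJ w z)).
  exact: linear_comp (derJtJ_linr w) lq.
have l4 w : linear (fun z : JtJ => perp_br (perp w) (perp z)).
  exact: linear_comp (@perp_linear F) (perp_br_linr _).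
apply: (span_eq_lin2 l1 l2 l3 l4).
move=> _ _ [r [t [Sr St ->]]] [c [d [Sc Sd ->]]].
rewrite derJtJ_x // !derJ_x // !commL_x // !perp_x.
rewrite (lin_scale (tensJ_linl _)) (lin_scale (tensJ_linr _)) (lin_add lq) !(lin_scale lq).
rewrite -!/(brJ _ _) -!/(gJ _ _).
rewrite (lin_scale (perp_br_linl _)) (lin_scale (perp_br_linr _)) /perp_br !lext_single.
have [Su|Su] := boolP (inS (r + t)).
  by rewrite sg_perp // !mul0r !scale0r addr0.
rewrite -!scalerA -scalerDr; congr (_ *: _).
rewrite scalerN; exact: (nf_der gJ0 gJC gJcyc).
Qed.

Definition perpq : JJ -> perpM F := qlift (@perp F).

Lemma perpq_linear : linear perpq.
Proof. by apply: qlift_linear; [exact: perp_linear | exact: perp_rel]. Qed.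

Lemma perpq_gJ r t : perpq (gJ r t) = sg F r t *: (single (r + t) 1 : perpM F).
Proof.
rewrite -perp_x; apply: qliftE; [exact: perp_linear | exact: perp_rel].
Qed.

Lemma JJ_span (q : JJ) :
  lspan [set w | exists r t, [/\ inS r, inS t & w = gJ r t]] q.
Proof.
rewrite -[q]qcls_repr; apply: (lspan_img (@qcls_linear _ _)) (JtJ_span (repr q)).
by move=> _ [r [t [Sr St ->]]]; apply: lspan_gen; exists r, t.
Qed.

End JJside.

(** * A formula for the TKK bracket without representatives *)

Section TKKside.
Variable F : numFieldType.
Local Notation J := (J F).
Local Notation tkk := (tkk F).

Lemma sum_sl2b (V : zmodType) (f : sl2b -> V) : \sum_b f b = f Xp + f Xm + f Av.
Proof.
have -> : index_enum sl2b = [:: Xp; Xm; Av].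
  by rewrite [index_enum _]unlock unlock.
by rewrite !big_cons big_nil addr0 addrA.
Qed.

Lemma tens2_linear (A : 'M[F]_2) : linear (tens2 A).
Proof.
apply: linear_ffun => b a u v; by rewrite scalerDr !scalerA mulrC.
Qed.

Lemma proj_linear b : linear (fun p : tkk => p.1 b).
Proof. by move=> a u v; rewrite !ffunE. Qed.

Lemma snd_linear : linear (fun p : tkk => p.2).
Proof. by []. Qed.

Definition tkk_brP (p q : tkk) : tkk :=
  ((\sum_b \sum_c tens2 (mxlie (sl2mx F b) (sl2mx F c)) (mulJ (p.1 b) (q.1 c)))
     + ([ffun b => derP (perpq p.2) (q.1 b)]
     - [ffun b => derP (perpq q.2) (p.1 b)]),
   (\sum_b \sum_c (2 * \tr (sl2mx F b *m sl2mx F c)) *: brJ (p.1 b) (q.1 c))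
     + perp_br (perpq p.2) (perpq q.2)).

Lemma tkk_brE p q : tkk_br p q = tkk_brP p q.
Proof.
rewrite /tkk_br /tkk_brP -addrA; congr (_ + (_ - _), _ + _).
- by apply/ffunP => b; rewrite !ffunE derJE.
- by apply/ffunP => b; rewrite !ffunE derJE.
- exact: derJtJE.
Qed.

Lemma tkk_br_linl q : linear ((@tkk_br F)^~ q).
Proof.
move=> a u v; rewrite !tkk_brE; move: a u v.
apply: linear_pair.
  apply: linear_add.
    apply: linear_bigsum => b; apply: linear_bigsum => c.
    apply: linear_comp (@tens2_linear _).
    by apply: linear_comp (@proj_linear b) (mulJ_linl _).
  apply: linear_add; last apply: linear_opp; apply: linear_ffun => b.
    apply: linear_comp (derP_linl _).
    exact: linear_comp snd_linear (@perpq_linear F).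
  by apply: linear_comp (@proj_linear b) (derP_linr _).
apply: linear_add.
  apply: linear_bigsum => b; apply: linear_bigsum => c; apply: linear_scale.
  by apply: linear_comp (@proj_linear b) (brJ_linl _).
apply: linear_comp (perp_br_linl _).
exact: linear_comp snd_linear (@perpq_linear F).
Qed.

Lemma tkk_br_linr (p : tkk) : linear (tkk_br p).
Proof.
move=> a u v; rewrite !tkk_brE; move: a u v.
apply: linear_pair.
  apply: linear_add.
    apply: linear_bigsum => b; apply: linear_bigsum => c.
    apply: linear_comp (@tens2_linear _).
    by apply: linear_comp (@proj_linear c) (mulJ_linr _).
  apply: linear_add; last apply: linear_opp; apply: linear_ffun => b.
    by apply: linear_comp (@proj_linear b) (derP_linr _).
  apply: linear_comp (derP_linl _).
  exact: linear_comp snd_linear (@perpq_linear F).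
apply: linear_add.
  apply: linear_bigsum => b; apply: linear_bigsum => c; apply: linear_scale.
  by apply: linear_comp (@proj_linear c) (brJ_linr _).
apply: linear_comp (perp_br_linr _).
exact: linear_comp snd_linear (@perpq_linear F).
Qed.

Definition inj2 (b : sl2b) (a : J) : sl2J F := [ffun c => if c == b then a else 0].

Definition sl2lie (b c d : sl2b) : F :=
  match b, c, d with
  | Xp, Xm, Av => 1 | Xm, Xp, Av => -1
  | Av, Xp, Xp => 2 | Xp, Av, Xp => -2
  | Av, Xm, Xm => -2 | Xm, Av, Xm => 2
  | _, _, _ => 0
  end.

(** The factor 2 of the bracket is included: these are the values of 2 tr(AB). *)
Definition sl2tr (b c : sl2b) : F :=
  match b, c with
  | Xp, Xm | Xm, Xp => 2 | Av, Av => 4 | _, _ => 0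
  end.

Lemma tens2_sl2mx b a : tens2 (sl2mx F b) a = inj2 b a.
Proof.
apply/ffunP => c; rewrite !ffunE.
by case: b; case: c; rewrite /= /entry !mxE /= ?inordK //= ?subr0 ?scale0r ?scale1r.
Qed.

Lemma sl2lieE b c d : sl2coord (mxlie (sl2mx F b) (sl2mx F c)) d = sl2lie b c d.
Proof.
case: b; case: c; case: d;
rewrite /= /mxlie /entry !mxE !big_ord_recl !big_ord0 !mxE /= ?inordK //=;
by rewrite ?(mulr0, mul0r, mulr1, mul1r, subr0, sub0r, addr0, add0r,
              subrr, oppr0, opprK, mulrN1, mulN1r); ring.
Qed.

Lemma sl2trE b c : 2 * \tr (sl2mx F b *m sl2mx F c) = sl2tr b c.
Proof.
case: b; case: c; rewrite /= /mxtrace !big_ord_recl !big_ord0 !mxE;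
rewrite !big_ord_recl !big_ord0 !mxE /=;
by rewrite ?(mulr0, mul0r, mulr1, mul1r, subr0, sub0r, addr0, add0r,
              subrr, oppr0, opprK, mulrN1, mulN1r); ring.
Qed.

End TKKside.

(** * Brackets of the generators of the TKK algebra *)

Section TKKgenerators.
Variable F : numFieldType.
Local Notation J := (J F).
Local Notation JJ := (JJ F).
Local Notation xJ := (xJ F).
Local Notation tkk := (tkk F).
Local Notation gJ := (gJ F).

Definition tkkl (u : sl2J F) : tkk := (u, 0).
Definition tkkr (j : JJ) : tkk := (0, j).

Lemma tkkl_linear : linear tkkl.
Proof. by apply: linear_pair; [exact: linear_id | exact: linear_zero]. Qed.

Lemma tkkr_linear : linear tkkr.
Proof. by apply: linear_pair; [exact: linear_zero | exact: linear_id]. Qed.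

Lemma inj2_linear b : linear (@inj2 F b).
Proof.
apply: linear_ffun => c; case: eqP => _; [exact: linear_id | exact: linear_zero].
Qed.

Lemma inj2E b (a : J) c : inj2 b a c = if c == b then a else 0.
Proof. exact: ffunE. Qed.

Lemma big_inj2 (V : lmodType F) (h : sl2b -> sl2b -> J -> J -> V) b0 c0 a a' :
  (forall b c x, h b c 0 x = 0) -> (forall b c x, h b c x 0 = 0) ->
  \sum_b \sum_c h b c (inj2 b0 a b) (inj2 c0 a' c) = h b0 c0 a a'.
Proof.
move=> h1 h2; rewrite (bigD1 b0) //= [X in _ + X]big1 ?addr0.
  rewrite (bigD1 c0) //= [X in _ + X]big1 ?addr0 ?inj2E ?eqxx // => c /negbTE cc.
  by rewrite (inj2E c0) cc h2.
move=> b /negbTE phi_b; apply: big1 => c _.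
by rewrite (inj2E b0) phi_b h1.
Qed.

Lemma derP0l (c : J) : derP (0 : perpM F) c = 0. Proof. exact: lin0 (derP_linl c). Qed.
Lemma derP0r (u : perpM F) : derP u (0 : J) = 0. Proof. exact: lin0 (derP_linr u). Qed.
Lemma perpq0 : perpq (0 : JJ) = 0. Proof. exact: lin0 (@perpq_linear F). Qed.

Lemma mulJ0l (c : J) : mulJ 0 c = 0. Proof. exact: lin0 (mulJ_linl c). Qed.
Lemma mulJ0r (c : J) : mulJ c 0 = 0. Proof. exact: lin0 (mulJ_linr c). Qed.
Lemma brJ0l (c : J) : brJ 0 c = 0. Proof. exact: lin0 (brJ_linl c). Qed.
Lemma brJ0r (c : J) : brJ c 0 = 0. Proof. exact: lin0 (brJ_linr c). Qed.

Lemma ffun0 (f : sl2b -> J) : (forall b, f b = 0) -> [ffun b => f b] = 0 :> sl2J F.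
Proof. by move=> f0; apply/ffunP => b; rewrite !ffunE f0. Qed.

Lemma br_ll b c (a a' : J) : tkk_br (tkkl (inj2 b a)) (tkkl (inj2 c a')) =
  tkkl (tens2 (mxlie (sl2mx F b) (sl2mx F c)) (mulJ a a')) + tkkr (sl2tr F b c *: brJ a a').
Proof.
rewrite tkk_brE /tkk_brP /=.
rewrite (big_inj2 (h := fun b c x y => tens2 (mxlie (sl2mx F b) (sl2mx F c)) (mulJ x y))).
- rewrite (big_inj2 (h := fun b c x y => (2 * \tr (sl2mx F b *m sl2mx F c)) *: brJ x y)).
  + rewrite !ffun0 => [|d|d]; rewrite ?perpq0 ?derP0l // (lin0 (perp_br_linl _)) sl2trE.
    by congr (_, _); rewrite ?subrr ?addr0 ?add0r.
  + by move=> ? ? ?; rewrite brJ0l scaler0.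
  + by move=> ? ? ?; rewrite brJ0r scaler0.
- by move=> ? ? ?; rewrite mulJ0l (lin0 (tens2_linear _)).
- by move=> ? ? ?; rewrite mulJ0r (lin0 (tens2_linear _)).
Qed.

Lemma br_rl (j : JJ) c (a : J) :
  tkk_br (tkkr j) (tkkl (inj2 c a)) = tkkl (inj2 c (derP (perpq j) a)).
Proof.
rewrite tkk_brE /tkk_brP /=.
rewrite big1 => [|b _]; last first.
  by apply: big1 => d _; rewrite ffunE mulJ0l (lin0 (tens2_linear _)).
rewrite big1 => [|b _]; last first.
  by apply: big1 => d _; rewrite ffunE brJ0l scaler0.
rewrite perpq0 (lin0 (perp_br_linr _)) !add0r; congr (_, _).
apply/ffunP => b; rewrite !ffunE derP0l subr0.
by case: eqP => // _; rewrite derP0r.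
Qed.

Lemma br_lr (j : JJ) c (a : J) :
  tkk_br (tkkl (inj2 c a)) (tkkr j) = - tkkl (inj2 c (derP (perpq j) a)).
Proof.
rewrite tkk_brE /tkk_brP /=.
rewrite big1 => [|b _]; last first.
  by apply: big1 => d _; rewrite [(0 : sl2J F) d]ffunE mulJ0r (lin0 (tens2_linear _)).
rewrite big1 => [|b _]; last first.
  by apply: big1 => d _; rewrite [(0 : sl2J F) d]ffunE brJ0r scaler0.
rewrite perpq0 (lin0 (perp_br_linl _)) !add0r -(lin_opp tkkl_linear); congr (_, _).
apply/ffunP => b; rewrite !ffunE derP0l sub0r.
by case: eqP => // _; rewrite derP0r.
Qed.

Lemma br_rr (j j' : JJ) : tkk_br (tkkr j) (tkkr j') = tkkr (perp_br (perpq j) (perpq j')).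
Proof.
rewrite tkk_brE /tkk_brP /=.
rewrite big1 => [|b _]; last first.
  by apply: big1 => d _; rewrite !ffunE mulJ0r (lin0 (tens2_linear _)).
rewrite big1 => [|b _]; last first.
  by apply: big1 => d _; rewrite !ffunE brJ0r scaler0.
rewrite !add0r; congr (_, _).
by apply/ffunP => b; rewrite !ffunE !derP0r subrr.
Qed.

Definition tgen (b : sl2b) (r : int * int) : tkk :=
  match b with Xp => xp_ F r | Xm => xm_ F r | Av => av_ F r end.

(** The homogeneous elements of degree v by five coordinates. These are not unique: some generators
    vanish at v, and C_1 and C_2 are linearly related. *)
Definition tc v (p m h c d : F) : tkk :=
  p *: xp_ F v + m *: xm_ F v + h *: av_ F v + c *: C1_ F v + d *: C2_ F v.

Lemma tgen_in b r : inS r -> tgen b r = tkkl (inj2 b (xJ r)).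
Proof. by move=> Sr; case: b; rewrite /= /xp_ /xm_ /av_ ?Sr tens2_sl2mx. Qed.

Lemma av_out r : ~~ inS r -> av_ F r = tkkr (2 *: gJ e1 (r - e1)).
Proof. by move=> Sr; rewrite /av_ (negbTE Sr). Qed.

Lemma xp_out r : ~~ inS r -> xp_ F r = 0.
Proof. by move=> Sr; rewrite /xp_ (xJ_out F Sr) (lin0 (tens2_linear _)). Qed.

Lemma xm_out r : ~~ inS r -> xm_ F r = 0.
Proof. by move=> Sr; rewrite /xm_ (xJ_out F Sr) (lin0 (tens2_linear _)). Qed.

Lemma C1_out r : ~~ inS0 r -> C1_ F r = 0.
Proof. by move=> Sr; rewrite /C1_ (negbTE Sr). Qed.

Lemma C2_out r : ~~ inS0 r -> C2_ F r = 0.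
Proof. by move=> Sr; rewrite /C2_ (negbTE Sr). Qed.

Lemma C1_in r : inS0 r -> C1_ F r = tkkr (gJ e1 (r - e1)).
Proof. by move=> Sr; rewrite /C1_ Sr. Qed.

Lemma C2_in r : inS0 r -> C2_ F r = tkkr (gJ e2 (r - e2)).
Proof. by move=> Sr; rewrite /C2_ Sr. Qed.

Lemma tkkr_nfc r u : tkkr (nfc gJ r u) = r.1%:~R *: C1_ F u + r.2%:~R *: C2_ F u.
Proof.
rewrite /nfc; have [S0|S0] := boolP (inS0 u); last first.
  by rewrite C1_out // C2_out // !scaler0 addr0 (lin0 tkkr_linear).
by rewrite C1_in // C2_in // (lin_add tkkr_linear) !(lin_scale tkkr_linear).
Qed.

Lemma C_rel u : u.1%:~R *: C1_ F u + u.2%:~R *: C2_ F u = 0.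
Proof.
rewrite -tkkr_nfc /nfc; case: ifP => S0; last exact: lin0 tkkr_linear.
by rewrite (nf_rel (@gJC F) (@gJcyc F)) // (lin0 tkkr_linear).
Qed.

(** The normal form of <x^r, x^t> in terms of generators. The 1/2 compensates the factor 2 in alpha
    on S^perp. *)
Lemma tkkr_gJ r t : inS r -> inS t -> tkkr (gJ r t) =
  r.1%:~R *: C1_ F (r + t) + r.2%:~R *: C2_ F (r + t) + (sg F r t / 2) *: av_ F (r + t).
Proof.
move=> Sr St; rewrite (nf (@gJ0 F) (@gJC F) (@gJcyc F)) // (lin_add tkkr_linear) tkkr_nfc.
congr (_ + _); have [S|S] := boolP (inS (r + t)).
  by rewrite sg_perp // mul0r !scale0r (lin0 tkkr_linear).
by rewrite av_out // !(lin_scale tkkr_linear) scalerA divfK // pnatr_eq0.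
Qed.

Lemma tkkl_tens2 (A : 'M[F]_2) a : tkkl (tens2 A a) =
  sl2coord A Xp *: tkkl (inj2 Xp a) + sl2coord A Xm *: tkkl (inj2 Xm a)
  + sl2coord A Av *: tkkl (inj2 Av a).
Proof.
rewrite -!(lin_scale tkkl_linear) -!(lin_add tkkl_linear); congr tkkl.
by apply/ffunP => -[]; rewrite !ffunE /= ?scaler0 ?addr0 ?add0r.
Qed.

(** Here h' is the element of sl_2 tensor J on the vector of alpha, and h is alpha(r + t). In S they
    agree and s = 0. Outside S, h' is 0 and alpha comes from <J, J> alone. The hypothesis covers
    both cases. *)
Lemma tc_assemble (V : lmodType F) (x y h h' c d : V) (a a' a'' k m n s z : F) :
  a'' *: h' = (z - k * s / 2) *: h ->
  a *: x + a' *: y + a'' *: h' + k *: (m *: c + n *: d + (s / 2) *: h)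
  = a *: x + a' *: y + z *: h + (k * m) *: c + (k * n) *: d.
Proof.
move=> ->; rewrite scalerBl !scalerDr !scalerA mulrA -!addrA; congr (_ + (_ + (_ + _))).
by rewrite addrC -!addrA subrr addr0.
Qed.

Lemma br_inS b c r t : inS r -> inS t -> tkk_br (tgen b r) (tgen c t) =
  tc (r + t) (sl2lie F b c Xp) (sl2lie F b c Xm)
     (if inS (r + t) then sl2lie F b c Av else sl2tr F b c * sg F r t / 2)
     (sl2tr F b c * r.1%:~R) (sl2tr F b c * r.2%:~R).
Proof.
move=> Sr St; rewrite !tgen_in // br_ll (lin_scale tkkr_linear) -/(gJ r t) tkkr_gJ // tkkl_tens2.
rewrite !sl2lieE (mulJ_x F Sr St).
have <- : xp_ F (r + t) = tkkl (inj2 Xp (xJ (r + t))) by rewrite /xp_ tens2_sl2mx.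
have <- : xm_ F (r + t) = tkkl (inj2 Xm (xJ (r + t))) by rewrite /xm_ tens2_sl2mx.
apply: tc_assemble; have [S|S] := boolP (inS (r + t)).
  by rewrite sg_perp // mulr0 mul0r subr0 -(tgen_in Av S).
rewrite subrr (xJ_out F S) (lin0 (inj2_linear _)) (lin0 tkkl_linear).
by apply: etrans (scaler0 _ _) _; rewrite scale0r.
Qed.

Lemma sg_e1 r : ~~ inS r -> sg F e1 (r - e1) = 1.
Proof.
by rewrite /sg !inSE /= !oddzE; case: (oddz r.1); case: (oddz r.2).
Qed.

Lemma inS_e1 r : ~~ inS r -> inS (r - e1).
Proof. by rewrite !inSE /= !oddzE; case: (oddz r.1); case: (oddz r.2). Qed.

Lemma perpq_av r : ~~ inS r -> perpq (2 *: gJ e1 (r - e1)) = 2 *: (single r 1 : perpM F).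
Proof.
move=> Sr; rewrite (lin_scale (@perpq_linear F)) perpq_gJ sg_e1 // scale1r.
by rewrite addrC subrK.
Qed.

Lemma derP_av r t : ~~ inS r -> inS t ->
  derP (perpq (2 *: gJ e1 (r - e1))) (xJ t) = (2 * sv F t) *: xJ (r + t).
Proof.
move=> Sr St; rewrite perpq_av // (lin_scale (derP_linl _)) derP_x //.
by rewrite scalerA.
Qed.

Lemma tgen_shift c r t : ~~ inS r -> inS t ->
  tkkl (inj2 c ((2 * sv F t) *: xJ (r + t))) = (2 * sv F t) *: tgen c (r + t).
Proof.
move=> Sr St; rewrite (lin_scale (inj2_linear _)) (lin_scale tkkl_linear).
have [S|S] := boolP (inS (r + t)); first by rewrite tgen_in.
(* Outside S the left side is 0 although alpha(r + t) is not. As r has both coordinates odd, r + t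
   outside S forces t into S_0, where [sv] is 0. *)
have -> : sv F t = 0; last by rewrite mulr0 !scale0r.
move: Sr St S; rewrite /sv !inSE /= !oddzE.
by case: (oddz r.1); case: (oddz r.2); case: (oddz t.1); case: (oddz t.2).
Qed.

Lemma br_perpl c r t : ~~ inS r -> inS t ->
  tkk_br (av_ F r) (tgen c t) = (2 * sv F t) *: tgen c (r + t).
Proof.
move=> Sr St; rewrite av_out // tgen_in // br_rl derP_av //.
exact: tgen_shift.
Qed.

Lemma br_perpr c r t : ~~ inS r -> inS t ->
  tkk_br (tgen c t) (av_ F r) = - ((2 * sv F t) *: tgen c (r + t)).
Proof.
move=> Sr St; rewrite av_out // tgen_in // br_lr derP_av // tgen_shift //.
Qed.

Lemma br_perp2 r t : ~~ inS r -> ~~ inS t ->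
  tkk_br (av_ F r) (av_ F t) = - 4 *: (r.1%:~R *: C1_ F (r + t) + r.2%:~R *: C2_ F (r + t)).
Proof.
move=> Sr St; rewrite !av_out // br_rr !perpq_av //.
rewrite (lin_scale (perp_br_linl _)) (lin_scale (perp_br_linr _)) /perp_br !lext_single.
rewrite scalerA !(lin_scale tkkr_linear) (lin_opp tkkr_linear) tkkr_nfc scalerN -scaleNr.
by congr (- _ *: _); ring.
Qed.

Lemma perpq_C r t : inS (r + t) -> perpq (gJ r t) = 0.
Proof. by move=> S; rewrite perpq_gJ sg_perp // scale0r. Qed.

(** An element of <J, J> enters every bracket only through [perpq]. *)
Lemma br_centr (j : JJ) (q : tkk) : perpq j = 0 ->
  tkk_br (tkkr j) q = 0 /\ tkk_br q (tkkr j) = 0.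
Proof.
move=> j0; have -> : q = \sum_b tkkl (inj2 b (q.1 b)) + tkkr q.2.
  case: q => u v /=; rewrite sum_sl2b; congr (_, _) => //=; rewrite ?add0r ?addr0 //.
  by apply/ffunP => -[]; rewrite !ffunE /= ?addr0 ?add0r.
split.
  rewrite (lin_add (tkk_br_linr _)) (lin_sum (tkk_br_linr _)) br_rr j0 (lin0 (perp_br_linl _)).
  rewrite (lin0 tkkr_linear) addr0 big1 // => b _.
  by rewrite br_rl j0 derP0l (lin0 (inj2_linear _)) (lin0 tkkl_linear).
rewrite (lin_add (tkk_br_linl _)) (lin_sum (tkk_br_linl _)) br_rr j0 (lin0 (perp_br_linr _)).
rewrite (lin0 tkkr_linear) addr0 big1 // => b _.
by rewrite br_lr j0 derP0l (lin0 (inj2_linear _)) (lin0 tkkl_linear) oppr0.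
Qed.

Lemma C1_cent r (q : tkk) : tkk_br (C1_ F r) q = 0 /\ tkk_br q (C1_ F r) = 0.
Proof.
have [S0|S0] := boolP (inS0 r); last first.
  by rewrite C1_out // (lin0 (tkk_br_linl _)) (lin0 (tkk_br_linr _)).
rewrite C1_in //; apply: br_centr; apply: perpq_C; rewrite addrC subrK.
by move: S0; rewrite inS0E inSE => /andP[/negbTE->].
Qed.

Lemma C2_cent r (q : tkk) : tkk_br (C2_ F r) q = 0 /\ tkk_br q (C2_ F r) = 0.
Proof.
have [S0|S0] := boolP (inS0 r); last first.
  by rewrite C2_out // (lin0 (tkk_br_linl _)) (lin0 (tkk_br_linr _)).
rewrite C2_in //; apply: br_centr; apply: perpq_C; rewrite addrC subrK.
by move: S0; rewrite inS0E inSE => /andP[/negbTE->].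
Qed.

Definition tkk_gens : set tkk := [set w |
  [\/ exists b r, (b != Av -> inS r) /\ w = tgen b r,
      exists r, w = C1_ F r | exists r, w = C2_ F r]].

Lemma tkk_span (q : tkk) : lspan tkk_gens q.
Proof.
have -> : q = \sum_b tkkl (inj2 b (q.1 b)) + tkkr q.2.
  case: q => u v /=; rewrite sum_sl2b; congr (_, _) => //=; rewrite ?add0r ?addr0 //.
  by apply/ffunP => -[]; rewrite !ffunE /= ?addr0 ?add0r.
apply: lspanD.
  elim/big_rec: _ => [|b x _ Sx]; first exact: lspan0.
  apply: lspanD Sx; apply: (lspan_img (f := fun a => tkkl (inj2 b a))) (J_span _).
    exact: linear_comp (inj2_linear b) tkkl_linear.
  move=> _ [r Sr ->]; rewrite -tgen_in //; apply: lspan_gen.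
  by constructor 1; exists b, r.
apply: (lspan_img tkkr_linear) (JJ_span _) => _ [r [t [Sr St ->]]].
rewrite tkkr_gJ //; apply: lspanD; first apply: lspanD.
- by apply: lspanZ; apply: lspan_gen; constructor 2; exists (r + t).
- by apply: lspanZ; apply: lspan_gen; constructor 3; exists (r + t).
- by apply: lspanZ; apply: lspan_gen; constructor 1; exists Av, (r + t).
Qed.

End TKKgenerators.

(** * Modes of the twisted algebra and the n-th products *)

Section Modes.
Variable F : numFieldType.
Local Notation Cg := (Cg F).
Local Notation Chat := (Chat F).
Local Notation loopCg := (loopCg F).

Lemma dD_linear : linear (@dD F).
Proof. exact: linear_of. Qed.

Lemma sigma_linear : linear (@sigma F).
Proof. exact: linear_of. Qed.

Lemma tpart_linear r : linear (@tpart F r).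
Proof.
apply: linear_scale; apply: linear_add; first exact: linear_id.
by apply: linear_scale; apply: sigma_linear.
Qed.

Lemma tpart_dD r (a : Cg) : tpart r (dD a) = dD (tpart r a).
Proof.
by rewrite /tpart sigma_dD (lin_scale dD_linear) (lin_add dD_linear) (lin_scale dD_linear).
Qed.

Lemma sign_sub2 (r : int) : (-1) ^ (r - 2) = (-1) ^ r :> F.
Proof.
have e0 : (-1 : F) != 0 by rewrite oppr_eq0 oner_eq0.
by rewrite expfzDr // -invr_expz -[_ ^ 2]/((-1) ^+ 2) sqrrN expr1n invr1 mulr1.
Qed.

Lemma sign_sq (r : int) : (-1) ^ r * (-1) ^ r = 1 :> F.
Proof. by rewrite -expfzMl mulrNN mulr1 exp1rz. Qed.

Lemma tpart_sub2 r (a : Cg) : tpart (r - 2) a = tpart r a.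
Proof. by rewrite /tpart sign_sub2. Qed.

Lemma tpart_sigma r (a : Cg) : tpart r (sigma a) = (-1) ^ r *: tpart r a.
Proof.
rewrite /tpart sigmaK scalerA mulrC -scalerA; congr (_ *: _).
by rewrite scalerDr scalerA sign_sq scale1r addrC.
Qed.

Lemma tpart_fix r (a : Cg) : sigma a = (-1) ^ r *: a -> tpart r a = a.
Proof.
move=> sa; rewrite /tpart sa scalerA sign_sq scale1r -mulr2n -scaler_nat scalerA.
by rewrite mulVf ?pnatr_eq0 // scale1r.
Qed.

Lemma twmon_linear r : linear (@twmon F r).
Proof.
move=> a u v; apply: val_inj => /=.
rewrite -[RHS]/(a *: single r (tpart r u) + single r (tpart r v) : loopCg).
by rewrite -single_linear tpart_linear.
Qed.

Lemma mode_linear r : linear (@mode F r).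
Proof. exact: linear_comp (twmon_linear r) (@qcls_linear _ _ _). Qed.

Definition totDs (r : int) (x : Cg) : loopCg :=
  single r (dD x) + single (r - 2) ((r%:~R / 2) *: x).

Lemma totDs_linear r : linear (totDs r).
Proof.
apply: linear_add; first exact: linear_comp dD_linear (@single_linear _ _ _ _).
by apply: linear_comp (@single_linear _ _ _ _); apply: linear_scale (@linear_id _ _).
Qed.

Lemma totDE (u : loopCg) : totD u = lsum totDs u. Proof. by []. Qed.

Lemma totD_linear : linear (@totD F).
Proof. exact: (lsum_linear totDs_linear). Qed.

Lemma mode_dD r (a : Cg) : mode r (dD a) = - (r%:~R / 2) *: mode (r - 2) a.
Proof.
rewrite -(lin_scale (mode_linear _)); apply: qcls_eq; apply: lspan_gen.
exists (twmon r a); rewrite totDE.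
rewrite -[LHS]/(single r (tpart r (dD a))
                - single (r - 2) (tpart (r - 2) (- (r%:~R / 2) *: a)) : loopCg).
rewrite (lsum_single _ _ totDs_linear) /totDs tpart_sub2 tpart_dD; congr (_ + _).
by rewrite -(lin_opp (@single_linear _ _ _ _)) scaleNr (lin_opp (tpart_linear _)) opprK
  (lin_scale (tpart_linear _)).
Qed.

(** [mode] first projects to the eigenspace of sigma for (-1)^r. *)
Lemma mode_sigma r (a : Cg) : mode r (sigma a) = (-1) ^ r *: mode r a.
Proof.
rewrite -(lin_scale (mode_linear _)) /mode; congr qcls; apply: val_inj => /=.
by congr single; rewrite tpart_sigma (lin_scale (tpart_linear _)).
Qed.

Lemma twvalE (w : twisted F) r : tpart r (twval w r) = twval w r.
Proof. by case: w => u /= /asboolP tw; apply: tpart_fix. Qed.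

Lemma Chat_span (q : Chat) : lspan [set w | exists r a, w = mode r a] q.
Proof.
rewrite -[q]qcls_repr; move: (repr q) => w.
have [A wA] := fs_supp (twval w).
have -> : w = \sum_(r <- A) twmon r (twval w r).
  apply: val_inj; rewrite -[LHS]/(twval w) [RHS]raddf_sum /=; apply: fs_ext => k.
  have -> : (\sum_(j <- A) val (twmon j (twval w j))) k =
      \sum_(j <- A) (if k == j then twval w j else 0).
    elim/big_rec2: _ => // j x y _ <-.
    rewrite -[LHS]/((if k == j then tpart j (twval w j) else 0) + y k).
    by rewrite twvalE.
  have [kA|kA] := boolP (k \in A).
    rewrite (big_fsetD1 k kA) /= eqxx big_seq big1 ?addr0 // => j.
    by rewrite !inE eq_sym => /andP[/negbTE -> _].
  rewrite wA // big_seq big1 // => j jA.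
  by case: eqP kA => // ->; rewrite jA.
rewrite (lin_sum (@qcls_linear _ _ _)).
elim/big_rec: _ => [|r x _ Sx]; first exact: lspan0.
by apply: lspanD Sx; apply: lspan_gen; exists r, (twval w r).
Qed.

Lemma nprod_linl n (b : Cg) : linear ((@nprod F n)^~ b).
Proof. exact: lext_linear. Qed.

Lemma nprod_linr n (a : Cg) : linear (nprod n a).
Proof. by apply: lext_linear_fun => k; apply: lext_linear. Qed.

Lemma nprod_elt n p q : nprod n (cg_elt F p) (cg_elt F q) = nprod_b F n p q.
Proof. by rewrite /nprod !lext_single. Qed.

Lemma Cg_span (a : Cg) : lspan [set w | exists p, w = cg_elt F p] a.
Proof. exact: fs_span1. Qed.

Lemma dD_inr : dD (cg_elt F (inr tt)) = 0. Proof. exact: lext_single. Qed.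

(** At n = 0 the truncated predecessor is harmless, since its coefficient is 0. *)
Lemma nprod_dDl n (a b : Cg) : nprod n (dD a) b = - n%:R *: nprod n.-1 a b.
Proof.
move: a b (Cg_span a) (Cg_span b).
apply: span_eq_lin2 => [b|b|a|a|].
- exact: linear_comp dD_linear (nprod_linl _ _).
- exact: linear_scale (nprod_linl _ _).
- exact: nprod_linr.
- exact: linear_scale (nprod_linr _ _).
move=> _ _ [[[i g]|[]] ->] [q ->]; last first.
  by rewrite dD_inr (lin0 (nprod_linl _ _)) nprod_elt /= scaler0.
by rewrite dD_elt !nprod_elt; case: q => [[j h]|[]] /=; rewrite ?scaler0 ?scaleNr.
Qed.

Lemma nprod_l_dD i j n g h :
  nprod_l F i j.+1 n g h = dD (nprod_l F i j n g h) + n%:R *: nprod_l F i j n.-1 g h.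
Proof.
elim: i n => [//|i IH] n /=; rewrite IH scalerDr opprD scalerN.
rewrite (lin_opp dD_linear) (lin_scale dD_linear); congr (_ - _).
Qed.

Lemma nprod_dDr n (a b : Cg) : nprod n a (dD b) = dD (nprod n a b) + n%:R *: nprod n.-1 a b.
Proof.
move: a b (Cg_span a) (Cg_span b).
apply: span_eq_lin2 => [b|b|a|a|].
- exact: nprod_linl.
- apply: linear_add; last exact: linear_scale (nprod_linl _ _).
  exact: linear_comp (nprod_linl _ _) dD_linear.
- exact: linear_comp dD_linear (nprod_linr _ _).
- apply: linear_add; last exact: linear_scale (nprod_linr _ _).
  exact: linear_comp (nprod_linr _ _) dD_linear.
move=> _ _ [p ->] [[[j h]|[]] ->]; last first.
  rewrite dD_inr (lin0 (nprod_linr _ _)) !nprod_elt; case: p => [[i g]|[]] /=;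
  by rewrite scaler0 (lin0 dD_linear) addr0.
rewrite dD_elt !nprod_elt; case: p => [[i g]|[]] /=; first exact: nprod_l_dD.
by rewrite scaler0 (lin0 dD_linear) addr0.
Qed.

(** A bound for the sum over all i in the bracket, which becomes a finite sum. Each D in an argument
    raises the bound by one, starting from 2. *)
Definition nvan (a b : Cg) (N : nat) := forall n, (N <= n)%N -> nprod n a b = 0.

Lemma nprod_g_van n g h : (2 <= n)%N -> nprod_g F n g h = 0.
Proof. by case: g => [[x m]|?]; case: h => [[y m']|?] //; case: n => [|[]]. Qed.

Lemma nprod_r_van j n g h : (j + 2 <= n)%N -> nprod_r F j n g h = 0.
Proof.
elim: j n => [|j IH] n jn; first exact: nprod_g_van.
by rewrite /= !IH ?(lin0 dD_linear) ?scaler0 ?addr0 //; lia.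
Qed.

Lemma nprod_l_van i j n g h : (i + j + 2 <= n)%N -> nprod_l F i j n g h = 0.
Proof.
elim: i n => [|i IH] n jn; first exact: nprod_r_van.
by rewrite /= IH ?scaler0 ?oppr0 //; lia.
Qed.

Lemma nvanW a b N N' : (N <= N')%N -> nvan a b N -> nvan a b N'.
Proof. by move=> NN v n nN; apply: v; apply: leq_trans NN nN. Qed.

Lemma nvan_ex a b : exists N, nvan a b N.
Proof.
elim: (Cg_span a) => [|_ [p ->]|c x y _ [N vN] _ [N' vN']].
- by exists 0%N => n _; apply: lin0 (nprod_linl _ _).
- elim: (Cg_span b) => [|_ [q ->]|c x y _ [N vN] _ [N' vN']].
  + by exists 0%N => n _; apply: lin0 (nprod_linr _ _).
  + case: p => [[i g]|[]]; last by exists 0%N => n _; rewrite nprod_elt.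
    case: q => [[j h]|[]]; last by exists 0%N => n _; rewrite nprod_elt.
    by exists (i + j + 2)%N => n nN; rewrite nprod_elt /= nprod_l_van.
  + exists (maxn N N') => n; rewrite geq_max => /andP[nN nN'].
    by rewrite nprod_linr vN // vN' // scaler0 addr0.
- exists (maxn N N') => n; rewrite geq_max => /andP[nN nN'].
  by rewrite nprod_linl vN // vN' // scaler0 addr0.
Qed.

(** The recurrence that matches a derivative in the left argument of the bracket; [gbinom_Sr] is the
    one for the right argument. *)
Lemma gbinom_Sl (x : F) i : i.+1%:R * gbinom x i.+1 = x * gbinom (x - 1) i.
Proof.
have i0 : i.+1%:R != 0 :> F by rewrite pnatr_eq0.
have f0 : i`!%:R != 0 :> F by rewrite pnatr_eq0 -lt0n fact_gt0.
rewrite /gbinom big_ord_recl /= subr0 factS natrM invfM.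
rewrite (eq_bigr (fun k : 'I_i => x - 1 - k%:R)); last first.
  by move=> k _; rewrite /bump /= natrD opprD addrA.
move: (\prod_(_ < _) _) (i.+1%:R) i0 (i`!%:R) f0 => P n n0 f f0; by field; rewrite n0 f0.
Qed.

Lemma gbinom_Sr (x : F) i : i.+1%:R * gbinom x i.+1 = (x - i%:R) * gbinom x i.
Proof.
have i0 : i.+1%:R != 0 :> F by rewrite pnatr_eq0.
have f0 : i`!%:R != 0 :> F by rewrite pnatr_eq0 -lt0n fact_gt0.
rewrite /gbinom big_ord_recr /= factS natrM invfM.
move: (\prod_(_ < _) _) (i.+1%:R) i0 (i`!%:R) f0 => P n n0 f f0; by field; rewrite n0 f0.
Qed.

Definition mbr_term (r s : int) (a b : Cg) (i : nat) : Chat :=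
  gbinom (r%:~R / 2) i *: mode (r + s - (2 * i)%:Z) (nprod i a b).

(** The bracket formula for arbitrary a and b, whether or not they are eigenvectors of sigma. This
    makes it bilinear on all of [Cg], so that it can be computed on basis elements. *)
Definition mbr (r s : int) (a b : Cg) : Chat := \sum_(i \in [set: nat]) mbr_term r s a b i.

Lemma mbrE r s a b N : nvan a b N -> mbr r s a b = \sum_(i < N) mbr_term r s a b i.
Proof.
move=> vN; rewrite fsbig_ord /mbr; apply/esym; apply: fsbig_widen => // i [_ /= Ni].
rewrite /mbr_term vN ?(lin0 (mode_linear _)) ?scaler0 //.
by rewrite leqNgt; apply/negP.
Qed.

Lemma mbr_term_linl r s b i : linear (fun a => mbr_term r s a b i).
Proof.
by apply: linear_scale; apply: linear_comp (nprod_linl _ _) (mode_linear _).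
Qed.

Lemma mbr_term_linr r s a i : linear (fun b => mbr_term r s a b i).
Proof.
by apply: linear_scale; apply: linear_comp (nprod_linr _ _) (mode_linear _).
Qed.

Lemma mbr_linl r s b : linear ((mbr r s)^~ b).
Proof.
move=> c x y; have [N vN] := nvan_ex x b; have [N' vN'] := nvan_ex y b.
have v1 := nvanW (leq_maxl N N') vN; have v2 := nvanW (leq_maxr N N') vN'.
have v3 : nvan (c *: x + y) b (maxn N N').
  by move=> n nN; rewrite nprod_linl v1 // v2 // scaler0 addr0.
rewrite (mbrE _ _ v1) (mbrE _ _ v2) (mbrE _ _ v3).
exact: (linear_bigsum _ _ (fun i : 'I__ => mbr_term_linl r s b i)).
Qed.

Lemma mbr_linr r s a : linear (mbr r s a).
Proof.
move=> c x y; have [N vN] := nvan_ex a x; have [N' vN'] := nvan_ex a y.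
have v1 := nvanW (leq_maxl N N') vN; have v2 := nvanW (leq_maxr N N') vN'.
have v3 : nvan a (c *: x + y) (maxn N N').
  by move=> n nN; rewrite nprod_linr v1 // v2 // scaler0 addr0.
rewrite (mbrE _ _ v1) (mbrE _ _ v2) (mbrE _ _ v3).
exact: (linear_bigsum _ _ (fun i : 'I__ => mbr_term_linr r s a i)).
Qed.

Lemma half_sub2 (r : int) : (r - 2)%:~R / 2 = r%:~R / 2 - 1 :> F.
Proof. by rewrite intrD mulrDl mulNr divff // pnatr_eq0. Qed.

(** The term i = 0 vanishes, and the shift of i by one absorbs the factor i + 1 into the binomial by
    [gbinom_Sl]. *)
Lemma mbr_dDl r s a b : mbr r s (dD a) b = - (r%:~R / 2) *: mbr (r - 2) s a b.
Proof.
have [N vN] := nvan_ex a b.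
have vD : nvan (dD a) b N.+1 by case=> // n nN; rewrite nprod_dDl /= vN ?scaler0.
have t0 : mbr_term r s (dD a) b 0 = 0.
  rewrite /mbr_term nprod_dDl; have -> : - 0%:R = 0 :> F by rewrite oppr0.
  by rewrite scale0r (lin0 (mode_linear _)) scaler0.
rewrite (mbrE _ _ vN) (mbrE _ _ vD) big_ord_recl -[X in X + _ = _]/(mbr_term r s (dD a) b 0) t0.
rewrite add0r scaler_sumr; apply: eq_bigr => i _.
rewrite /mbr_term nprod_dDl /= (lin_scale (mode_linear _)) !scalerA half_sub2.
have -> : r - 2 + s - (2 * i)%:Z = r + s - (2 * bump 0 i)%:Z by rewrite /bump; lia.
by congr (_ *: _); rewrite mulrN mulNr mulrC [bump 0 i]add1n gbinom_Sl.
Qed.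

Lemma mbr_dDr r s a b : mbr r s a (dD b) = - (s%:~R / 2) *: mbr r (s - 2) a b.
Proof.
have [N vN] := nvan_ex a b.
have vD : nvan a (dD b) N.+1.
  case=> // n nN; rewrite nprod_dDr /= !vN ?scaler0 ?addr0 ?(lin0 dD_linear) //.
  exact: ltnW.
rewrite (mbrE _ _ (nvanW (leqnSn N) vN)) (mbrE _ _ vD) scaler_sumr.
(* D b contributes D (a_i b) and i a_(i-1) b. Written in the [T i], the first has coefficient - ((r
   + s) / 2 - i) and the second, after a shift, r / 2 - i. Their sum is - s / 2. The boundary term
   [T N] is 0. *)
pose T i := gbinom (r%:~R / 2 : F) i *: mode (r + s - 2 - (2 * i)%:Z) (nprod i a b).
have t1 (i : nat) : mbr_term r s a (dD b) i =
    (- ((r + s)%:~R / 2 - i%:R)) *: T i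
    + (if i is j.+1 then ((r%:~R / 2) - j%:R) *: T j else 0).
  rewrite /mbr_term nprod_dDr (lin_add (mode_linear _)) scalerDr mode_dD; congr (_ + _).
    rewrite /T !scalerA; have -> : r + s - (2 * i)%:Z - 2 = r + s - 2 - (2 * i)%:Z by lia.
    congr (_ *: _); rewrite mulrC; congr (- _ * _).
    by rewrite PoszM; field.
  case: i => [|j]; first by rewrite scale0r (lin0 (mode_linear _)) scaler0.
  rewrite (lin_scale (mode_linear _)) /T !scalerA -gbinom_Sr mulrC.
  by congr (_ *: mode _ _); lia.
have t2 (i : nat) : - (s%:~R / 2) *: mbr_term r (s - 2) a b i = - (s%:~R / 2) *: T i.
  by rewrite /mbr_term /T addrA.
under eq_bigr do rewrite t1; under [RHS]eq_bigr do rewrite t2.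
rewrite big_split [X in _ + X = _]big_ord_recl /= add0r.
rewrite [in LHS]big_ord_recr /= [in RHS]big_ord_recr /=.
have -> : T N = 0 by rewrite /T vN // (lin0 (mode_linear _)) scaler0.
rewrite !scaler0 !addr0 -big_split; apply: eq_bigr => i _ /=.
rewrite -scalerDl; congr (_ *: _); rewrite intrD mulrDl; ring.
Qed.

End Modes.

(** * Bilinearity of the twisted bracket *)

Section TwistedBracket.
Variable F : numFieldType.
Local Notation Cg := (Cg F).
Local Notation Chat := (Chat F).
Local Notation loopCg := (loopCg F).

Definition loop_br (u v : loopCg) : Chat :=
  lsum (fun r a => lsum (fun s b => mbr r s a b) v) u.

Lemma loop_br_in_lin r (a : Cg) : linear (lsum (fun s b => mbr r s a b) : loopCg -> Chat).
Proof. by apply: lsum_linear => s; apply: mbr_linr. Qed.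

Lemma loop_br_out_lin (v : loopCg) r : linear (fun a : Cg => lsum (fun s b => mbr r s a b) v).
Proof.
by apply: lsum_linear_fun => [a s|s b]; [exact: mbr_linr | exact: mbr_linl].
Qed.

Lemma loop_br_linl v : linear (loop_br^~ v).
Proof. by apply: lsum_linear => r; apply: loop_br_out_lin. Qed.

Lemma loop_br_linr u : linear (loop_br u).
Proof.
by apply: lsum_linear_fun => [v r|r a]; [exact: loop_br_out_lin | exact: loop_br_in_lin].
Qed.

Lemma loop_br_single r s (a b : Cg) : loop_br (single r a) (single s b) = mbr r s a b.
Proof.
rewrite /loop_br (lsum_single _ _ (loop_br_out_lin _)).
by rewrite (lsum_single _ _ (mbr_linr r ^~ a)).
Qed.

Lemma loop_br_totDl (u v : loopCg) : loop_br (totD u) v = 0.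
Proof.
move: u v (fs_span u) (fs_span v).
apply: (@span_eq_lin2 _ _ _ _ _ _ (fun u v => loop_br (totD u) v) (fun _ _ => 0)).
- by move=> v; apply: linear_comp (@totD_linear F) (loop_br_linl v).
- by move=> v; apply: linear_zero.
- by move=> u; apply: loop_br_linr.
- by move=> v; apply: linear_zero.
move=> _ _ [r [a ->]] [s [b ->]].
rewrite totDE (lsum_single _ _ (@totDs_linear F)) /totDs (lin_add (loop_br_linl _)) !loop_br_single.
rewrite mbr_dDl (lin_scale (mbr_linl _ _ _)) -scalerDl addNr; exact: scale0r.
Qed.

Lemma loop_br_totDr (u v : loopCg) : loop_br u (totD v) = 0.
Proof.
move: u v (fs_span u) (fs_span v).
apply: (@span_eq_lin2 _ _ _ _ _ _ (fun u v => loop_br u (totD v)) (fun _ _ => 0)).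
- by move=> v; apply: loop_br_linl.
- by move=> v; apply: linear_zero.
- by move=> u; apply: linear_comp (@totD_linear F) (loop_br_linr u).
- by move=> v; apply: linear_zero.
move=> _ _ [r [a ->]] [s [b ->]].
rewrite totDE (lsum_single _ _ (@totDs_linear F)) /totDs (lin_add (loop_br_linr _)) !loop_br_single.
rewrite mbr_dDr (lin_scale (mbr_linr _ _ _)) -scalerDl addNr; exact: scale0r.
Qed.

Lemma twval_linear : linear (@twval F).
Proof. by []. Qed.

Lemma Chat_br_qcls (w w' : twisted F) :
  Chat_br (qcls (@imtotD F) w) (qcls (@imtotD F) w') = loop_br (twval w) (twval w').
Proof.
have BE x y : Chat_br x y = loop_br (twval (repr x)) (twval (repr y)) by [].
rewrite BE.
(* The representative of a class differs from w by an element spanned by the image of [totD], on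
   which the bracket vanishes in either argument. *)
have K1 v x : lspan (@imtotD F) x -> loop_br (twval x) v = 0.
  apply: (span_lin0 (f := fun x : twisted F => loop_br (twval x) v)).
    exact: linear_comp twval_linear (loop_br_linl v).
  by move=> y [u ->]; apply: loop_br_totDl.
have K2 v x : lspan (@imtotD F) x -> loop_br v (twval x) = 0.
  apply: (span_lin0 (f := fun x : twisted F => loop_br v (twval x))).
    exact: linear_comp twval_linear (loop_br_linr v).
  by move=> y [u ->]; apply: loop_br_totDr.
have L1 v := linear_comp twval_linear (loop_br_linl v).
have L2 v := linear_comp twval_linear (loop_br_linr v).
move: (repr_qcls (@imtotD F) w) (repr_qcls (@imtotD F) w').
move: (repr (qcls _ w)) (repr (qcls _ w')) => z z' /K1 H /K2 H'.
transitivity (loop_br (twval w) (twval z')).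
  apply/eqP; rewrite -subr_eq0 -(lin_opp (L1 _)) -(lin_add (L1 _)); apply/eqP; exact: H.
apply/eqP; rewrite -subr_eq0 -(lin_opp (L2 _)) -(lin_add (L2 _)); apply/eqP; exact: H'.
Qed.

Lemma Chat_br_linl (y : Chat) : linear ((@Chat_br F)^~ y).
Proof.
move=> c x x'; rewrite -[y]qcls_repr -[x]qcls_repr -[x']qcls_repr.
rewrite -(@qcls_linear F _ _ c (repr x) (repr x')) !Chat_br_qcls.
exact: linear_comp twval_linear (loop_br_linl _) _ _ _.
Qed.

Lemma Chat_br_linr (x : Chat) : linear (Chat_br x).
Proof.
move=> c y y'; rewrite -[y]qcls_repr -[x]qcls_repr -[y']qcls_repr.
rewrite -(@qcls_linear F _ _ c (repr y) (repr y')) !Chat_br_qcls.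
exact: linear_comp twval_linear (loop_br_linr _) _ _ _.
Qed.

Lemma Chat_br_mode r s (a b : Cg) :
  Chat_br (mode r a) (mode s b) = mbr r s (tpart r a) (tpart s b).
Proof. by rewrite Chat_br_qcls /= loop_br_single. Qed.

End TwistedBracket.

(** * Structure constants of sp_4 *)

Definition sp4lie (b c d : sp4b) : int :=
  match b, c, d with
  | XH1, X13, X13 => 2
  | XH1, X31, X31 => -2
  | XH1, X12, X12 | XH1, X14, X14 => 1
  | XH1, X21, X21 | XH1, X41, X41 => -1
  | XH2, X24, X24 => 2
  | XH2, X42, X42 => -2
  | XH2, X12, X12 | XH2, X41, X41 => -1
  | XH2, X21, X21 | XH2, X14, X14 => 1
  | X13, XH1, X13 => -2
  | X13, X31, XH1 | X13, X41, X12 => 1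
  | X13, X21, X14 => -1
  | X31, XH1, X31 => 2
  | X31, X13, XH1 | X31, X14, X21 => -1
  | X31, X12, X41 => 1
  | X24, XH2, X24 => -2
  | X24, X42, XH2 | X24, X41, X21 => 1
  | X24, X12, X14 => -1
  | X42, XH2, X42 => 2
  | X42, X24, XH2 | X42, X14, X12 => -1
  | X42, X21, X41 => 1
  | X12, XH1, X12 | X12, X31, X41 | X12, X21, XH2 => -1
  | X12, XH2, X12 | X12, X24, X14 | X12, X21, XH1 => 1
  | X12, X14, X13 => 2
  | X12, X41, X42 => -2
  | X21, XH1, X21 | X21, X13, X14 | X21, X12, XH2 => 1
  | X21, XH2, X21 | X21, X42, X41 | X21, X12, XH1 => -1
  | X21, X14, X24 => 2
  | X21, X41, X31 => -2
  | X14, XH1, X14 | X14, XH2, X14 => -1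
  | X14, X31, X21 | X14, X42, X12 | X14, X41, XH1 | X14, X41, XH2 => 1
  | X14, X12, X13 | X14, X21, X24 => -2
  | X41, XH1, X41 | X41, XH2, X41 => 1
  | X41, X13, X12 | X41, X24, X21 | X41, X14, XH1 | X41, X14, XH2 => -1
  | X41, X12, X42 | X41, X21, X31 => 2
  | _, _, _ => 0
  end.

Definition sp4tr (b c : sp4b) : int :=
  match b, c with
  | XH1, XH1 | XH2, XH2 | X12, X21 | X21, X12 | X14, X41 | X41, X14 => 2
  | X13, X31 | X31, X13 | X24, X42 | X42, X24 => 1
  | _, _ => 0
  end.

(** The basis matrices over the integers, where brackets and traces are evaluated by computation;
    the field F is abstract and does not compute. *)
Definition sp4mxz (b : sp4b) (i j : nat) : int :=
  let e k l : int := ((i == k) && (j == l))%N%:Z in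
  match b with
  | XH1 => e 1 1 - e 3 3 | XH2 => e 2 2 - e 4 4
  | X13 => e 1 3 | X31 => e 3 1 | X24 => e 2 4 | X42 => e 4 2
  | X12 => e 1 2 - e 4 3 | X21 => e 2 1 - e 3 4
  | X14 => e 1 4 + e 2 3 | X41 => e 4 1 + e 3 2
  end.

Definition sp4mulz (b c : sp4b) (i j : nat) : int :=
  foldr (fun k s => sp4mxz b i k * sp4mxz c k j + s) 0 [:: 1; 2; 3; 4]%N.

Section Sp4.
Variable F : numFieldType.

Lemma sp4mxE b (i j : 'I_4) : sp4mx F b i j = (sp4mxz b i.+1 j.+1)%:~R.
Proof. by case: b; rewrite !mxE ?intrD ?mulrNz. Qed.

Lemma sp4mulE b c (i j : 'I_4) :
  (sp4mx F b *m sp4mx F c) i j = (sp4mulz b c i.+1 j.+1)%:~R.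
Proof.
rewrite mxE; under eq_bigr do rewrite !sp4mxE -intrM.
by rewrite !big_ord_recl big_ord0 !addr0 /sp4mulz /= !intrD addr0.
Qed.

Lemma sp4lieE b c d :
  sp4coord (mxlie (sp4mx F b) (sp4mx F c)) d = (sp4lie b c d)%:~R.
Proof.
have E i j : entry (mxlie (sp4mx F b) (sp4mx F c)) i.+1 j.+1 =
    (sp4mulz b c (inord i : 'I_4).+1 (inord j : 'I_4).+1
     - sp4mulz c b (inord i : 'I_4).+1 (inord j : 'I_4).+1)%:~R.
  by rewrite /entry /mxlie mxE [X in _ + X]mxE !sp4mulE intrB.
case: d; rewrite /= E !inordK //; congr (_%:~R);
  case: b {E}; case: c; vm_compute; reflexivity.
Qed.

Lemma sp4trE b c : \tr (sp4mx F b *m sp4mx F c) = (sp4tr b c)%:~R.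
Proof.
rewrite /mxtrace; under eq_bigr do rewrite sp4mulE.
rewrite !big_ord_recl big_ord0 addr0 -!intrD; congr (_%:~R).
by case: b; case: c; vm_compute.
Qed.

End Sp4.

Lemma comb5_scale (F : fieldType) (V : lmodType F) (x y z t u : V) (a p m h c d : F) :
  a *: (p *: x + m *: y + h *: z + c *: t + d *: u) =
  (a * p) *: x + (a * m) *: y + (a * h) *: z + (a * c) *: t + (a * d) *: u.
Proof. by rewrite !scalerDr !scalerA. Qed.

Lemma comb5_add (F : fieldType) (V : lmodType F) (x y z t u : V)
    (p m h c d p' m' h' c' d' : F) :
  (p *: x + m *: y + h *: z + c *: t + d *: u) +
  (p' *: x + m' *: y + h' *: z + c' *: t + d' *: u) =
  (p + p') *: x + (m + m') *: y + (h + h') *: z + (c + c') *: t + (d + d') *: u.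
Proof.
by rewrite !scalerDl [LHS](AC (5*5) ((1*6)*(2*7)*(3*8)*(4*9)*(5*10))).
Qed.

(** * The inverse map on modes *)

Section Psi.
Variable F : numFieldType.
Variable ii : F.
Local Notation Cg := (Cg F).
Local Notation tkk := (tkk F).
Local Notation tc := (@tc F).

Lemma tc_scale v a p m h c d :
  a *: tc v p m h c d = tc v (a * p) (a * m) (a * h) (a * c) (a * d).
Proof. exact: comb5_scale. Qed.

Lemma tc_add v p m h c d p' m' h' c' d' :
  tc v p m h c d + tc v p' m' h' c' d' = tc v (p + p') (m + m') (h + h') (c + c') (d + d').
Proof. exact: comb5_add. Qed.

Lemma tc0 v : tc v 0 0 0 0 0 = 0.
Proof. by rewrite -(mul0r (0 : F)) -tc_scale; exact: scale0r. Qed.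

Lemma tc_sum (I : Type) (s : seq I) v (p m h c d : I -> F) :
  \sum_(i <- s) tc v (p i) (m i) (h i) (c i) (d i) =
  tc v (\sum_(i <- s) p i) (\sum_(i <- s) m i) (\sum_(i <- s) h i)
       (\sum_(i <- s) c i) (\sum_(i <- s) d i).
Proof.
elim: s => [|i s IH]; first by rewrite !big_nil tc0.
rewrite !big_cons -tc_add; congr (_ + _); exact: IH.
Qed.

Lemma tc_C2 v c : c *: C2_ F v = tc v 0 0 0 0 c.
Proof.
have A (V : lmodType F) (x y z t u : V) : c *: u = 0 *: x + 0 *: y + 0 *: z + 0 *: t + c *: u.
  by rewrite !scale0r !add0r.
exact: A.
Qed.

Lemma tc_gen v g c : c *: tgen F g v =
  tc v (c *+ (g == Xp)) (c *+ (g == Xm)) (c *+ (g == Av)) 0 0.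
Proof.
have A (V : lmodType F) (x y z t u : V) : c *: x = c *: x + 0 *: y + 0 *: z + 0 *: t + 0 *: u.
  by rewrite !scale0r !addr0.
have B (V : lmodType F) (x y z t u : V) : c *: y = 0 *: x + c *: y + 0 *: z + 0 *: t + 0 *: u.
  by rewrite !scale0r !addr0 add0r.
have D (V : lmodType F) (x y z t u : V) : c *: z = 0 *: x + 0 *: y + c *: z + 0 *: t + 0 *: u.
  by rewrite !scale0r !addr0 !add0r.
by case: g; [exact: A | exact: B | exact: D].
Qed.

(* The grading of sp_4 for which x tensor t_2^n has second degree 2 n + sp4deg x. *)
Definition sp4deg (b : sp4b) : int :=
  match b with
  | X14 | X21 => 1 | X12 | X41 => -1 | X24 => 2 | X42 => -2 | _ => 0
  end.

(** The argument [e] is the sign (-1)^r. It appears exactly at the basis elements that are reached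
    through sigma: [X42] here, and likewise [X24], [XH2] and [X41] below. *)
Definition wp (e : F) b : F :=
  match b with X13 => 2^-1 | X12 => - ii | X42 => e / 2 | _ => 0 end.
Definition wm (e : F) b : F :=
  match b with X31 => 2^-1 | X21 => ii | X24 => e / 2 | _ => 0 end.
Definition wh (e : F) b : F :=
  match b with
  | XH1 => 2^-1 | XH2 => - (e / 2) | X14 => - (ii / 2) | X41 => ii * e / 2 | _ => 0
  end.
(** Comes from the correction kappa_n in sigma of [XH1], which psi sends to 2 C_2. *)
Definition wd b : F := if b is XH2 then 2 else 0.

(* The image under psi of (x tensor t_2^n)(r/2), found by solving the formulas
   for phi; for b outside the image of phi_b it is forced by
   (sigma a)(r/2) = (-1)^r a(r/2). *)
Definition wx (r : int) (b : sp4b) (n : int) : tkk :=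
  let e := (-1) ^ r in tc (r, 2 * n + sp4deg b) (wp e b) (wm e b) (wh e b) 0 (wd b).

(** The shift r + 2 inverts the m - 1 in the image of C_1(2m, 2n); the factors 2 invert the 1/2. *)
Definition W0 (r : int) (g : gbasis) : tkk :=
  match g with
  | inl (b, n) => wx r b n
  | inr (inl _) => (2 : F) *: C2_ F (r, 0)
  | inr (inr s) => (2 : F) *: C1_ F (r + 2, 2 * val s)
  end.

(** The product results from applying (D a)(r/2) = - (r/2) a(r/2 - 1) i times. *)
Definition Wb (r : int) (p : cgbasis) : tkk :=
  match p with
  | inl (i, g) => (\prod_(k < i) (k%:R - r%:~R / 2) : F) *: W0 (r - (2 * i)%:Z) g
  | inr _ => (2 : F) *: C1_ F (r + 2, 0)
  end.

Definition W (r : int) : Cg -> tkk := lext (Wb r).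

Lemma W_linear r : linear (W r).
Proof. exact: lext_linear. Qed.

Lemma W_elt r p : W r (cg_elt F p) = Wb r p.
Proof. exact: lext_single. Qed.

Lemma Wb0 r g : Wb r (inl (0%N, g)) = W0 r g.
Proof. by rewrite /= big_ord0 muln0 subr0; exact: scale1r. Qed.

Lemma W_xt r b n : W r (xt F b n) = wx r b n.
Proof. by rewrite /xt W_elt Wb0. Qed.

Lemma W_k2 r : W r (k2 F) = (2 : F) *: C2_ F (r, 0).
Proof. by rewrite /k2 W_elt Wb0. Qed.

Lemma W_k1t r s : W r (k1t F s) = (2 : F) *: C1_ F (r + 2, 2 * s).
Proof.
rewrite /k1t; case: insubP => [s' s0 <-|]; first by rewrite W_elt Wb0.
by rewrite negbK => /eqP ->; rewrite W_elt /= mulr0.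
Qed.

Lemma W_dD r (a : Cg) : W r (dD a) = - (r%:~R / 2) *: W (r - 2) a.
Proof.
move: a (Cg_span a); apply: span_eq_lin.
- exact: linear_comp (@dD_linear F) (W_linear r).
- by apply: linear_scale; apply: W_linear.
move=> _ [[[i g]|[]] ->]; last first.
  rewrite dD_inr (lin0 (W_linear _)) W_elt /= subrK.
  (* D k_1 = 0 demands that r C_1(r, 0) be 0, which is the relation between C_1 and C_2 in degree
     (r, 0). *)
  have A (V : lmodType F) (x y : V) : r%:~R *: x + (0 : int)%:~R *: y = 0 ->
      0 = - (r%:~R / 2) *: ((2 : F) *: x).
    rewrite scale0r addr0 => H.
    by rewrite scalerA mulNr divfK ?pnatr_eq0 // scaleNr H oppr0.
  exact: A (C_rel F (r, 0)).
rewrite dD_elt !W_elt /=.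
have -> : r - 2 - (2 * i)%:Z = r - (2 * i.+1)%:Z by lia.
apply: etrans (esym (scalerA _ _ _)); congr (_ *: _).
rewrite big_ord_recl sub0r; congr (_ * _); apply: eq_bigr => k _.
by rewrite half_sub2 lift0 -natr1; ring.
Qed.

Lemma C_rel2 (r n : int) : n != 0 ->
  (- (r%:~R / n%:~R) : F) *: C1_ F (r, 2 * n) = (2 : F) *: C2_ F (r, 2 * n).
Proof.
move=> n0; have n0' : n%:~R != 0 :> F by rewrite intr_eq0.
have A (V : lmodType F) (x y : V) : r%:~R *: x + (2 * n)%:~R *: y = 0 ->
    (- (r%:~R / n%:~R) : F) *: x = (2 : F) *: y.
  move=> H; have -> : - (r%:~R / n%:~R) = (- n%:~R^-1) * r%:~R :> F by field.
  rewrite -scalerA; have /eqP := H; rewrite addr_eq0 => /eqP ->.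
  by rewrite scalerN scaleNr opprK scalerA intrM mulrCA mulVf // mulr1.
exact: A (C_rel F (r, 2 * n)).
Qed.

(** One formula for n = 0 and n <> 0. In the second case the mode of D t_2^n k_1 gives - (r / n)
    C_1(r, 2n), and the relation r C_1 + 2n C_2 = 0 turns this into 2 C_2(r, 2n). *)
Lemma W_kappa r n : W r (kappa F n) = (2 : F) *: C2_ F (r, 2 * n).
Proof.
rewrite /kappa; case: eqP => [->|/eqP n0]; first by rewrite W_k2 mulr0.
rewrite (lin_scale (W_linear _)) W_dD W_k1t subrK -C_rel2 //.
apply: etrans (scalerA _ _ _) _; apply: etrans (scalerA _ _ _) _; congr (_ *: _).
by field; rewrite intr_eq0.
Qed.

Lemma signE (r : int) : (-1) ^ r = (if oddz r then -1 else 1) :> F.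
Proof.
have e0 : (-1 : F) != 0 by rewrite oppr_eq0 oner_eq0.
have e2 (n : int) : (-1) ^ (2 * n) = 1 :> F.
  by rewrite -exprz_exp -[_ ^ 2]/((-1) ^+ 2) sqrrN expr1n exp1rz.
rewrite [in LHS](oddz_half r) expfzDr // e2 mul1r.
by case: (oddz r).
Qed.

(** For odd r the element is 0. This is how psi respects that sigma fixes the central elements. *)
Lemma C1_sign r n : (-1) ^ r *: C1_ F (r, n) = C1_ F (r, n).
Proof.
rewrite signE; case: ifP => pr; last exact: scale1r.
rewrite C1_out; first exact: scaler0.
by rewrite inS0E /= pr.
Qed.

Lemma C2_sign r n : (-1) ^ r *: C2_ F (r, n) = C2_ F (r, n).
Proof.
rewrite signE; case: ifP => pr; last exact: scale1r.
rewrite C2_out; first exact: scaler0.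
by rewrite inS0E /= pr.
Qed.

(** The alpha coordinate must always agree, as alpha lives in every degree. Those of x_+ and x_-
    matter only in S, and those of C_1 and C_2 only in S_0. *)
Lemma tc_eq v p m h c d p' m' h' c' d' :
  (inS v -> p = p' /\ m = m') -> h = h' -> (inS0 v -> c = c' /\ d = d') ->
  tc v p m h c d = tc v p' m' h' c' d'.
Proof.
move=> H1 <- H2.
have A (V : lmodType F) (x y z t u : V) :
    (x = 0 /\ y = 0) \/ (p = p' /\ m = m') -> (t = 0 /\ u = 0) \/ (c = c' /\ d = d') ->
    p *: x + m *: y + h *: z + c *: t + d *: u =
    p' *: x + m' *: y + h *: z + c' *: t + d' *: u.
  by move=> [[-> ->]|[-> ->]] [[-> ->]|[-> ->]]; rewrite ?scaler0.
apply: A.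
  have [S|S] := boolP (inS v); first by right; apply: H1.
  by left; rewrite xp_out // xm_out.
have [S|S] := boolP (inS0 v); first by right; apply: H2.
by left; rewrite C1_out // C2_out.
Qed.

End Psi.

(** * The involution in coordinates, and the descent of psi to the quotient *)

Definition sgm (b : sp4b) : sp4b :=
  match b with
  | XH1 => XH2 | XH2 => XH1 | X12 => X12 | X21 => X21 | X14 => X41 | X41 => X14
  | X13 => X42 | X42 => X13 | X31 => X24 | X24 => X31
  end.
Definition sgm_sign (b : sp4b) : int :=
  match b with XH1 | XH2 | X14 | X41 => -1 | _ => 1 end.
Definition sgm_shift (b : sp4b) : int :=
  match b with X14 | X13 | X24 => 1 | X41 | X42 | X31 => -1 | _ => 0 end.
Definition is_cartan (b : sp4b) : bool := match b with XH1 | XH2 => true | _ => false end.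

(** Sigma preserves the second degree, so applying it stays within the same [tc] degree. *)
Lemma sgm_deg b : sp4deg (sgm b) + 2 * sgm_shift b = sp4deg b.
Proof. by case: b. Qed.

Lemma sum_sp4b (V : zmodType) (f : sp4b -> V) : \sum_b f b =
  f XH1 + f XH2 + f X13 + f X31 + f X24 + f X42 + f X12 + f X21 + f X14 + f X41.
Proof.
have -> : index_enum sp4b = sp4b_seq by rewrite [index_enum _]unlock unlock.
by rewrite /sp4b_seq !big_cons big_nil addr0 !addrA.
Qed.

Section Psi2.
Variable F : numFieldType.
Variable ii : F.
Local Notation Cg := (Cg F).
Local Notation Chat := (Chat F).
Local Notation tkk := (tkk F).
Local Notation tc := (@tc F).
Local Notation W := (W ii).
Local Notation wp := (wp ii).
Local Notation wm := (wm ii).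
Local Notation wh := (wh ii).
Local Notation wd := (wd F).

Lemma sigma_xE b n : sigma_x F b n =
  (sgm_sign b)%:~R *: xt F (sgm b) (n + sgm_shift b) + (is_cartan b)%:R *: kappa F n.
Proof.
by case: b => /=; rewrite ?addr0 ?scale0r ?scale1r ?addr0 ?mulrN1z ?scaleN1r.
Qed.

Lemma wx_sgm r b n : wx ii r (sgm b) (n + sgm_shift b) =
  let e := (-1) ^ r in
  tc (r, 2 * n + sp4deg b) (wp e (sgm b)) (wm e (sgm b)) (wh e (sgm b)) 0 (wd (sgm b)).
Proof.
have E : 2 * (n + sgm_shift b) + sp4deg (sgm b) = 2 * n + sp4deg b.
  by rewrite -(sgm_deg b); ring.
by rewrite /wx E.
Qed.

Lemma W_sigma_x r b n : W r (sigma_x F b n) = (-1) ^ r *: wx ii r b n.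
Proof.
have Wc a x c y : W r (a *: x + c *: y) = a *: W r x + c *: W r y.
  by rewrite (lin_add (W_linear _ _)) 2!(lin_scale (W_linear _ _)).
rewrite sigma_xE Wc W_xt W_kappa.
have -> : (is_cartan b)%:R *: ((2 : F) *: C2_ F (r, 2 * n)) =
    tc (r, 2 * n + sp4deg b) 0 0 0 0 ((is_cartan b)%:R * 2).
  have [->|[-> ->]] : is_cartan b = false \/ is_cartan b = true /\ sp4deg b = 0.
  - by case: (b); [right | right | left | left | left | left | left | left | left | left].
  - by rewrite mul0r tc0; apply: scale0r.
  - by rewrite -tc_C2 addr0; apply: scalerA.
rewrite wx_sgm /wx !tc_scale tc_add signE; apply: tc_eq => /=.
(* Sigma fixes [X12] and [X21], so for odd r their coordinates would have to equal their negatives.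
   Their degree then has both entries odd, which the hypothesis excludes. *)
- rewrite inSE /= !oddzE; case: (oddz r) => /=; case: b => /=; rewrite /oddz;
    split; try ring; lia.
- by case: (oddz r); case: b => /=; field.
- rewrite inS0E /=; case: (oddz r) => //= _.
  by case: b => /=; split; ring.
Qed.

Lemma W_sigma r (a : Cg) : W r (sigma a) = (-1) ^ r *: W r a.
Proof.
move: a (Cg_span a); apply: span_eq_lin.
- exact: linear_comp (@sigma_linear F) (W_linear _ r).
- by apply: linear_scale; apply: W_linear.
move=> _ [[[i g]|[]] ->]; last first.
  rewrite sigma_elt /= W_elt /=.
  have := C1_sign F (r + 2) 0; rewrite -[in X in X -> _](sign_sub2 F) addrK => {1}<-.
  apply: etrans (scalerA _ _ _) _; apply: esym; apply: etrans (scalerA _ _ _) _.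
  by rewrite mulrC.
elim: i r => [|i IH] r.
  case: g => [[b n]|[[]|s]].
  - by rewrite sigma_elt /= -/(xt F b n) W_sigma_x W_xt.
  - rewrite sigma_elt /= -/(k2 F) W_k2 -{1}(C2_sign F r 0).
    apply: etrans (scalerA _ _ _) _; apply: esym; apply: etrans (scalerA _ _ _) _.
    by rewrite mulrC.
  - rewrite sigma_elt W_elt Wb0 /=.
    have := C1_sign F (r + 2) (2 * val s); rewrite -[in X in X -> _](sign_sub2 F) addrK => {1}<-.
    apply: etrans (scalerA _ _ _) _; apply: esym; apply: etrans (scalerA _ _ _) _.
    by rewrite mulrC.
rewrite -dD_elt sigma_dD 2!W_dD IH sign_sub2.
apply: etrans (scalerA _ _ _) _; apply: esym; apply: etrans (scalerA _ _ _) _.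
by rewrite mulrC.
Qed.

(** Therefore psi of a mode can be computed without projecting to an eigenspace first. *)
Lemma W_tpart r (a : Cg) : W r (tpart r a) = W r a.
Proof.
rewrite /tpart (lin_scale (W_linear _ _)) (lin_add (W_linear _ _)) (lin_scale (W_linear _ _)).
rewrite W_sigma.
have A (V : lmodType F) (x : V) : 2^-1 *: (x + (-1) ^ r *: ((-1) ^ r *: x)) = x.
  rewrite scalerA sign_sq scale1r -mulr2n -scaler_nat scalerA mulVf ?scale1r //.
  by rewrite pnatr_eq0.
exact: A.
Qed.

Definition psi : Chat -> tkk := qlift (fun w : twisted F => lsum W (twval w)).

Lemma psi_pre_linear : linear (fun w : twisted F => lsum W (twval w)).
Proof. exact: linear_comp (@twval_linear F) (lsum_linear (W_linear ii)). Qed.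

Lemma psi_pre_kill w : imtotD w -> lsum W (twval w) = 0.
Proof.
move=> [u ->]; move: (twval u) => {w}v.
have l : linear (fun v => lsum W (totD v)).
  exact: linear_comp (@totD_linear F) (lsum_linear (W_linear ii)).
apply: (span_lin0 l) (fs_span v) => _ [r [a ->]].
rewrite totDE (lsum_single _ _ (@totDs_linear F)) /totDs.
rewrite (lin_add (lsum_linear (W_linear ii))) !(lsum_single _ _ (W_linear ii)).
rewrite W_dD (lin_scale (W_linear _ _)).
have A (V : lmodType F) (x : V) (c : F) : - c *: x + c *: x = 0.
  by rewrite -scalerDl addNr scale0r.
exact: A.
Qed.

Lemma psi_linear : linear psi.
Proof. exact: qlift_linear psi_pre_linear psi_pre_kill. Qed.

Lemma psi_mode r (a : Cg) : psi (mode r a) = W r a.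
Proof.
apply: etrans (qliftE psi_pre_linear psi_pre_kill _) _.
by rewrite /= (lsum_single _ _ (W_linear ii)) W_tpart.
Qed.

End Psi2.

(** * The image under psi of a bracket of modes *)

Section PsiBracket.
Variable F : numFieldType.
Variable ii : F.
Local Notation Cg := (Cg F).
Local Notation tkk := (tkk F).

Lemma nprod_l_centl i j n g h : nprod_l F i j n (inr g) h = 0.
Proof.
elim: i n => [|i IH] n /=; last by rewrite IH scaler0 oppr0.
by elim: j n => [//|j IH] n /=; rewrite !IH (lin0 (@dD_linear F)) scaler0 addr0.
Qed.

Lemma nprod_l_centr i j n g h : nprod_l F i j n g (inr h) = 0.
Proof.
elim: i n => [|i IH] n /=; last by rewrite IH scaler0 oppr0.
elim: j n => [|j IH] n /=; first by case: g => [[]|].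
by rewrite !IH (lin0 (@dD_linear F)) scaler0 addr0.
Qed.

Lemma nprod_centl n p (b : Cg) : (if p is inl (_, inl _) then False else True) ->
  nprod n (cg_elt F p) b = 0.
Proof.
move=> cp; apply: (span_lin0 (nprod_linr n _)) (Cg_span b) => _ [q ->].
rewrite nprod_elt; case: p cp => [[i [//|g]]|//] _ /=.
by case: q => [[j h]|//]; apply: nprod_l_centl.
Qed.

Lemma nprod_centr n p (a : Cg) : (if p is inl (_, inl _) then False else True) ->
  nprod n a (cg_elt F p) = 0.
Proof.
move=> cp; apply: (span_lin0 (nprod_linl n _)) (Cg_span a) => _ [q ->].
rewrite nprod_elt; case: p cp => [[i [//|g]]|u] _ /=; last by case: q => [[]|].
by case: q => [[j h]|//]; apply: nprod_l_centr.
Qed.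

Lemma cent_span (P : Cg -> Prop) n :
  (forall p, (if p is inl (_, inl _) then False else True) -> P (cg_elt F p)) ->
  P 0 -> (forall c x, P x -> P (c *: x)) -> P (k1t F n) /\ P (kappa F n).
Proof.
move=> Pp P0 Pc; split.
  by rewrite /k1t; case: insubP => [s' _ _|_]; apply: Pp.
rewrite /kappa; case: eqP => _; first exact: Pp.
apply: Pc; rewrite /k1t; case: insubP => [s' _ _|_]; first by rewrite dD_elt; apply: Pp.
by rewrite dD_inr.
Qed.

Lemma nvan_centl n (b : Cg) : nvan (k1t F n) b 0 /\ nvan (kappa F n) b 0.
Proof.
apply: (@cent_span (fun x => nvan x b 0)) => [p cp k _|k _|c x vx k k0].
- by rewrite nprod_centl.
- exact: lin0 (nprod_linl _ _).
- by rewrite (lin_scale (nprod_linl _ _)) vx // scaler0.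
Qed.

Lemma nvan_centr n (a : Cg) : nvan a (k1t F n) 0 /\ nvan a (kappa F n) 0.
Proof.
apply: (@cent_span (fun x => nvan a x 0)) => [p cp k _|k _|c x vx k k0].
- by rewrite nprod_centr.
- exact: lin0 (nprod_linr _ _).
- by rewrite (lin_scale (nprod_linr _ _)) vx // scaler0.
Qed.

Lemma mbr_van r s (a b : Cg) : nvan a b 0 -> mbr r s a b = 0.
Proof. by move=> v; rewrite (mbrE _ _ v) big_ord0. Qed.

Lemma nprod0_xt b m c m' : nprod 0 (xt F b m) (xt F c m') =
  Xt (mxlie (sp4mx F b) (sp4mx F c)) (m + m')
  + (m%:~R * (sp4tr b c)%:~R) *: kappa F (m + m').
Proof.
rewrite nprod_elt /= sp4trE; congr (_ + _); rewrite /kappa; case: eqP => // _.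
by rewrite scalerA mulrAC.
Qed.

Lemma nprod1_xt b m c m' : nprod 1 (xt F b m) (xt F c m') =
  (sp4tr b c)%:~R *: k1t F (m + m').
Proof. by rewrite nprod_elt /= sp4trE. Qed.

(** Only the products of index 0 and 1 survive on sp_4 tensor Laurent polynomials, with binomials 1
    and r / 2. *)
Lemma psi_mbr_xt r s b m c m' : psi ii (mbr r s (xt F b m) (xt F c m')) =
  W ii (r + s) (nprod 0 (xt F b m) (xt F c m')) +
  (r%:~R / 2) *: W ii (r + s - 2) (nprod 1 (xt F b m) (xt F c m')).
Proof.
have v : nvan (xt F b m) (xt F c m') 2.
  by move=> n n2; rewrite nprod_elt; apply: nprod_g_van.
move: (xt F b m) (xt F c m') v => x y v.
have S2 (V : zmodType) (f : nat -> V) : \sum_(i < 2) f i = f 0%N + f 1%N.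
  by rewrite !big_ord_recl big_ord0 addr0.
have -> : mbr r s x y = mode (r + s) (nprod 0 x y)
    + (r%:~R / 2) *: mode (r + s - 2) (nprod 1 x y).
  apply: etrans (mbrE _ _ v) _; apply: etrans (S2 _ _) _; congr (_ + _).
    rewrite /mbr_term muln0 subr0.
    have -> : gbinom (r%:~R / 2 : F) 0 = 1 by rewrite /gbinom big_ord0 divr1.
    exact: scale1r.
  rewrite /mbr_term muln1.
  have -> // : gbinom (r%:~R / 2 : F) 1 = r%:~R / 2.
  by rewrite /gbinom big_ord_recl big_ord0 subr0 mulr1 divr1.
apply: etrans (lin_add (psi_linear ii) _ _) _; rewrite psi_mode //; congr (_ + _).
by apply: etrans (lin_scale (psi_linear ii) _ _) _; rewrite psi_mode.
Qed.

Definition lz (b c d : sp4b) : F := (sp4lie b c d)%:~R.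
(** The functions from here to [cd2] are the coordinates of psi of the bracket before projection to
    eigenspaces: structure constants weighted by the coefficients of [wp], [wm], [wh] and [wd]. *)
Definition cp (e : F) (b c : sp4b) : F :=
  lz b c X13 / 2 - ii * lz b c X12 + e / 2 * lz b c X42.
Definition cm (e : F) (b c : sp4b) : F :=
  lz b c X31 / 2 + ii * lz b c X21 + e / 2 * lz b c X24.
Definition ch (e : F) (b c : sp4b) : F :=
  lz b c XH1 / 2 - e / 2 * lz b c XH2 - ii / 2 * lz b c X14 + ii * e / 2 * lz b c X41.
Definition cd1 (x : F) (b c : sp4b) : F := x * (sp4tr b c)%:~R.
(** The argument x is the second degree M = 2m + sp4deg b of the left factor, so x - sp4deg b is 2m.
    The last term is the C_2 coordinate of [XH2]. *)
Definition cd2 (x : F) (b c : sp4b) : F :=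
  (x - (sp4deg b)%:~R) * (sp4tr b c)%:~R + 2 * lz b c XH2.

Lemma sp4lie_deg b c d : sp4lie b c d = 0 \/ sp4deg d = sp4deg b + sp4deg c.
Proof. by case: b; case: c; case: d => /=; by [left | right]. Qed.

Lemma sp4tr_deg b c : sp4tr b c = 0 \/ sp4deg b + sp4deg c = 0.
Proof. by case: b; case: c => /=; by [left | right]. Qed.

Lemma W_Xt r b c n : W ii r (Xt (mxlie (sp4mx F b) (sp4mx F c)) n) =
  let e := (-1) ^ r in
  tc (r, 2 * n + (sp4deg b + sp4deg c)) (cp e b c) (cm e b c) (ch e b c) 0 (2 * lz b c XH2).
Proof.
rewrite /Xt (lin_sum (W_linear _ _)).
have E d : W ii r (sp4coord (mxlie (sp4mx F b) (sp4mx F c)) d *: xt F d n) =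
    let e := (-1) ^ r in
    tc (r, 2 * n + (sp4deg b + sp4deg c)) (lz b c d * wp ii e d) (lz b c d * wm ii e d)
      (lz b c d * wh ii e d) 0 (lz b c d * wd F d).
  rewrite (lin_scale (W_linear _ _)) W_xt sp4lieE -/(lz b c d) /wx /=.
  have [L0|<-] := sp4lie_deg b c d; last by rewrite tc_scale mulr0.
  by rewrite /lz L0 !mul0r tc0; apply: scale0r.
under eq_bigr do rewrite E.
rewrite /= tc_sum; apply: tc_eq => [_||_]; rewrite !sum_sp4b /=;
  [split | | split]; rewrite /cp /cm /ch; ring.
Qed.

Lemma tc_addC v p m h c d k k' :
  tc v p m h c d + k *: C2_ F v + k' *: C1_ F v = tc v p m h (c + k') (d + k).
Proof.
have A (V : lmodType F) (x c1 c2 : V) :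
    x + c *: c1 + d *: c2 + k *: c2 + k' *: c1 = x + (c + k') *: c1 + (d + k) *: c2.
  by rewrite !scalerDl [LHS](AC (5) ((1*(2*5)*(3*4)))).
exact: A.
Qed.

Lemma psi_mbr r s b m c m' M M' : 2 * m + sp4deg b = M -> 2 * m' + sp4deg c = M' ->
  psi ii (mbr r s (xt F b m) (xt F c m')) =
  let e := (-1) ^ (r + s) in
  tc (r + s, M + M') (cp e b c) (cm e b c) (ch e b c) (cd1 r%:~R b c) (cd2 M%:~R b c).
Proof.
move=> <- <-; rewrite psi_mbr_xt nprod0_xt nprod1_xt (lin_add (W_linear _ _)) W_Xt.
rewrite 2!(lin_scale (W_linear _ _)) W_kappa W_k1t subrK.
have -> : 2 * m + sp4deg b + (2 * m' + sp4deg c) = 2 * (m + m') + (sp4deg b + sp4deg c) by ring.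
(* If the trace is nonzero, the degrees of b and c add up to 0, so the central terms sit in the
   degree of the whole bracket. Otherwise they are absent. *)
have [t0|->] := sp4tr_deg b c.
  have A (V : lmodType F) (x y z : V) (k : F) : x + (k * 0) *: y + (r%:~R / 2) *: (0 *: z) = x.
    by rewrite mulr0 !scale0r scaler0 !addr0.
  rewrite t0; apply: etrans (A _ _ _ _ _) _; rewrite /=.
  by rewrite /cd1 /cd2 t0 !mulr0 add0r.
rewrite addr0.
have A (V : lmodType F) (x y z : V) (k k' t : F) :
    x + k *: (2 *: y) + k' *: (t *: (2 *: z)) = x + (k * 2) *: y + (k' * t * 2) *: z.
  by rewrite !scalerA.
apply: etrans (A _ _ _ _ _ _ _) _.
apply: etrans (tc_addC _ _ _ _ _ _ _ _) _; apply: tc_eq => [_||_];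
  [split | | split]; rewrite /cd1 /cd2; by field.
Qed.

(** The effect of projecting both arguments to eigenspaces: the average over b, sigma b and c, sigma
    c, with x = (-1)^r and y = (-1)^s. The corrections kappa do not contribute because their
    products vanish. *)
Definition avg (x y : F) (f : sp4b -> sp4b -> F) (b c : sp4b) : F :=
  2^-1 * (2^-1 * (f b c + y * (sgm_sign c)%:~R * f b (sgm c)) +
    x * (sgm_sign b)%:~R *
      (2^-1 * (f (sgm b) c + y * (sgm_sign c)%:~R * f (sgm b) (sgm c)))).

Lemma mbr_tpartl r s b m (y : Cg) : mbr r s (tpart r (xt F b m)) y =
  2^-1 *: (mbr r s (xt F b m) y
           + ((-1) ^ r * (sgm_sign b)%:~R) *: mbr r s (xt F (sgm b) (m + sgm_shift b)) y).
Proof.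
have l := mbr_linl r s y; rewrite /tpart sigma_xt sigma_xE.
apply: etrans (lin_scale l _ _) _; congr (_ *: _).
apply: etrans (lin_add l _ _) _; congr (_ + _).
apply: etrans (lin_scale l _ _) _; apply: etrans _ (scalerA _ _ _); congr (_ *: _).
apply: etrans (lin_add l _ _) _.
have -> : mbr r s ((is_cartan b)%:R *: kappa F m) y = 0.
  apply: etrans (lin_scale l _ _) _.
  by rewrite mbr_van; [exact: scaler0 | have [] := nvan_centl m y].
by apply: etrans (addr0 _) _; apply: lin_scale l _ _.
Qed.

Lemma mbr_tpartr r s b m (y : Cg) : mbr r s y (tpart s (xt F b m)) =
  2^-1 *: (mbr r s y (xt F b m)
           + ((-1) ^ s * (sgm_sign b)%:~R) *: mbr r s y (xt F (sgm b) (m + sgm_shift b))).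
Proof.
have l := mbr_linr r s y; rewrite /tpart sigma_xt sigma_xE.
apply: etrans (lin_scale l _ _) _; congr (_ *: _).
apply: etrans (lin_add l _ _) _; congr (_ + _).
apply: etrans (lin_scale l _ _) _; apply: etrans _ (scalerA _ _ _); congr (_ *: _).
apply: etrans (lin_add l _ _) _.
have -> : mbr r s y ((is_cartan b)%:R *: kappa F m) = 0.
  apply: etrans (lin_scale l _ _) _.
  by rewrite mbr_van; [exact: scaler0 | have [] := nvan_centr m y].
by apply: etrans (addr0 _) _; apply: lin_scale l _ _.
Qed.

Lemma psi_br r s b m c m' M M' : 2 * m + sp4deg b = M -> 2 * m' + sp4deg c = M' ->
  psi ii (Chat_br (mode r (xt F b m)) (mode s (xt F c m'))) =
  let e := (-1) ^ (r + s) in let a f := avg ((-1) ^ r) ((-1) ^ s) f b c in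
  tc (r + s, M + M') (a (cp e)) (a (cm e)) (a (ch e)) (a (cd1 r%:~R)) (a (cd2 M%:~R)).
Proof.
move=> HM HM'.
have HMs : 2 * (m + sgm_shift b) + sp4deg (sgm b) = M by rewrite -HM -(sgm_deg b); ring.
have HMs' : 2 * (m' + sgm_shift c) + sp4deg (sgm c) = M' by rewrite -HM' -(sgm_deg c); ring.
have P a x k y : psi ii (a *: (x + k *: y)) = a *: (psi ii x + k *: psi ii y).
  apply: etrans (lin_scale (psi_linear ii) _ _) _; congr (_ *: _).
  apply: etrans (lin_add (psi_linear ii) _ _) _; congr (_ + _).
  exact: lin_scale (psi_linear ii) _ _.
have Q (a k : F) (x x' y y' : tkk) : x = x' -> y = y' ->
    a *: (x + k *: y) = a *: (x' + k *: y') by move=> -> ->.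
have T v (a k p q h d d' p' q' h' f f' : F) :
    a *: (tc v p q h d d' + k *: tc v p' q' h' f f') =
    tc v (a * (p + k * p')) (a * (q + k * q')) (a * (h + k * h'))
       (a * (d + k * f)) (a * (d' + k * f')).
  by rewrite (tc_scale _ k) tc_add tc_scale.
have R b' n : 2 * n + sp4deg b' = M ->
    psi ii (mbr r s (xt F b' n) (tpart s (xt F c m'))) =
    let e := (-1) ^ (r + s) in
    let a f := 2^-1 * (f b' c + (-1) ^ s * (sgm_sign c)%:~R * f b' (sgm c)) in
    tc (r + s, M + M') (a (cp e)) (a (cm e)) (a (ch e)) (a (cd1 r%:~R)) (a (cd2 M%:~R)).
  move=> Hn; rewrite mbr_tpartr; apply: etrans (P _ _ _ _) _.
  apply: etrans (Q _ _ _ _ _ _ (psi_mbr _ _ Hn HM') (psi_mbr _ _ Hn HMs')) _.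
  exact: T.
rewrite Chat_br_mode mbr_tpartl; apply: etrans (P _ _ _ _) _.
apply: etrans (Q _ _ _ _ _ _ (R _ _ HM) (R _ _ HMs)) _.
exact: T.
Qed.

End PsiBracket.

(** * Linear maps out of the TKK algebra given on generators *)

Section UniversalProperty.
Variables (F : numFieldType) (V : lmodType F).
Variables (a : sl2b -> int * int -> V) (c1 c2 : int * int -> V).
Hypothesis c_rel : forall u, inS0 u -> u.1%:~R *: c1 u + u.2%:~R *: c2 u = 0.
Local Notation J := (J F).
Local Notation JtJ := (JtJ F).
Local Notation JJ := (JJ F).
Local Notation xJ := (xJ F).
Local Notation tkk := (tkk F).

Definition liftC (r u : int * int) : V :=
  if inS0 u then r.1%:~R *: c1 u + r.2%:~R *: c2 u else 0.

(** Forced by the normal form [tkkr_gJ]. *)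
Definition liftB (r t : int * int) : V := liftC r (r + t) + (sg F r t / 2) *: a Av (r + t).

Definition liftJJ (w : JtJ) : V := lext (fun p => liftB (val p.1) (val p.2)) w.

Lemma liftJJ_linear : linear liftJJ. Proof. exact: lext_linear. Qed.

Lemma liftJJ_x r t : inS r -> inS t -> liftJJ (tensJ (xJ r) (xJ t)) = liftB r t.
Proof.
move=> Sr St; rewrite -[r]/(val (Sub r Sr : idxS)) -[t]/(val (Sub t St : idxS)).
by rewrite (tensJ_x F (Sub r Sr : idxS, Sub t St : idxS)) /liftJJ lext_single.
Qed.

Lemma liftJJ_x_out r t : inS t ->
  liftJJ (tensJ (xJ r) (xJ t)) = if inS r then liftB r t else 0.
Proof.
move=> St; case: ifP => Sr; first exact: liftJJ_x.
by rewrite (xJ_out F (negbT Sr)) tensJ0l (lin0 liftJJ_linear).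
Qed.

Lemma liftCD r s u : liftC (r + s) u = liftC r u + liftC s u.
Proof.
rewrite /liftC; case: ifP => _; last by rewrite addr0.
by rewrite !intrD !scalerDl addrACA.
Qed.

Lemma liftC_rel u : liftC u u = 0.
Proof. by rewrite /liftC; case: ifP => // S0; apply: c_rel. Qed.

(** The alpha part vanishes by the antisymmetry and cyclicity of [sg]. The central part is additive
    in its first degree, and the first degrees sum to u for the antisymmetry relation and to 2u for
    the cyclic one. It is 0 there by the assumed relation between [c1] and [c2]. *)
Lemma liftJJ_rel w : relJ w -> liftJJ w = 0.
Proof.
apply: kill_rel liftJJ_linear _ _ w => [r t Sr St|r s t Sr Ss St].
  rewrite !liftJJ_x // /liftB (sg_anti F r t) mulNr scaleNr (addrC t r) opprD; congr (_ - _).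
  by apply/eqP; rewrite -addr_eq0 -liftCD liftC_rel.
rewrite !liftJJ_x_out //.
have Ev x y z : inS z -> (if inS (x + y) then liftB (x + y) z else 0) =
    (if inS (x + y) then liftC (x + y) (x + y + z) else 0)
    + (sg F (x + y) z / 2) *: a Av (x + y + z).
  by move=> Sz; case: ifP => // S; rewrite /sg S /= mul0r scale0r addr0.
rewrite !Ev //.
have -> : s + t + r = r + s + t by rewrite addrC addrA.
have -> : t + r + s = r + s + t by rewrite -addrA addrC.
set u := r + s + t.
have A (x y z p : V) (k l m : F) : x + y + z = 0 -> k + l + m = 0 ->
    x + (k / 2) *: p + (y + (l / 2) *: p) + (z + (m / 2) *: p) = 0.
  move=> E E'; rewrite [LHS](AC ((2*2)*2) ((1*3*5)*(2*4*6))) /= E add0r -!scalerDl -!mulrDl E'.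
  by rewrite mul0r scale0r.
apply: A => //; last exact: sg_cyc.
have [S0|S0] := boolP (inS0 u); last first.
  by rewrite /liftC (negbTE S0) !if_same !addr0.
have [S1 S2 S3] : [/\ inS (r + s), inS (s + t) & inS (t + r)].
  move: Sr Ss St S0; rewrite !inSE !inS0E /= !oddzE.
  by case: (oddz r.1); case: (oddz r.2); case: (oddz t.1); case: (oddz t.2);
    case: (oddz s.1); case: (oddz s.2).
rewrite S1 S2 S3 -!liftCD.
have -> : r + s + (s + t) + (t + r) = u + u.
  by rewrite /u [LHS](AC (2*2*2) ((1*2*4)*(6*3*5))).
by rewrite liftCD liftC_rel addr0.
Qed.

Definition tlift (p : tkk) : V :=
  \sum_b lext (fun s : idxS => a b (val s)) (p.1 b) + qlift liftJJ p.2.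

Lemma tlift_linear : linear tlift.
Proof.
apply: linear_add.
  apply: linear_bigsum => b.
  exact: linear_comp (@proj_linear F b) (lext_linear _).
apply: linear_comp (@snd_linear F) _; apply: qlift_linear;
  [exact: liftJJ_linear | exact: liftJJ_rel].
Qed.

Lemma tlift_tkkl b (x : J) : tlift (tkkl (inj2 b x)) = lext (fun s : idxS => a b (val s)) x.
Proof.
have q0 : qlift liftJJ (0 : JJ) = 0.
  by apply: (lin0 (f := qlift liftJJ)); apply: qlift_linear;
  [exact: liftJJ_linear | exact: liftJJ_rel].
rewrite /tlift /= q0 addr0 sum_sl2b !inj2E.
by case: b => /=; rewrite ?(lin0 (lext_linear _)) ?addr0 ?add0r.
Qed.

Lemma tlift_tkkr (w : JtJ) : tlift (tkkr (qcls (@relJ F) w)) = liftJJ w.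
Proof.
rewrite /tlift /= big1 ?add0r => [|b _]; last by rewrite ffunE (lin0 (lext_linear _)).
by apply: qliftE; [exact: liftJJ_linear | exact: liftJJ_rel].
Qed.

Lemma tlift_tgen b r : (b != Av -> inS r) -> tlift (tgen F b r) = a b r.
Proof.
move=> H; have [Sr|Sr] := boolP (inS r).
  by rewrite tgen_in // tlift_tkkl (xJ_in F Sr) lext_single.
have -> : b = Av by apply/eqP; apply: contraT => /H; rewrite (negbTE Sr).
rewrite /= av_out // (lin_scale (@tkkr_linear F)) (lin_scale tlift_linear) tlift_tkkr.
have E : e1 + (r - e1) = r by rewrite addrC subrK.
rewrite liftJJ_x ?inS_e1 // /liftB sg_e1 // E /liftC.
have /negbTE -> : ~~ inS0 r by move: Sr; rewrite inSE inS0E negbK => /andP[->].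
by rewrite add0r scalerA mulrCA mulfV ?mulr1 ?scale1r ?pnatr_eq0.
Qed.

Lemma tlift_C1 u : inS0 u -> tlift (C1_ F u) = c1 u.
Proof.
move=> S0; have Su : inS (u - e1) by move: S0; rewrite inSE inS0E /= !oddzE; do 2!case: (oddz _).
have S : inS u by move: S0; rewrite inS0E inSE => /andP[/negbTE->].
have E : e1 + (u - e1) = u by rewrite addrC subrK.
rewrite C1_in // tlift_tkkr liftJJ_x // /liftB sg_perp E //.
by rewrite mul0r scale0r addr0 /liftC S0 scale1r scale0r addr0.
Qed.

Lemma tlift_C2 u : inS0 u -> tlift (C2_ F u) = c2 u.
Proof.
move=> S0; have Su : inS (u - e2) by move: S0; rewrite inSE inS0E /= !oddzE; do 2!case: (oddz _).
have S : inS u by move: S0; rewrite inS0E inSE => /andP[/negbTE->].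
have E : e2 + (u - e2) = u by rewrite addrC subrK.
rewrite C2_in // tlift_tkkr liftJJ_x // /liftB sg_perp E //.
by rewrite mul0r scale0r addr0 /liftC S0 scale1r scale0r add0r.
Qed.

End UniversalProperty.

(** * The map phi, and psi as its two-sided inverse *)

Section Phi.
Variable F : numFieldType.
Variable ii : F.
Hypothesis ii2 : ii * ii = -1.
Local Notation Cg := (Cg F).
Local Notation Chat := (Chat F).
Local Notation tkk := (tkk F).

Definition phi_b (g : sl2b) (o : bool) : sp4b :=
  match g, o with
  | Xp, false => X13 | Xp, true => X12
  | Xm, false => X31 | Xm, true => X21
  | Av, false => XH1 | Av, true => X14
  end.
Definition phi_k (g : sl2b) (o : bool) : F :=
  match g, o with
  | Xp, true => ii | Xm, true => - ii | Av, true => 2 * ii | _, false => 2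
  end.
(* The exponent n of t_2 for which (phi_b g _) tensor t_2^n has degree k. *)
Definition phi_n (g : sl2b) (k : int) : int :=
  (k %/ 2)%Z + ((g == Xp) && oddz k)%:Z.

Lemma phi_n_deg g k : 2 * phi_n g k + sp4deg (phi_b g (oddz k)) = k.
Proof.
rewrite [in RHS](oddz_half k) /phi_n; case: (oddz k); case: g => /=; lia.
Qed.

Definition phi_gen (g : sl2b) (r : int * int) : Chat :=
  phi_k g (oddz r.2) *: mode r.1 (xt F (phi_b g (oddz r.2)) (phi_n g r.2)).
Definition phi_c1 (u : int * int) : Chat := 2^-1 *: mode (u.1 - 2) (k1t F (u.2 %/ 2)%Z).
(** Through kappa, the two cases C_2(2m, 0) and C_2(2m, 2s) of the definition become one. *)
Definition phi_c2 (u : int * int) : Chat := 2^-1 *: mode u.1 (kappa F (u.2 %/ 2)%Z).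

Lemma mode_kappa r n : n%:~R *: mode r (kappa F n) = - (r%:~R / 2) *: mode (r - 2) (k1t F n).
Proof.
rewrite -mode_dD /kappa; case: eqP => [->|/eqP n0].
  apply: etrans (scale0r _) _; rewrite /k1t insubN // dD_inr.
  by rewrite (lin0 (mode_linear _)).
rewrite -(lin_scale (mode_linear _)) scalerA mulfV ?intr_eq0 //.
by rewrite scale1r.
Qed.

Lemma phi_c_rel u : inS0 u -> u.1%:~R *: phi_c1 u + u.2%:~R *: phi_c2 u = 0.
Proof.
rewrite inS0E => /andP[_ /negbTE u2].
have E : u.2%:~R = 2 * (u.2 %/ 2)%Z%:~R :> F.
  by rewrite {1}(oddz_half u.2) u2 addr0 intrM.
have A (V : lmodType F) (x y : V) :
    (u.2 %/ 2)%Z%:~R *: y = - (u.1%:~R / 2) *: x ->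
    u.1%:~R *: (2^-1 *: x) + u.2%:~R *: (2^-1 *: y) = 0.
  move=> H; rewrite E !scalerA mulrAC mulfV ?pnatr_eq0 // mul1r H -scalerDl.
  by rewrite subrr scale0r.
exact: A (mode_kappa _ _).
Qed.

Definition phi : tkk -> Chat := tlift phi_gen phi_c1 phi_c2.

Lemma phi_linear : linear phi.
Proof. exact: tlift_linear phi_c_rel. Qed.

Lemma phi_tgen b r : (b != Av -> inS r) -> phi (tgen F b r) = phi_gen b r.
Proof. exact: tlift_tgen phi_c_rel _ _. Qed.

Lemma phi_C1 u : inS0 u -> phi (C1_ F u) = phi_c1 u.
Proof. exact: tlift_C1 phi_c_rel _. Qed.

Lemma phi_C2 u : inS0 u -> phi (C2_ F u) = phi_c2 u.
Proof. exact: tlift_C2 phi_c_rel _. Qed.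

Lemma psi_phi_gen g r : psi ii (phi_gen g r) = tgen F g r.
Proof.
rewrite /phi_gen (lin_scale (psi_linear ii)) psi_mode // W_xt /wx /= phi_n_deg -surjective_pairing.
apply: etrans (_ : 1 *: tgen F g r = _); last exact: scale1r.
rewrite tc_gen tc_scale; apply: tc_eq => [_||_]; [split | | split];
  case: (oddz r.2); case: g => /=; rewrite ?mulr0 //; try by field.
(* In the odd rows the coefficients of phi and psi multiply to - ii^2, which is 1. *)
all: by transitivity (- (ii * ii)); [field | rewrite ii2 opprK].
Qed.

Lemma half2 (k : int) : oddz k = false -> 2 * (k %/ 2)%Z = k.
Proof. by move=> p; rewrite {2}(oddz_half k) p addr0. Qed.

Lemma half_scale (V : lmodType F) (x : V) : 2^-1 *: ((2 : F) *: x) = x.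
Proof. by rewrite scalerA mulVf ?scale1r ?pnatr_eq0. Qed.

Lemma psi_phi_c1 u : inS0 u -> psi ii (phi_c1 u) = C1_ F u.
Proof.
rewrite inS0E => /andP[_ /negbTE u2].
rewrite /phi_c1 (lin_scale (psi_linear ii)) psi_mode // W_k1t subrK half2 // -surjective_pairing.
exact: half_scale.
Qed.

Lemma psi_phi_c2 u : inS0 u -> psi ii (phi_c2 u) = C2_ F u.
Proof.
rewrite inS0E => /andP[_ /negbTE u2].
rewrite /phi_c2 (lin_scale (psi_linear ii)) psi_mode // W_kappa half2 // -surjective_pairing.
exact: half_scale.
Qed.

Lemma phiK x : psi ii (phi x) = x.
Proof.
have l := linear_comp phi_linear (psi_linear ii).
move: x (tkk_span x); apply: (span_eq_lin l (@linear_id _ _)).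
move=> _ [[b [r [H ->]]]|[r ->]|[r ->]].
- by rewrite phi_tgen // psi_phi_gen.
- have [S|S] := boolP (inS0 r); first by rewrite phi_C1 // psi_phi_c1.
  by rewrite C1_out // (lin0 phi_linear) (lin0 (psi_linear ii)).
- have [S|S] := boolP (inS0 r); first by rewrite phi_C2 // psi_phi_c2.
  by rewrite C2_out // (lin0 phi_linear) (lin0 (psi_linear ii)).
Qed.

Lemma mode_odd r (a : Cg) : oddz r -> sigma a = a -> mode r a = 0.
Proof.
move=> pr sa; have := mode_sigma r a; rewrite sa signE pr.
have A (V : lmodType F) (x : V) : x = -1 *: x -> x = 0.
  by rewrite scaleN1r => /eqP; rewrite -addr_eq0 -mulr2n -scaler_nat scaler_eq0 pnatr_eq0 => /eqP.
exact: A.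
Qed.

(** Quantified over r because a derivative passes from r to r - 2. *)
Definition goodW (a : Cg) := forall r, phi (W ii r a) = mode r a.

Lemma goodW_lin k a b : goodW a -> goodW b -> goodW (k *: a + b).
Proof.
move=> ga gb r; apply: etrans (congr1 phi (W_linear ii r k a b)) _.
apply: etrans (phi_linear _ _ _) _.
have Q (x x' y y' : Chat) : x = x' -> y = y' -> k *: x + y = k *: x' + y' by move=> -> ->.
have ga' : phi (W ii r a) = mode r a := ga r.
have gb' : phi (W ii r b) = mode r b := gb r.
apply: etrans (Q _ _ _ _ ga' gb') _.
by rewrite mode_linear.
Qed.

Lemma goodW0 : goodW 0.
Proof. by move=> r; rewrite (lin0 (W_linear ii r)) (lin0 phi_linear) (lin0 (mode_linear _)). Qed.

(** Both sides pick up the same invertible sign (-1)^r under sigma. *)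
Lemma goodW_sigma a : goodW (sigma a) -> goodW a.
Proof.
move=> g r; have := g r; rewrite W_sigma // mode_sigma.
have A (x y : Chat) : (-1) ^ r *: x = (-1) ^ r *: y -> x = y.
  apply: scalerI; rewrite expfz_neq0 // oppr_eq0 oner_eq0 //.
by rewrite (lin_scale phi_linear); apply: A.
Qed.

Lemma goodW_dD a : goodW a -> goodW (dD a).
Proof.
by move=> g r; rewrite W_dD mode_dD; apply: etrans (lin_scale phi_linear _ _) _; rewrite g.
Qed.

Lemma goodW_k1t s : goodW (k1t F s).
Proof.
move=> r; rewrite W_k1t; apply: etrans (lin_scale phi_linear _ _) _.
have p2 : oddz (2 * s) = false by rewrite /oddz; lia.
have [pr|pr] := boolP (oddz r).
  rewrite C1_out ?inS0E /= ?oddzE ?pr // (lin0 phi_linear) mode_odd ?sigma_k1t //.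
  exact: scaler0.
rewrite phi_C1 ?inS0E /= ?oddzE ?(negbTE pr) ?p2 // /phi_c1 /= addrK mulKz //.
apply: etrans (scalerA _ _ _) _; rewrite mulfV ?pnatr_eq0 //; exact: scale1r.
Qed.

Lemma goodW_kappa s : goodW (kappa F s).
Proof.
move=> r; rewrite W_kappa; apply: etrans (lin_scale phi_linear _ _) _.
have p2 : oddz (2 * s) = false by rewrite /oddz; lia.
have [pr|pr] := boolP (oddz r).
  rewrite C2_out ?inS0E /= ?pr // (lin0 phi_linear) mode_odd ?sigma_kappa //.
  exact: scaler0.
rewrite phi_C2 ?inS0E /= ?(negbTE pr) ?p2 // /phi_c2 /= mulKz //.
apply: etrans (scalerA _ _ _) _; rewrite mulfV ?pnatr_eq0 //; exact: scale1r.
Qed.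

Lemma goodW_bb g o n : goodW (xt F (phi_b g o) n).
Proof.
move=> r; rewrite W_xt.
(* The exceptional case is [X12] or [X21] with odd r: phi has no generator x_+ or x_- in that
   degree, and both sides are 0, because these elements are fixed by sigma. *)
have [/and3P[gA o1 pr]|S] := boolP [&& g != Av, o & oddz r].
  rewrite mode_odd //; last by rewrite sigma_xt; case: g o gA o1 => [] [].
  apply: etrans _ (lin0 phi_linear); congr phi.
  rewrite /wx -[RHS](tc0 F (r, 2 * n + sp4deg (phi_b g o))).
  apply: tc_eq => /=.
  - rewrite inSE /= pr /= => /negbTE; case: g o gA o1 => [] [] //= _ _; rewrite /oddz; lia.
  - by case: g o gA o1 => [] [].
  - by rewrite inS0E /= pr.
have pk : oddz (2 * n + sp4deg (phi_b g o)) = o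
  by case: g {S}; case: o => /=; rewrite /oddz; lia.
have mk : phi_n g (2 * n + sp4deg (phi_b g o)) = n.
  by have := phi_n_deg g (2 * n + sp4deg (phi_b g o)); rewrite pk; lia.
have pgE : phi_gen g (r, 2 * n + sp4deg (phi_b g o)) = phi_k g o *: mode r (xt F (phi_b g o) n).
  by rewrite /phi_gen /= pk mk.
have k0 : phi_k g o != 0.
  have i0 : ii != 0.
    apply: contraTneq (oner_neq0 F) => i0; move: ii2.
    by rewrite i0 mul0r => /eqP; rewrite eq_sym oppr_eq0 => ->.
  by case: g {S pk mk pgE}; case: o => /=; rewrite ?oppr_eq0 ?mulf_neq0 ?pnatr_eq0.
(* Outside the exceptional case the mode is, up to the nonzero factor [phi_k], the image of a
   generator, where psi is already known to invert phi. *)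
have := psi_phi_gen g (r, 2 * n + sp4deg (phi_b g o)).
rewrite pgE (lin_scale (psi_linear ii)) psi_mode // W_xt.
move=> E; apply: (scalerI k0).
apply: etrans (esym (lin_scale phi_linear _ _)) _; rewrite E phi_tgen //.
move=> gA; rewrite inSE /= pk; move: S; rewrite gA /= negb_and => /orP[/negbTE->|/negbTE->] //.
by rewrite andbF.
Qed.

Lemma goodW_xt b n : goodW (xt F b n).
Proof.
have G o g m : goodW (xt F (phi_b g o) m) by exact: goodW_bb.
(* Six basis elements of sp_4 occur in phi. The other four are carried by sigma to a multiple of one
   of these, plus kappa in the case of [XH2]. *)
have [[g [o ->]]|H] : (exists g o, b = phi_b g o) \/
    (exists g o k, sigma_x F b n =
       k *: xt F (phi_b g o) (n + sgm_shift b) + (is_cartan b)%:R *: kappa F n).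
  case: b; [by left; exists Av, false | right; exists Av, false, (-1)
    | by left; exists Xp, false | by left; exists Xm, false
    | right; exists Xm, false, 1 | right; exists Xp, false, 1
    | by left; exists Xp, true | by left; exists Xm, true | by left; exists Av, true
    | right; exists Av, true, (-1)]; by rewrite sigma_xE.
- exact: G.
- apply: goodW_sigma; rewrite sigma_xt; case: H => g [o [k ->]].
  apply: goodW_lin; first exact: G.
  by rewrite -[_ *: _]addr0; apply: goodW_lin; [exact: goodW_kappa | exact: goodW0].
Qed.

Lemma goodW_all a : goodW a.
Proof.
elim: (Cg_span a) => [|_ [[[i g]|[]] ->]|k x y _ gx _ gy]; first exact: goodW0.
- elim: i => [|i IH]; last by rewrite -dD_elt; apply: goodW_dD.
  case: g => [[b n]|[[]|s]]; first exact: goodW_xt.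
  + exact: (goodW_kappa 0).
  + by have := goodW_k1t (val s); rewrite /k1t valK.
- by have := goodW_k1t 0; rewrite /k1t insubN.
- exact: goodW_lin.
Qed.

Lemma psiK y : phi (psi ii y) = y.
Proof.
have l := linear_comp (psi_linear ii) phi_linear.
move: y (Chat_span y); apply: (span_eq_lin l (@linear_id _ _)).
by move=> _ [r [a ->]]; rewrite psi_mode // goodW_all.
Qed.

End Phi.

(** * Compatibility with the brackets *)

Section Hom.
Variable F : numFieldType.
Variable ii : F.
Hypothesis ii2 : ii * ii = -1.
Local Notation Cg := (Cg F).
Local Notation Chat := (Chat F).
Local Notation tkk := (tkk F).

Definition sgn (o : bool) : F := if o then -1 else 1.

(** One coordinate of psi of the bracket of two images of generators, with the degrees replaced by
    their parities so that finitely many cases remain. *)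
Definition coef (o1 o2 q1 q2 : bool) g g' (f : sp4b -> sp4b -> F) : F :=
  phi_k ii g o2 * phi_k ii g' q2 * avg (sgn o1) (sgn q1) f (phi_b g o2) (phi_b g' q2).

Lemma psi_br_gen g g' r t : psi ii (Chat_br (phi_gen ii g r) (phi_gen ii g' t)) =
  let e := sgn (oddz r.1 (+) oddz t.1) in
  let a f := coef (oddz r.1) (oddz r.2) (oddz t.1) (oddz t.2) g g' f in
  tc (r + t) (a (cp ii e)) (a (cm ii e)) (a (ch ii e)) (a (cd1 r.1%:~R)) (a (cd2 r.2%:~R)).
Proof.
have sE (k : int) : (-1) ^ k = sgn (oddz k) by exact: signE.
have sDE : (-1) ^ (r.1 + t.1) = sgn (oddz r.1 (+) oddz t.1) by rewrite sE oddzD.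
have H (x y z : F) : (-1) ^ r.1 = x -> (-1) ^ t.1 = y -> (-1) ^ (r.1 + t.1) = z ->
    psi ii (Chat_br (mode r.1 (xt F (phi_b g (oddz r.2)) (phi_n g r.2)))
                    (mode t.1 (xt F (phi_b g' (oddz t.2)) (phi_n g' t.2)))) =
    let a f := avg x y f (phi_b g (oddz r.2)) (phi_b g' (oddz t.2)) in
    tc (r + t) (a (cp ii z)) (a (cm ii z)) (a (ch ii z)) (a (cd1 r.1%:~R)) (a (cd2 r.2%:~R)).
  by move=> <- <- <-; exact: (psi_br ii r.1 t.1 (phi_n_deg g r.2) (phi_n_deg g' t.2)).
rewrite /phi_gen.
have E (k k' : F) (x y : Chat) :
    psi ii (Chat_br (k *: x) (k' *: y)) = (k * k') *: psi ii (Chat_br x y).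
  have -> : Chat_br (k *: x) (k' *: y) = k *: (k' *: Chat_br x y).
    apply: etrans (lin_scale (Chat_br_linl _) _ _) _; congr (_ *: _).
    exact: lin_scale (Chat_br_linr _) _ _.
  apply: etrans (lin_scale (psi_linear ii) _ _) _.
  apply: etrans (congr1 _ (lin_scale (psi_linear ii) _ _)) _; exact: scalerA.
apply: etrans (E _ _ _ _) _.
apply: etrans (congr1 (fun z => _ *: z) (H _ _ _ (sE _) (sE _) sDE)) _.
exact: tc_scale.
Qed.

(** Once parities and generators are fixed, each claim is a rational identity in [ii] modulo ii^2 =
    -1; a degree occurring in it stays a variable. *)
Ltac solve_coef :=
  rewrite /coef /avg /cp /cm /ch /cd1 /cd2 /lz /sgn /=; by field: ii2.

Lemma coef_p o1 o2 q1 q2 g g' : ~~ (o1 && o2) -> ~~ (q1 && q2) ->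
  ~~ ((o1 (+) q1) && (o2 (+) q2)) ->
  coef o1 o2 q1 q2 g g' (cp ii (sgn (o1 (+) q1))) = sl2lie F g g' Xp.
Proof.
case: o1; case: o2; case: q1; case: q2 => // _ _ _; case: g; case: g'; solve_coef.
Qed.

Lemma coef_m o1 o2 q1 q2 g g' : ~~ (o1 && o2) -> ~~ (q1 && q2) ->
  ~~ ((o1 (+) q1) && (o2 (+) q2)) ->
  coef o1 o2 q1 q2 g g' (cm ii (sgn (o1 (+) q1))) = sl2lie F g g' Xm.
Proof.
case: o1; case: o2; case: q1; case: q2 => // _ _ _; case: g; case: g'; solve_coef.
Qed.

(** In S the coefficient of alpha comes from the bracket of sl_2. In S^perp the product x^r x^t is
    0, and the coefficient comes from the trace term alone. *)
Lemma coef_h r t g g' : inS r -> inS t ->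
  coef (oddz r.1) (oddz r.2) (oddz t.1) (oddz t.2) g g' (ch ii (sgn (oddz r.1 (+) oddz t.1))) =
  if inS (r + t) then sl2lie F g g' Av else sl2tr F g g' * sg F r t / 2.
Proof.
move=> Sr St; rewrite /sg Sr St; move: Sr St; rewrite !inSE /= !oddzD.
case: (oddz r.1); case: (oddz r.2); case: (oddz t.1); case: (oddz t.2) => // _ _;
  case: g; case: g'; solve_coef.
Qed.

Lemma coef_c o1 o2 q1 q2 g g' x : ~~ (o1 && o2) -> ~~ (q1 && q2) ->
  ~~ (o1 (+) q1) && ~~ (o2 (+) q2) ->
  coef o1 o2 q1 q2 g g' (cd1 x) = sl2tr F g g' * x /\
  coef o1 o2 q1 q2 g g' (cd2 x) = sl2tr F g g' * x.
Proof.
case: o1; case: o2; case: q1; case: q2 => // _ _ _; case: g; case: g'; split; solve_coef.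
Qed.

Lemma perp_oddz u : ~~ inS u -> oddz u.1 = true /\ oddz u.2 = true.
Proof. by rewrite inSE negbK => /andP[-> ->]. Qed.

Lemma coef_perpl u t g' : ~~ inS u -> inS t ->
  let a f := coef (oddz u.1) (oddz u.2) (oddz t.1) (oddz t.2) Av g' f in
  let e := sgn (oddz u.1 (+) oddz t.1) in
  [/\ inS (u + t) ->
       a (cp ii e) = (2 * sv F t) *+ (g' == Xp) /\ a (cm ii e) = (2 * sv F t) *+ (g' == Xm),
      a (ch ii e) = (2 * sv F t) *+ (g' == Av) &
      inS0 (u + t) -> a (cd1 u.1%:~R) = 0 /\ a (cd2 u.2%:~R) = 0].
Proof.
move=> /perp_oddz[u1 u2]; rewrite !inSE inS0E /= !oddzD u1 u2 /sv.
case: (oddz t.1); case: (oddz t.2) => // _; split => //;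
  try (move=> _; split); case: g'; rewrite ?mulr1n ?mulr0n; solve_coef.
Qed.

Lemma coef_perpr u t g' : ~~ inS u -> inS t ->
  let a f := coef (oddz t.1) (oddz t.2) (oddz u.1) (oddz u.2) g' Av f in
  let e := sgn (oddz t.1 (+) oddz u.1) in
  [/\ inS (t + u) ->
       a (cp ii e) = (- (2 * sv F t)) *+ (g' == Xp) /\ a (cm ii e) = (- (2 * sv F t)) *+ (g' == Xm),
      a (ch ii e) = (- (2 * sv F t)) *+ (g' == Av) &
      inS0 (t + u) -> a (cd1 t.1%:~R) = 0 /\ a (cd2 t.2%:~R) = 0].
Proof.
move=> /perp_oddz[u1 u2]; rewrite !inSE inS0E /= !oddzD u1 u2 /sv.
case: (oddz t.1); case: (oddz t.2) => // _; split => //;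
  try (move=> _; split); case: g'; rewrite ?mulr1n ?mulr0n; solve_coef.
Qed.

Lemma coef_perp2 u t : ~~ inS u -> ~~ inS t ->
  let a f := coef (oddz u.1) (oddz u.2) (oddz t.1) (oddz t.2) Av Av f in
  let e := sgn (oddz u.1 (+) oddz t.1) in
  [/\ a (cp ii e) = 0, a (cm ii e) = 0, a (ch ii e) = 0,
      a (cd1 u.1%:~R) = - 4 * u.1%:~R & a (cd2 u.2%:~R) = -4 * u.2%:~R].
Proof. move=> /perp_oddz[-> ->] /perp_oddz[-> ->]; split; solve_coef. Qed.

(** Four cases, according to which of r and t lie in S. A degree outside S forces the generator to
    be alpha. *)
Lemma hom_gen g g' r t : (g != Av -> inS r) -> (g' != Av -> inS t) ->
  psi ii (Chat_br (phi_gen ii g r) (phi_gen ii g' t)) = tkk_br (tgen F g r) (tgen F g' t).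
Proof.
move=> Hr Ht; apply: etrans (psi_br_gen _ _ _ _) _.
have [Sr|Sr] := boolP (inS r); have [St|St] := boolP (inS t).
- apply: etrans _ (esym (br_inS _ _ _ Sr St)); apply: tc_eq.
  + rewrite inSE /= !oddzD => S; move: Sr St; rewrite !inSE => Sr St.
    by split; [apply: coef_p | apply: coef_m].
  + exact: coef_h.
  + rewrite inS0E /= !oddzD => S; move: Sr St; rewrite !inSE => Sr St.
    by split; [have [] := coef_c g g' r.1%:~R Sr St S
              | have [] := coef_c g g' r.2%:~R Sr St S].
- have eA : g' = Av by apply/eqP; apply: contraT => /Ht; rewrite (negbTE St).
  subst g'; apply: etrans _ (esym (br_perpr _ g St Sr)); rewrite [t + r]addrC.
  apply: etrans _ (scaleNr _ _); apply: etrans _ (esym (tc_gen _ _ _)).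
  by have [H1 H2 H3] := coef_perpr g St Sr; apply: tc_eq.
- have eA : g = Av by apply/eqP; apply: contraT => /Hr; rewrite (negbTE Sr).
  subst g; apply: etrans _ (esym (br_perpl _ g' Sr St)).
  apply: etrans _ (esym (tc_gen _ _ _)).
  by have [H1 H2 H3] := coef_perpl g' Sr St; apply: tc_eq.
- have eA : g' = Av by apply/eqP; apply: contraT => /Ht; rewrite (negbTE St).
  have eA' : g = Av by apply/eqP; apply: contraT => /Hr; rewrite (negbTE Sr).
  subst g g'; apply: etrans _ (esym (br_perp2 _ Sr St)).
  have [H1 H2 H3 H4 H5] := coef_perp2 Sr St.
  apply: (etrans (y := tc (r + t) 0 0 0 (- 4 * r.1%:~R) (- 4 * r.2%:~R))).
    by apply: tc_eq.
  have A (V : lmodType F) (x y z c1 c2 : V) (k m n : F) :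
      0 *: x + 0 *: y + 0 *: z + (k * m) *: c1 + (k * n) *: c2 = k *: (m *: c1 + n *: c2).
    by rewrite !scale0r !add0r scalerDr !scalerA.
  exact: A.
Qed.

Lemma nvan_tpartl r (a b : Cg) : sigma a = a -> nvan a b 0 -> nvan (tpart r a) b 0.
Proof.
move=> sa v n n0; rewrite /tpart sa (lin_scale (nprod_linl _ _)) (lin_add (nprod_linl _ _)).
by rewrite (lin_scale (nprod_linl _ _)) v // !scaler0 addr0 scaler0.
Qed.

Lemma nvan_tpartr r (a b : Cg) : sigma a = a -> nvan b a 0 -> nvan b (tpart r a) 0.
Proof.
move=> sa v n n0; rewrite /tpart sa (lin_scale (nprod_linr _ _)) (lin_add (nprod_linr _ _)).
by rewrite (lin_scale (nprod_linr _ _)) v // !scaler0 addr0 scaler0.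
Qed.

Lemma mode_cent r (a : Cg) : sigma a = a -> (forall b, nvan a b 0) -> (forall b, nvan b a 0) ->
  forall y : Chat, Chat_br (mode r a) y = 0 /\ Chat_br y (mode r a) = 0.
Proof.
move=> sa v1 v2 y; split.
  apply: (span_lin0 (Chat_br_linr _)) (Chat_span y) => _ [s [b ->]].
  by rewrite Chat_br_mode mbr_van //; apply: nvan_tpartl.
apply: (span_lin0 (Chat_br_linl _)) (Chat_span y) => _ [s [b ->]].
by rewrite Chat_br_mode mbr_van //; apply: nvan_tpartr.
Qed.

Lemma scale_cent (k : F) (x : Chat) :
  (forall y : Chat, Chat_br x y = 0 /\ Chat_br y x = 0) ->
  forall y : Chat, Chat_br (k *: x) y = 0 /\ Chat_br y (k *: x) = 0.
Proof.
move=> H y; have [H1 H2] := H y; split.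
  by apply: etrans (lin_scale (Chat_br_linl _) _ _) _; rewrite H1; apply: scaler0.
by apply: etrans (lin_scale (Chat_br_linr _) _ _) _; rewrite H2; apply: scaler0.
Qed.

Lemma phi_c1_cent u (y : Chat) : Chat_br (phi_c1 F u) y = 0 /\ Chat_br y (phi_c1 F u) = 0.
Proof.
apply: scale_cent y; apply: mode_cent; first exact: sigma_k1t.
- by move=> b; have [] := nvan_centl (u.2 %/ 2)%Z b.
- by move=> b; have [] := nvan_centr (u.2 %/ 2)%Z b.
Qed.

Lemma phi_c2_cent u (y : Chat) : Chat_br (phi_c2 F u) y = 0 /\ Chat_br y (phi_c2 F u) = 0.
Proof.
apply: scale_cent y; apply: mode_cent; first exact: sigma_kappa.
- by move=> b; have [] := nvan_centl (u.2 %/ 2)%Z b.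
- by move=> b; have [] := nvan_centr (u.2 %/ 2)%Z b.
Qed.

Lemma phi_hom x y : phi ii (tkk_br x y) = Chat_br (phi ii x) (phi ii y).
Proof.
(* Applying phi to this identity gives the claim, as phi inverts psi. *)
suff E : psi ii (Chat_br (phi ii x) (phi ii y)) = tkk_br x y by rewrite -E psiK.
have lp := phi_linear ii; have ls := psi_linear ii.
move: x y (tkk_span x) (tkk_span y).
apply: (@span_eq_lin2 _ _ _ _ _ _
  (fun x y => psi ii (Chat_br (phi ii x) (phi ii y))) (@tkk_br F)).
- move=> y; exact: linear_comp (linear_comp lp (Chat_br_linl (phi ii y))) ls.
- exact: tkk_br_linl.
- move=> x; exact: linear_comp (linear_comp lp (Chat_br_linr (phi ii x))) ls.
- exact: tkk_br_linr.
have c1 u : (C1_ F u = 0) \/ phi ii (C1_ F u) = phi_c1 F u.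
  by have [S|S] := boolP (inS0 u); [right; apply: phi_C1 | left; apply: C1_out].
have c2 u : (C2_ F u = 0) \/ phi ii (C2_ F u) = phi_c2 F u.
  by have [S|S] := boolP (inS0 u); [right; apply: phi_C2 | left; apply: C2_out].
have z0 : psi ii 0 = 0 by exact: lin0 ls.
have p0 : phi ii 0 = 0 by exact: lin0 lp.
(* C_1 and C_2 and their images are central, so with such an argument both sides are 0. *)
have cl x q : x = 0 \/ phi ii x = phi_c1 F q \/ phi ii x = phi_c2 F q ->
    forall y, psi ii (Chat_br (phi ii x) y) = 0 /\ psi ii (Chat_br y (phi ii x)) = 0.
  move=> H y; have [-> ->] : Chat_br (phi ii x) y = 0 /\ Chat_br y (phi ii x) = 0; last by [].
  case: H => [->|[->|->]].
  - by rewrite p0; split; [exact: lin0 (Chat_br_linl y) | exact: lin0 (Chat_br_linr y)].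
  - exact: phi_c1_cent.
  - exact: phi_c2_cent.
move=> x y Hx Hy.
have [[g [r [Hr ->]]]|[r Ex]] : (exists g r, (g != Av -> inS r) /\ x = tgen F g r) \/
    (exists r, x = C1_ F r \/ x = C2_ F r).
- by case: Hx => [?|[r ?]|[r ?]]; [left | right; exists r; left | right; exists r; right].
- have [[g' [t [Ht ->]]]|[t Ey]] : (exists g r, (g != Av -> inS r) /\ y = tgen F g r) \/
      (exists r, y = C1_ F r \/ y = C2_ F r).
  + by case: Hy => [?|[t ?]|[t ?]]; [left | right; exists t; left | right; exists t; right].
  + by rewrite !phi_tgen //; apply: hom_gen.
  + have [-> ->] : psi ii (Chat_br (phi ii (tgen F g r)) (phi ii y)) = 0 /\
        tkk_br (tgen F g r) y = 0; last by [].
    split.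
      by have [] := cl y t _ (phi ii (tgen F g r)); first by case: Ey => ->;
        [case: (c1 t) => ->; auto | case: (c2 t) => ->; auto].
    by case: Ey => ->; [have [] := C1_cent t (tgen F g r) | have [] := C2_cent t (tgen F g r)].
- have [-> ->] : psi ii (Chat_br (phi ii x) (phi ii y)) = 0 /\ tkk_br x y = 0; last by [].
  split.
    by have [] := cl x r _ (phi ii y); first by case: Ex => ->;
      [case: (c1 r) => ->; auto | case: (c2 r) => ->; auto].
  by case: Ex => ->; [have [] := C1_cent r y | have [] := C2_cent r y].
Qed.

End Hom.

HB.instance Definition _ (F : numFieldType) (ii : F) :=
  GRing.isLinear.Build F (tkk F) (Chat F) *:%R (phi ii) (phi_linear ii).

Theorem proposition4p3 (R : realType) :
  let C : numClosedFieldType := R[i] in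
  exists phi : {linear tkk C -> Chat C},
    [/\ [/\ forall (m n : int) (j : bool),
              phi (xp_ _ (2 * m + j%:Z, 2 * n))
              = 2 *: mode (2 * m + j%:Z) (xt _ X13 n)
          & forall m n : int,
              phi (xp_ _ (2 * m, 2 * n + 1))
              = 'i *: mode (2 * m) (xt _ X12 (n + 1))],
        [/\ forall (m n : int) (j : bool),
              phi (xm_ _ (2 * m + j%:Z, 2 * n))
              = 2 *: mode (2 * m + j%:Z) (xt _ X31 n)
          & forall m n : int,
              phi (xm_ _ (2 * m, 2 * n + 1))
              = - 'i *: mode (2 * m) (xt _ X21 n)],
        [/\ forall (m n : int) (j : bool),
              phi (av_ _ (2 * m + j%:Z, 2 * n))
              = 2 *: mode (2 * m + j%:Z) (xt _ XH1 n)
          & forall (m n : int) (j : bool),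
              phi (av_ _ (2 * m + j%:Z, 2 * n + 1))
              = (2 * 'i) *: mode (2 * m + j%:Z) (xt _ X14 n)],
        [/\ forall m n : int,
              phi (C1_ _ (2 * m, 2 * n)) = 2^-1 *: mode (2 * (m - 1)) (k1t _ n),
            forall m : int,
              phi (C2_ _ (2 * m, 0)) = 2^-1 *: mode (2 * m) (k2 _)
          & forall m s : int, s != 0 ->
              phi (C2_ _ (2 * m, 2 * s))
              = - (m%:~R / (2 * s%:~R)) *: mode (2 * (m - 1)) (k1t _ s)]
      & bijective phi /\
        {morph phi : x y / tkk_br x y >-> Chat_br x y}].
Proof.
move=> C; have i2 : ('i : C) * 'i = -1 by rewrite -expr2 sqrCi.
have pze (n : int) : oddz (2 * n) = false by rewrite /oddz; lia.
have pzo (n : int) : oddz (2 * n + 1) = true by rewrite /oddz; lia.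
have Se m n : inS (m, 2 * n) by rewrite inSE /= pze andbF.
have So m n : inS (2 * m, n) by rewrite inSE /= pze.
have He (n : int) : (2 * n %/ 2)%Z = n by rewrite mulKz.
have Ho (n : int) : ((2 * n + 1) %/ 2)%Z = n by lia.
have S0 m n : inS0 (2 * m, 2 * n) by rewrite inS0E /= !pze.
exists (phi ('i : C)); split; [split | split | split | split | split].
- move=> m n j; apply: etrans (phi_tgen 'i (b := Xp) (fun=> Se _ _)) _.
  by rewrite /phi_gen /phi_n /= pze He addr0.
- move=> m n; apply: etrans (phi_tgen 'i (b := Xp) (fun=> So _ _)) _.
  by rewrite /phi_gen /phi_n /= pzo Ho.
- move=> m n j; apply: etrans (phi_tgen 'i (b := Xm) (fun=> Se _ _)) _.
  by rewrite /phi_gen /phi_n /= pze He addr0.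
- move=> m n; apply: etrans (phi_tgen 'i (b := Xm) (fun=> So _ _)) _.
  by rewrite /phi_gen /phi_n /= pzo Ho addr0.
- move=> m n j; apply: etrans (phi_tgen 'i (b := Av) (fun=> Se _ _)) _.
  by rewrite /phi_gen /phi_n /= pze He addr0.
(* For j = 1 the degree lies outside S. The side condition of [phi_tgen] constrains only x_+ and
   x_-. *)
- move=> m n j; apply: etrans (@phi_tgen _ 'i Av (_, _) _) _; first by [].
  by rewrite /phi_gen /phi_n /= pzo Ho addr0.
- move=> m n; apply: etrans (phi_C1 'i (S0 m n)) _.
  by rewrite /phi_c1 /= He mulrBr mulr1.
(* Writing 0 as 2 * 0 brings the degree into the form handled by [S0]; kappa at 0 is then k_2. *)
- move=> m; apply: etrans (_ : _ = phi 'i (C2_ C (2 * m, 2 * 0))) _; first by rewrite mulr0.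
  by apply: etrans (phi_C2 'i (S0 m 0)) _; rewrite /phi_c2 /= He.
- move=> m s s0; apply: etrans (phi_C2 'i (S0 m s)) _.
  (* The coefficient is the product of 1/2 from [phi_c2], 1/s from kappa and - (2m)/2 from removing
     D. *)
  rewrite /phi_c2 /= He /kappa (negbTE s0) (lin_scale (mode_linear _)) mode_dD mulrBr mulr1.
  apply: etrans (scalerA _ _ _) _; apply: etrans (scalerA _ _ _) _; congr (_ *: _).
  by rewrite intrM; field; rewrite intr_eq0.
- by exists (psi 'i); [exact: phiK | exact: psiK].
- exact: phi_hom.
Qed.
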